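(* Let $r,n\ge1$, let $k$ be a field containing a primitive $r$-th root of unity $\zeta$, let $I\subseteq k$ with $I_1$ connected, $J=\{0,1,\dots,r-1\}$, $K=I\times J$, and let $\Gamma=\coprod_{j\in J}I_1$. With $H_n(\Gamma)$, $\widehat{Y}_{r,n}^{k}(1)$, $\mathcal{C}_\Gamma^0$, $\bar{\mathcal{C}}_K$ and $e(\nu,j)$ as defined in the context, the following holds. There is an equivalence of categories $\bar\Phi:\mathcal{C}_\Gamma^0\to\bar{\mathcal{C}}_K$ given by $M\mapsto M$ (same underlying space), where for each $\alpha=(\nu,j)\in K^n$: $t_a$ acts on $1_\alpha M$ by $\zeta^{j_a}$ and $y_a$ acts on $1_\alpha M$ by $x_a+\nu_a$ for $1\le a\le n$, and $f_i$ acts on $1_\alpha M$ by $\tau_iq_i(\nu,j)-p_i(\nu,j)$ for $1\le i\le n-1$, where $$q_i(\nu,j)=\begin{cases}x_{i+1}-x_i+1&\text{if } j_i=j_{i+1},\ \nu_i=\nu_{i+1},\\ (x_i-x_{i+1}-1)^{-1}&\text{if } j_i=j_{i+1},\ \nu_{i+1}=\nu_i+1,\\ \dfrac{x_{i+1}-x_i+\nu_{i+1}-\nu_i-1}{x_i-x_{i+1}+\nu_i-\nu_{i+1}}&\text{if } j_i=j_{i+1},\ \text{otherwise},\\ 1&\text{if } j_i\ne j_{i+1},\end{cases}$$ $$p_i(\nu,j)=\begin{cases}1&\text{if } j_i=j_{i+1},\ \nu_i=\nu_{i+1},\\ \dfrac{1}{x_i-x_{i+1}+\nu_i-\nu_{i+1}}&\text{if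 } j_i=j_{i+1},\ \nu_i\neq\nu_{i+1},\\ 0&\text{if } j_i\ne j_{i+1}.\end{cases}$$ The inverse functor $\bar\Psi:\bar{\mathcal{C}}_K\to\mathcal{C}_\Gamma^0$ is given by $N\mapsto N$, where for each $\alpha=(\nu,j)\in K^n$: $1_\alpha$ acts on $N$ by $e(\nu,j)$, $x_a$ acts on $N_\alpha$ by $y_a-\nu_a$ for $1\le a\le n$, and $\tau_i$ acts on $N_\alpha$ by $\varphi_iq_i'(\nu,j)^{-1}=(f_i+p_i'(\nu,j))q_i'(\nu,j)^{-1}$ for $1\le i\le n-1$. Here $p_i'(\nu,j)$ and $q_i'(\nu,j)$ are obtained from $p_i(\nu,j)$ and $q_i(\nu,j)$ by replacing each $x_a$ by $y_a-\nu_a$, and $$\varphi_i=f_i+\sum_{\substack{(\nu,j)\in K^n\\ \nu_i\ne\nu_{i+1},\ j_i=j_{i+1}}}(y_i-y_{i+1})^{-1}e(\nu,j)+\sum_{\substack{(\nu,j)\in K^n\\ \nu_i=\nu_{i+1},\ j_i=j_{i+1}}}e(\nu,j).$$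
   Context: Quiver. $I_1$ is the quiver with vertex set $I\subseteq k$ and an arrow $i\to i+1$ whenever $i,i+1\in I$. $\Gamma$ is the disjoint union of $r$ copies of $I_1$: its vertex set is $K=I\times J$, and there is an arrow $(i,j)\to(i',j')$ iff $j=j'$ and $i\to i'$ in $I_1$. For $\kappa,\kappa'\in K$ write $\kappa\rightleftarrows\kappa'$ if both $\kappa\to\kappa'$ and $\kappa'\to\kappa$; in case distinctions ''$\kappa\to\kappa'$'' (resp. ''$\kappa\leftarrow\kappa'$'') means there is an arrow in that direction only. Write $\kappa\not\!-\,\kappa'$ if $\kappa\ne\kappa'$ and there is no arrow between them. $\mathfrak{S}_n$ acts on $K^n=I^n\times J^n$ by permuting places; $s_i=(i,i+1)$. Elements of $K^n$ are written $\alpha=(\nu,j)$ with $\alpha_a=(\nu_a,j_a)$. Quiver Hecke algebra. $H_n(\Gamma)$ is the (possibly non-unital) $k$-algebra with generators $1_\alpha$ ($\alpha\in K^n$), $x_a$ ($1\le a\le n$), $\tau_i$ ($1\le i\le n-1$) and relations: $1_\alpha1_{\alpha'}=\delta_{\alpha,\alpha'}1_\alpha$, $\sum_{\alpha}1_\alpha=1$; $\tau_i1_\alpha=1_{s_i(\alpha)}\tau_i$, $x_a1_\alpha=1_\alpha x_a$; $x_ax_b=x_bx_a$; $\tau_i\tau_l=\tau_l\tau_i$ if $|i-l|\ge2$; $\tau_ix_a1_\alpha-x_{s_i(a)}\tau_i1_\alpha=-1_\alpha$ if $a=i$ and $\alpha_i=\alpha_{i+1}$, $=1_\alpha$ if $a=i+1$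 and $\alpha_i=\alpha_{i+1}$, $=0$ otherwise; $\tau_i^21_\alpha=Q_{\alpha_i,\alpha_{i+1}}(x_i,x_{i+1})1_\alpha$; $\tau_{i+1}\tau_i\tau_{i+1}1_\alpha-\tau_i\tau_{i+1}\tau_i1_\alpha=(x_{i+2}-x_i)^{-1}\big(Q_{\alpha_i,\alpha_{i+1}}(x_{i+2},x_{i+1})-Q_{\alpha_i,\alpha_{i+1}}(x_i,x_{i+1})\big)1_\alpha$ if $\alpha_i=\alpha_{i+2}$, and $=0$ otherwise. Here $Q_{\kappa,\kappa'}(u,v)=0$ if $\kappa=\kappa'$; $1$ if $\kappa\not\!-\,\kappa'$; $v-u$ if $\kappa\to\kappa'$; $u-v$ if $\kappa\leftarrow\kappa'$; $-(u-v)^2$ if $\kappa\rightleftarrows\kappa'$. When $K$ is infinite, $\sum_\alpha1_\alpha=1$ is understood as: the $1_\alpha$ form a system of local units, and every module $M$ satisfies $M=\bigoplus_\alpha1_\alpha M$. $\mathcal{C}_\Gamma^0$ is the category of finitely generated $H_n(\Gamma)$-modules $M$ such that for every $\alpha\in K^n$ and $1\le a\le n$, $x_a1_\alpha$ acts locally nilpotently on $1_\alpha M$. (So power series in $x_1,\dots,x_n$ act on each $1_\alpha M$.) Degenerate affine Yokonuma-Hecke algebra. $\widehat{Y}_{r,n}^{k}(1)$ is the $k$-algebra generated by $t_1,\dots,t_n,f_1,\dots,f_{n-1},y_1,\dots,y_n$ with relations: $f_if_l=f_lf_i$ if $|i-l|\ge2$; $f_if_{i+1}f_i=f_{i+1}f_if_{i+1}$;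 $t_it_l=t_lt_i$; $f_it_l=t_{s_i(l)}f_i$; $t_i^r=1$; $f_i^2=1$; $y_iy_l=y_ly_i$; $f_iy_{i+1}=y_if_i+e_i$, where $e_i=\frac1r\sum_{s=0}^{r-1}t_i^st_{i+1}^{-s}$ ($r$ is invertible in $k$); $f_iy_l=y_lf_i$ for $l\ne i,i+1$; $t_ly_i=y_it_l$ for all $i,l$. For a $\widehat{Y}_{r,n}^{k}(1)$-module $N$ and $\alpha=(\nu,j)\in K^n$, $N_\alpha=N(\nu,j)$ is the subspace on which, for all $1\le a\le n$, $y_a-\nu_a$ acts locally nilpotently and $t_a-\zeta^{j_a}$ acts as zero. $\bar{\mathcal{C}}_K$ is the category of finitely generated $\widehat{Y}_{r,n}^{k}(1)$-modules $N$ with $N=\bigoplus_{\alpha\in K^n}N_\alpha$. For $N\in\bar{\mathcal{C}}_K$, $e(\nu,j)$ denotes the projection of $N$ onto $N(\nu,j)$ along the other weight spaces. *)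

(* Defs.v *)
From HB Require Import structures.
From mathcomp Require Import all_boot all_order perm all_algebra.
From mathcomp Require Import mpoly.
From mathcomp Require Import boolp classical_sets cardinality fsbigop.

Set Implicit Arguments.
Unset Strict Implicit.
Unset Printing Implicit Defensive.

Import GRing.Theory.
Local Open Scope ring_scope.
Local Open Scope quotient_scope.

Record category := Category {
  obj :> Type;
  hom : obj -> obj -> Type;
  idc : forall X, hom X X;
  compc : forall X Y Z, hom Y Z -> hom X Y -> hom X Z;
  compc_idl : forall X Y (f : hom X Y), compc (idc Y) f = f;
  compc_idr : forall X Y (f : hom X Y), compc f (idc X) = f;
  compcA : forall X Y Z T (h : hom Z T) (g : hom Y Z) (f : hom X Y),
    compc h (compc g f) = compc (compc h g) f }.

Arguments hom {c} X Y.
Arguments idc {c} X.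

Record functor (C D : category) := Functor {
  fobj :> C -> D;
  fmap : forall X Y : C, hom X Y -> hom (fobj X) (fobj Y);
  fmap_id : forall X : C, fmap (idc X) = idc (fobj X);
  fmap_comp : forall (X Y Z : C) (g : hom Y Z) (f : hom X Y),
    fmap (compc g f) = compc (fmap g) (fmap f) }.

Definition functor_id (C : category) : functor C C :=
  @Functor C C id (fun _ _ f => f) (fun _ => erefl) (fun _ _ _ _ _ => erefl).

Lemma functor_comp_id (C D E : category) (G : functor D E) (F : functor C D) X :
  fmap G (fmap F (idc X)) = idc (G (F X)).
Proof. by rewrite !fmap_id. Qed.

Lemma functor_comp_comp (C D E : category) (G : functor D E) (F : functor C D)
    (X Y Z : C) (g : hom Y Z) (f : hom X Y) :
  fmap G (fmap F (compc g f)) = compc (fmap G (fmap F g)) (fmap G (fmap F f)).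
Proof. by rewrite !fmap_comp. Qed.

Definition functor_comp (C D E : category) (G : functor D E) (F : functor C D) :
    functor C E :=
  @Functor C E (fun X => G (F X)) (fun _ _ f => fmap G (fmap F f))
    (functor_comp_id G F) (functor_comp_comp G F).

Record nat_iso (C D : category) (F G : functor C D) := NatIso {
  component :> forall X : C, hom (F X) (G X);
  component_inv : forall X : C, hom (G X) (F X);
  componentK : forall X, compc (component_inv X) (component X) = idc (F X);
  component_invK : forall X, compc (component X) (component_inv X) = idc (G X);
  naturality : forall (X Y : C) (f : hom X Y),
    compc (component Y) (fmap F f) = compc (fmap G f) (component X) }.

(* Associative, not necessarily unital, algebras given by a presentation.     *)
(* The algebra on the generators G subject to the relations u = v for rel u v *)
(* is the quotient of the formal expressions in G by the least congruence     *)
(* containing rel and the axioms of an associative k-algebra.                 *)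

Inductive term (k G : Type) :=
  | Gen of G
  | Zero
  | Add of term k G & term k G
  | Opp of term k G
  | Scale of k & term k G
  | Mul of term k G & term k G.

Arguments Gen {k G}.
Arguments Zero {k G}.
Arguments Add {k G}.
Arguments Opp {k G}.
Arguments Scale {k G}.
Arguments Mul {k G}.

Declare Scope expr_scope.
Delimit Scope expr_scope with expr.
Bind Scope expr_scope with term.
Notation "0" := Zero : expr_scope.
Infix "+" := Add : expr_scope.
Notation "- u" := (Opp u) : expr_scope.
Notation "u - v" := (Add u (Opp v)) : expr_scope.
Infix "*" := Mul : expr_scope.
Infix "*:" := Scale : expr_scope.

HB.instance Definition _ (k G : Type) := gen_eqMixin (term k G).
HB.instance Definition _ (k G : Type) := gen_choiceMixin (term k G).

Section Presentation.
Variables (k : fieldType) (G : Type) (rel : term k G -> term k G -> Prop).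
Implicit Types (u v w : term k G) (a b : k).

Inductive cong : term k G -> term k G -> Prop :=
  | cong_rel u v : rel u v -> cong u v
  | cong_refl u : cong u u
  | cong_sym u v : cong u v -> cong v u
  | cong_trans u v w : cong u v -> cong v w -> cong u w
  | cong_add u u' v v' : cong u u' -> cong v v' -> cong (u + v)%expr (u' + v')%expr
  | cong_opp u u' : cong u u' -> cong (- u)%expr (- u')%expr
  | cong_scale a u u' : cong u u' -> cong (a *: u)%expr (a *: u')%expr
  | cong_mul u u' v v' : cong u u' -> cong v v' -> cong (u * v)%expr (u' * v')%expr
  | cong_addA u v w : cong (u + (v + w))%expr ((u + v) + w)%expr
  | cong_addC u v : cong (u + v)%expr (v + u)%expr
  | cong_add0 u : cong (0 + u)%expr u
  | cong_addN u : cong (- u + u)%expr 0%expr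
  | cong_scaleA a b u : cong (a *: (b *: u))%expr ((a * b)%R *: u)%expr
  | cong_scale1 u : cong (1%R *: u)%expr u
  | cong_scaleDr a u v : cong (a *: (u + v))%expr (a *: u + a *: v)%expr
  | cong_scaleDl a b u : cong ((a + b)%R *: u)%expr (a *: u + b *: u)%expr
  | cong_mulA u v w : cong (u * (v * w))%expr ((u * v) * w)%expr
  | cong_mulDl u v w : cong ((u + v) * w)%expr (u * w + v * w)%expr
  | cong_mulDr u v w : cong (u * (v + w))%expr (u * v + u * w)%expr
  | cong_mulZl a u v : cong ((a *: u) * v)%expr (a *: (u * v))%expr
  | cong_mulZr a u v : cong (u * (a *: v))%expr (a *: (u * v))%expr.

Definition congb u v := `[< cong u v >].

Lemma congb_refl : reflexive congb.
Proof. by move=> u; apply/asboolP/cong_refl. Qed.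

Lemma congb_sym : ssrbool.symmetric congb.
Proof.
by move=> u v; apply/asboolP/asboolP => /cong_sym.
Qed.

Lemma congb_trans : transitive congb.
Proof.
by move=> v u w /asboolP uv /asboolP vw; apply/asboolP/(cong_trans uv vw).
Qed.

Canonical congb_equiv := EquivRel congb congb_refl congb_sym congb_trans.

Definition presented := {eq_quot congb}.
HB.instance Definition _ := Choice.on presented.
HB.instance Definition _ := Quotient.on presented.

Definition pi_alg (u : term k G) : presented := \pi_presented u.

Lemma pi_algP u v : pi_alg u = pi_alg v <-> cong u v.
Proof.
by split=> [/eqmodP/asboolP|uv]; last by apply/eqmodP/asboolP.
Qed.

Lemma pi_alg_surj (x : presented) : {u | x = pi_alg u}.
Proof. by exists (repr x); rewrite /pi_alg reprK. Qed.

Lemma repr_cong u : cong (repr (pi_alg u)) u.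
Proof. by apply/pi_algP; rewrite /pi_alg reprK. Qed.

Definition palg_add (x y : presented) := pi_alg (repr x + repr y)%expr.
Definition palg_opp (x : presented) := pi_alg (- repr x)%expr.
Definition palg_scale a (x : presented) := pi_alg (a *: repr x)%expr.
Definition palg_mul (x y : presented) := pi_alg (repr x * repr y)%expr.

Lemma pi_add u v : palg_add (pi_alg u) (pi_alg v) = pi_alg (u + v)%expr.
Proof. by apply/pi_algP/cong_add; apply: repr_cong. Qed.

Lemma pi_opp u : palg_opp (pi_alg u) = pi_alg (- u)%expr.
Proof. by apply/pi_algP/cong_opp/repr_cong. Qed.

Lemma pi_scale a u : palg_scale a (pi_alg u) = pi_alg (a *: u)%expr.
Proof. by apply/pi_algP/cong_scale/repr_cong. Qed.

Lemma pi_mul u v : palg_mul (pi_alg u) (pi_alg v) = pi_alg (u * v)%expr.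
Proof. by apply/pi_algP/cong_mul; apply: repr_cong. Qed.

Local Ltac lift_cong lem :=
  repeat (let x := fresh "x" in let u := fresh "u" in
          move=> x; have [u ->] := pi_alg_surj x; clear x);
  rewrite ?(pi_add, pi_opp, pi_scale, pi_mul);
  apply/pi_algP; apply: lem.

Fact palg_addA : associative palg_add. Proof. lift_cong cong_addA. Qed.
Fact palg_addC : commutative palg_add. Proof. lift_cong cong_addC. Qed.
Fact palg_add0 : left_id (pi_alg 0%expr) palg_add.
Proof. lift_cong cong_add0. Qed.
Fact palg_addN : left_inverse (pi_alg 0%expr) palg_opp palg_add.
Proof. lift_cong cong_addN. Qed.

HB.instance Definition _ := GRing.isZmodule.Build presented
  palg_addA palg_addC palg_add0 palg_addN.

Lemma pi_algD u v : pi_alg u + pi_alg v = pi_alg (u + v)%expr.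
Proof. exact: pi_add. Qed.

Local Ltac lift_congD lem :=
  repeat (let x := fresh "x" in let u := fresh "u" in
          move=> x; have [u ->] := pi_alg_surj x; clear x);
  rewrite !(pi_algD, pi_scale, pi_mul); apply/pi_algP; apply: lem.

Fact palg_scaleA a b x : palg_scale a (palg_scale b x) = palg_scale (a * b) x.
Proof. move: x; lift_cong cong_scaleA. Qed.
Fact palg_scale1 : left_id 1 palg_scale. Proof. lift_cong cong_scale1. Qed.
Fact palg_scaleDr : right_distributive palg_scale +%R.
Proof. move=> a; lift_congD cong_scaleDr. Qed.
Fact palg_scaleDl x : {morph palg_scale^~ x : a b / a + b}.
Proof. move=> a b; move: x; lift_congD cong_scaleDl. Qed.

HB.instance Definition _ := GRing.Zmodule_isLmodule.Build k presented
  palg_scaleA palg_scale1 palg_scaleDr palg_scaleDl.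

Lemma pi_algZ a u : a *: pi_alg u = pi_alg (a *: u)%expr.
Proof. exact: pi_scale. Qed.

Local Ltac lift_congZ lem :=
  repeat (let x := fresh "x" in let u := fresh "u" in
          move=> x; have [u ->] := pi_alg_surj x; clear x);
  rewrite !(pi_algZ, pi_mul); apply/pi_algP; apply: lem.

Lemma palg_mulA : associative palg_mul. Proof. lift_cong cong_mulA. Qed.
Lemma palg_mulDl : left_distributive palg_mul +%R.
Proof. lift_congD cong_mulDl. Qed.
Lemma palg_mulDr : right_distributive palg_mul +%R.
Proof. lift_congD cong_mulDr. Qed.
Lemma palg_mulZl a x y : palg_mul (a *: x) y = a *: palg_mul x y.
Proof. move: x y; lift_congZ cong_mulZl. Qed.
Lemma palg_mulZr a x y : palg_mul x (a *: y) = a *: palg_mul x y.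
Proof. move: x y; lift_congZ cong_mulZr. Qed.

End Presentation.

(* Modules over an algebra (A, mul), and full subcategories of modules *)

Section Modules.
Variables (k : fieldType) (A : lmodType k) (mul : A -> A -> A).

Definition is_module (V : lmodType k) (act : A -> V -> V) : Prop :=
  [/\ forall a, linear (act a),
      forall v, linear (act^~ v) &
      forall a b v, act (mul a b) v = act a (act b v)].

Definition finitely_generated (V : lmodType k) (act : A -> V -> V) : Prop :=
  exists s : seq V, forall v, exists c : 'I_(size s) -> A,
    v = \sum_(i < size s) act (c i) s`_i.

End Modules.

Definition action_class (k : fieldType) (A : lmodType k) :=
  forall V : lmodType k, (A -> V -> V) -> Prop.

Section ModuleCategory.
Variables (k : fieldType) (A : lmodType k) (C : action_class A).

Record modobj := ModObj {
  carrier :> lmodType k;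
  mact : A -> carrier -> carrier;
  mactP : C mact }.

Record modhom (M N : modobj) := ModHom {
  modfun :> M -> N;
  modfun_linear : linear modfun;
  modfun_act : forall a v, modfun (mact a v) = mact a (modfun v) }.

Lemma modhom_ext (M N : modobj) (f g : modhom M N) : f =1 g -> f = g.
Proof.
case: f g => [f fl fa] [g gl ga] /= /funext fg.
by subst g; congr ModHom; apply: Prop_irrelevance.
Qed.

Definition modhom_id (M : modobj) : modhom M M :=
  @ModHom M M id (fun _ _ _ => erefl) (fun _ _ => erefl).

Section Comp.
Variables (M N P : modobj) (g : modhom N P) (f : modhom M N).

Fact modcomp_linear : linear (fun v => g (f v)).
Proof. by move=> a u v; rewrite !modfun_linear. Qed.

Fact modcomp_act a v : g (f (mact a v)) = mact a (g (f v)).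
Proof. by rewrite !modfun_act. Qed.

Definition modhom_comp : modhom M P := ModHom modcomp_linear modcomp_act.
End Comp.

Fact modhom_comp1c (M N : modobj) (f : modhom M N) :
  modhom_comp (modhom_id N) f = f.
Proof. exact: modhom_ext. Qed.

Fact modhom_compc1 (M N : modobj) (f : modhom M N) :
  modhom_comp f (modhom_id M) = f.
Proof. exact: modhom_ext. Qed.

Fact modhom_compA (M N P L : modobj)
    (h : modhom P L) (g : modhom N P) (f : modhom M N) :
  modhom_comp h (modhom_comp g f) = modhom_comp (modhom_comp h g) f.
Proof. exact: modhom_ext. Qed.

Definition module_category : category :=
  Category modhom_comp1c modhom_compc1 modhom_compA.

Definition underlying (M N : module_category) (f : hom M N) :
  carrier M -> carrier N := modfun f.

End ModuleCategory.

(* Functors of the form "M |-> M, f |-> f": such a functor keeps the          *)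
(* underlying vector space and linear maps and only replaces the A-action by  *)
(* a B-action.                                                                *)
Section SameSpace.
Variables (k : fieldType) (A B : lmodType k).
Variables (C : action_class A) (D : action_class B).

Record same_space_functor := SameSpaceFunctor {
  new_act : forall M : module_category C, B -> carrier M -> carrier M;
  new_actP : forall M : module_category C, D (@new_act M);
  new_act_hom : forall (M N : module_category C) (f : hom M N) b v,
    underlying f (new_act b v) = new_act b (underlying f v) }.

Variable F : same_space_functor.

Definition ss_obj (M : module_category C) : module_category D :=
  ModObj (new_actP F M).

Definition ss_map (M N : module_category C) (f : hom M N) :
    hom (ss_obj M) (ss_obj N) :=
  @ModHom _ _ _ (ss_obj M) (ss_obj N) (underlying f) (modfun_linear f)
    (new_act_hom F f).

Fact ss_map_id (M : module_category C) : ss_map (idc M) = idc (ss_obj M).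
Proof. exact: modhom_ext. Qed.

Fact ss_map_comp (M N P : module_category C) (g : hom N P) (f : hom M N) :
  ss_map (compc g f) = compc (ss_map g) (ss_map f).
Proof. exact: modhom_ext. Qed.

Definition ss_functor : functor (module_category C) (module_category D) :=
  Functor ss_map_id ss_map_comp.

End SameSpace.

Coercion ss_functor : same_space_functor >-> functor.

Section LinearAlgebra.
Variables (k : fieldType) (V : lmodType k).

(* The inverse on the subspace W of an operator which is bijective on W. It   *)
(* is used when that operator is the sum of a nonzero scalar and a locally    *)
(* nilpotent operator; it is then the action of the inverse power series.     *)
Definition inv_on (W : set V) (T : V -> V) (v : V) : V :=
  xget 0 [set w | W w /\ T w = v].

Lemma inv_on_power_series (W : set V) (T : V -> V) (c : k) (d : nat) (v : V) :
  (forall a u w, W u -> W w -> W (a *: u + w)) ->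
  linear T -> (forall w, W w -> W (T w)) ->
  (forall w, W w -> exists m, iter m T w = 0) -> c != 0 ->
  W v -> iter d T v = 0 ->
  inv_on W (fun w => c *: w + T w) v =
    \sum_(s < d) ((-1) ^+ s * c ^- s.+1) *: iter s T v.
Proof.
move=> Wlin Tlin WT Tnil c0 Wv Tdv.
have T0 : T 0 = 0.
  by have := Tlin (-1) 0 0; rewrite scaler0 addr0 scaleN1r addNr.
have TZ a u : T (a *: u) = a *: T u by have := Tlin a u 0; rewrite T0 !addr0.
have TD u w : T (u + w) = T u + T w by have := Tlin 1 u w; rewrite !scale1r.
have W0 : W 0 by have := Wlin (-1) v v Wv Wv; rewrite scaleN1r addNr.
have Wit s : W (iter s T v) by elim: s => //= s; apply: WT.
have W_S m : W (\sum_(s < m) ((-1) ^+ s * c ^- s.+1) *: iter s T v).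
  by elim: m => [|m IH]; rewrite ?big_ord0 // big_ord_recr /= addrC; apply: Wlin.
have S_P m : c *: (\sum_(s < m) ((-1) ^+ s * c ^- s.+1) *: iter s T v)
    + T (\sum_(s < m) ((-1) ^+ s * c ^- s.+1) *: iter s T v)
    = v - ((-1) ^+ m * c ^- m) *: iter m T v.
  elim: m => [|m IH].
    by rewrite big_ord0 scaler0 T0 expr0 invr1 mul1r scale1r subrr addr0.
  rewrite big_ord_recr /= scalerDr TD addrACA IH -addrA; congr (_ + _).
  rewrite scalerA mulrCA [c ^+ m.+1]exprS invfM mulVKf // TZ addrA addNr add0r.
  by rewrite [_ ^+ m.+1]exprS mulN1r mulNr scaleNr opprK.
have inj w : W w -> c *: w + T w = 0 -> w = 0.
  move=> Ww /eqP; rewrite addr_eq0 => /eqP cw; have [m Tm] := Tnil w Ww.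
  have Tw : T w = (- c) *: w by rewrite scaleNr cw opprK.
  have : iter m T w = (- c) ^+ m *: w.
    elim: {Tm} m => [|m IH]; first by rewrite scale1r.
    by rewrite iterS IH TZ Tw scalerA exprSr.
  rewrite Tm => /esym/eqP; rewrite scaler_eq0 expf_eq0 oppr_eq0 (negbTE c0).
  by rewrite andbF => /eqP.
rewrite /inv_on; case: xgetP => [w _ [Ww Tw]|none]; last first.
  by case: (none _ (conj (W_S d) _)); rewrite S_P Tdv scaler0 subr0.
set S := (RHS); have /inj : W (w - S).
  by rewrite addrC -scaleN1r; apply: Wlin => //; apply: W_S.
rewrite -scaleN1r TD TZ scalerDr addrACA Tw scalerA mulrC -scalerA -scalerDr.
rewrite S_P Tdv scaler0 subr0 !scaleN1r subrr => /(_ erefl)/eqP.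
by rewrite subr_eq0 => /eqP.
Qed.

Variable X : choiceType.

Definition decomposition (W : X -> set V) (v : V) (c : X -> V) : Prop :=
  [/\ forall x, W x (c x),
      finite_set [set x | c x != 0] &
      v = \sum_(x \in [set: X]) c x].

Definition direct_sum (W : X -> set V) : Prop :=
  forall v, exists! c, decomposition W v c.

(* the projection onto W x along the other summands of a direct sum *)
Definition projection (W : X -> set V) (x : X) (v : V) : V :=
  xget 0 [set w | exists2 c, decomposition W v c & w = c x].

End LinearAlgebra.

Section Weights.
Variables (k : fieldType) (I : set k) (r n : nat).

Definition arrow1 : rel (set_type I) := fun i i' => val i' == val i + 1.

Definition quiver_connected : Prop :=
  forall i i' : set_type I, exists p : seq (set_type I),
    path (fun x y => arrow1 x y || arrow1 y x) i p /\ last i p = i'.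

Definition vertex : Type := (set_type I * 'I_r)%type.
HB.instance Definition _ := Choice.on vertex.

Definition arrow : rel vertex :=
  fun x y => (x.2 == y.2) && arrow1 x.1 y.1.

Definition weight : Type := {ffun 'I_n -> vertex}.
HB.instance Definition _ := Choice.on weight.

Definition nu (al : weight) (a : 'I_n) : k := val (al a).1.
Definition jj (al : weight) (a : 'I_n) : 'I_r := (al a).2.

(* For i : 'I_n.-1, the adjacent places lo i and hi i = lo i + 1. *)
Fact hi_subproof (i : 'I_n.-1) : (i.+1 < n)%N.
Proof. by case: n i => [|m] [i] //=; rewrite ltnS. Qed.

Definition lo (i : 'I_n.-1) : 'I_n := widen_ord (leq_pred n) i.
Definition hi (i : 'I_n.-1) : 'I_n := Ordinal (hi_subproof i).

Definition sperm (i : 'I_n.-1) : 'S_n := tperm (lo i) (hi i).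

Definition swt (i : 'I_n.-1) (al : weight) : weight :=
  [ffun a => al (sperm i a)].

Definition far (i l : 'I_n.-1) : bool := (i.+1 < l)%N || (l.+1 < i)%N.

End Weights.

(* The quiver Hecke algebra H_n(Gamma). Its elements x_a and tau_i only make  *)
(* sense after multiplication by some 1_al when K is infinite, so that the    *)
(* generators are 1_al, x_a 1_al and tau_i 1_al.                              *)
Section QuiverHecke.
Variables (k : fieldType) (I : set k) (r n : nat).
Local Notation K := (vertex I r).
Local Notation wt := (weight I r n).

Inductive Hgen :=
  | H1gen of wt
  | Hxgen of 'I_n & wt
  | Htgen of 'I_n.-1 & wt.

Local Notation tm := (term k Hgen).
Definition e1 (al : wt) : tm := Gen (H1gen al).
Definition x1 (a : 'I_n) (al : wt) : tm := Gen (Hxgen a al).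
Definition t1 (i : 'I_n.-1) (al : wt) : tm := Gen (Htgen i al).

(* tau_i tau_l 1_al and tau_i tau_l tau_m 1_al *)
Definition t2 (i l : 'I_n.-1) (al : wt) : tm := (t1 i (swt l al) * t1 l al)%expr.
Definition t3 (i l m : 'I_n.-1) (al : wt) : tm :=
  (t1 i (swt l (swt m al)) * t2 l m al)%expr.

(* p(x_1, ..., x_n) 1_al *)
Definition monomial1 (m : 'X_{1..n}) (al : wt) : tm :=
  foldr (fun a u => iter (m a) (Mul (x1 a al)) u) (e1 al) (enum 'I_n).
Definition poly1 (p : {mpoly k[n]}) (al : wt) : tm :=
  \big[Add/Zero]_(m <- msupp p) (p@_m *: monomial1 m al)%expr.

Definition Q (x y : K) (u v : {mpoly k[n]}) : {mpoly k[n]} :=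
  if x == y then 0
  else if arrow x y then
    if arrow y x then - (u - v) ^+ 2 else v - u
  else if arrow y x then u - v
  else 1.

Inductive Hrel : tm -> tm -> Prop :=
  | H_11 al be : Hrel (e1 al * e1 be)%expr (if al == be then e1 al else 0%expr)
  | H_x1 a al : Hrel (x1 a al * e1 al)%expr (x1 a al)
  | H_1x a al : Hrel (e1 al * x1 a al)%expr (x1 a al)
  | H_t1 i al : Hrel (t1 i al * e1 al)%expr (t1 i al)
  | H_1t i al : Hrel (e1 (swt i al) * t1 i al)%expr (t1 i al)
  | H_xx a b al : Hrel (x1 a al * x1 b al)%expr (x1 b al * x1 a al)%expr
  | H_tt i l al : far i l -> Hrel (t2 i l al) (t2 l i al)
  | H_tx i a al :
      Hrel (t1 i al * x1 a al - x1 (sperm i a) (swt i al) * t1 i al)%expr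
           (if al (lo i) == al (hi i) then
              if a == lo i then (- e1 al)%expr
              else if a == hi i then e1 al
              else 0%expr
            else 0%expr)
  | H_quadratic i al :
      Hrel (t2 i i al) (poly1 (Q (al (lo i)) (al (hi i)) 'X_(lo i) 'X_(hi i)) al)
  (* D is the exact quotient, in k[x_1, ..., x_n], of the difference of the   *)
  (* two values of Q by x_{i+2} - x_i.                                        *)
  | H_braid_eq (i l : 'I_n.-1) (al : wt) (D : {mpoly k[n]}) :
      l = i.+1 :> nat -> al (lo i) = al (hi l) ->
      ('X_(hi l) - 'X_(lo i)) * D =
        Q (al (lo i)) (al (hi i)) 'X_(hi l) 'X_(hi i)
        - Q (al (lo i)) (al (hi i)) 'X_(lo i) 'X_(hi i) ->
      Hrel (t3 l i l al - t3 i l i al)%expr (poly1 D al)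
  | H_braid_neq (i l : 'I_n.-1) (al : wt) :
      l = i.+1 :> nat -> al (lo i) <> al (hi l) ->
      Hrel (t3 l i l al - t3 i l i al)%expr 0%expr.

Definition Halg : lmodType k := presented Hrel.
Definition Hmul : Halg -> Halg -> Halg := @palg_mul k Hgen Hrel.
Definition H1 (al : wt) : Halg := pi_alg Hrel (e1 al).
Definition Hx (a : 'I_n) (al : wt) : Halg := pi_alg Hrel (x1 a al).
Definition Ht (i : 'I_n.-1) (al : wt) : Halg := pi_alg Hrel (t1 i al).

Definition Hweight (V : lmodType k) (act : Halg -> V -> V) (al : wt) : set V :=
  range (act (H1 al)).

(* the objects of C_Gamma^0 *)
Definition CGamma : action_class Halg := fun V act =>
  [/\ is_module Hmul act,
      direct_sum (Hweight act),
      finitely_generated act &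
      forall al a v, Hweight act al v ->
        exists d, iter d (act (Hx a al)) v = 0].

End QuiverHecke.

(* The degenerate affine Yokonuma-Hecke algebra, a unital algebra: the unit   *)
(* is one of the generators and its axioms are among the relations.           *)
Section YokonumaHecke.
Variables (k : fieldType) (r n : nat).

Inductive Ygen :=
  | Y1gen
  | Ytgen of 'I_n
  | Yfgen of 'I_n.-1
  | Yygen of 'I_n.

Local Notation tm := (term k Ygen).
Local Notation "1" := (Gen Y1gen : tm) : expr_scope.
Local Notation t a := (Gen (Ytgen a) : tm).
Local Notation f i := (Gen (Yfgen i) : tm).
Local Notation y a := (Gen (Yygen a) : tm).

Definition tpow (a : 'I_n) (s : nat) : tm := iter s (Mul (t a)) 1%expr.

(* As t_{i+1}^r = 1, the power t_{i+1}^(r - s) is t_{i+1}^(-s). *)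
Definition eY (i : 'I_n.-1) : tm :=
  ((r%:R^-1)%R *:
     \big[Add/Zero]_(0 <= s < r) (tpow (lo i) s * tpow (hi i) (r - s)))%expr.

Inductive Yrel : tm -> tm -> Prop :=
  | Y_1l u : Yrel (1 * u)%expr u
  | Y_1r u : Yrel (u * 1)%expr u
  | Y_ff i l : far i l -> Yrel (f i * f l)%expr (f l * f i)%expr
  | Y_braid (i l : 'I_n.-1) : l = i.+1 :> nat ->
      Yrel (f i * (f l * f i))%expr (f l * (f i * f l))%expr
  | Y_tt a b : Yrel (t a * t b)%expr (t b * t a)%expr
  | Y_ft i a : Yrel (f i * t a)%expr (t (sperm i a) * f i)%expr
  | Y_tr a : Yrel (tpow a r) 1%expr
  | Y_f2 i : Yrel (f i * f i)%expr 1%expr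
  | Y_yy a b : Yrel (y a * y b)%expr (y b * y a)%expr
  | Y_fy_hi i : Yrel (f i * y (hi i))%expr (y (lo i) * f i + eY i)%expr
  | Y_fy i a : a != lo i -> a != hi i -> Yrel (f i * y a)%expr (y a * f i)%expr
  | Y_ty a b : Yrel (t a * y b)%expr (y b * t a)%expr.

Definition Yalg : Type := presented Yrel.
HB.instance Definition _ := GRing.Lmodule.on Yalg.
Definition Ymul : Yalg -> Yalg -> Yalg := @palg_mul k Ygen Yrel.
Definition Y1 : Yalg := pi_alg Yrel 1%expr.
Definition Yt (a : 'I_n) : Yalg := pi_alg Yrel (t a).
Definition Yf (i : 'I_n.-1) : Yalg := pi_alg Yrel (f i).
Definition Yy (a : 'I_n) : Yalg := pi_alg Yrel (y a).

Fact Ymul1l : left_id Y1 Ymul.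
Proof.
move=> x; have [u ->] := pi_alg_surj x; rewrite /Ymul /Y1 pi_mul.
by apply/pi_algP/cong_rel/Y_1l.
Qed.

Fact Ymul1r : right_id Y1 Ymul.
Proof.
move=> x; have [u ->] := pi_alg_surj x; rewrite /Ymul /Y1 pi_mul.
by apply/pi_algP/cong_rel/Y_1r.
Qed.

HB.instance Definition _ := GRing.Zmodule_isPzRing.Build Yalg
  (@palg_mulA k Ygen Yrel) Ymul1l Ymul1r
  (@palg_mulDl k Ygen Yrel) (@palg_mulDr k Ygen Yrel).

(* with these, Yalg is a k-algebra (not declared as an algType, whose         *)
(* definition requires 1 != 0)                                                *)
Fact YscaleAl (a : k) (x y : Yalg) : a *: (x * y) = (a *: x) * y.
Proof. by rewrite /GRing.mul /= palg_mulZl. Qed.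
Fact YscaleAr (a : k) (x y : Yalg) : a *: (x * y) = x * (a *: y).
Proof. by rewrite /GRing.mul /= palg_mulZr. Qed.

Variables (I : set k) (zeta : k).
Local Notation wt := (weight I r n).

Definition Yweight (V : lmodType k) (act : Yalg -> V -> V) (al : wt) : set V :=
  [set v | forall a : 'I_n,
     (exists d, iter d (fun w => act (Yy a) w - nu al a *: w) v = 0)
     /\ act (Yt a) v = zeta ^+ jj al a *: v].

(* the objects of the category \bar C_K *)
Definition CK : action_class Yalg := fun V act =>
  [/\ is_module Ymul act,
      forall v, act Y1 v = v,
      finitely_generated act &
      direct_sum (Yweight act)].

End YokonumaHecke.

Arguments CGamma {k} I r n V act.
Arguments CK {k} r n I zeta V act.

Section Formulas.
Variables (k : fieldType) (I : set k) (r n : nat) (V : lmodType k).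
Local Notation wt := (weight I r n).

(* The action on the weight space W of index al = (nu, j) of q_i(nu, j) and   *)
(* p_i(nu, j), when x_a acts by x a.                                          *)
Section pq.
Variables (W : set V) (x : 'I_n -> V -> V) (i : 'I_n.-1) (al : wt).
Local Notation nu1 := (nu al (lo i)).
Local Notation nu2 := (nu al (hi i)).
Local Notation j1 := (jj al (lo i)).
Local Notation j2 := (jj al (hi i)).
Local Notation X1 := (x (lo i)).
Local Notation X2 := (x (hi i)).

Definition denominator (v : V) : V := X1 v - X2 v + (nu1 - nu2) *: v.

Definition qop (v : V) : V :=
  if j1 == j2 then
    if nu1 == nu2 then X2 v - X1 v + v
    else if nu2 == nu1 + 1 then inv_on W (fun w => X1 w - X2 w - w) v
    else let w := inv_on W denominator v in
         X2 w - X1 w + (nu2 - nu1 - 1) *: w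
  else v.

Definition pop (v : V) : V :=
  if j1 == j2 then
    if nu1 == nu2 then v else inv_on W denominator v
  else 0.

End pq.

Section phi.
Variables (zeta : k) (act : Yalg k r n -> V -> V).

(* the idempotent e(nu, j) *)
Definition eproj (al : wt) : V -> V :=
  projection (fun be : wt => Yweight zeta act be) al.

Definition phi (i : 'I_n.-1) (v : V) : V :=
  act (Yf k r i) v
  + \sum_(al \in [set al : wt | nu al (lo i) <> nu al (hi i)
                             /\ jj al (lo i) = jj al (hi i)])
      inv_on (Yweight zeta act al)
        (fun w => act (Yy k r (lo i)) w - act (Yy k r (hi i)) w) (eproj al v)
  + \sum_(al \in [set al : wt | nu al (lo i) = nu al (hi i)
                             /\ jj al (lo i) = jj al (hi i)])
      eproj al v.

Definition yshift (al : wt) (a : 'I_n) (v : V) : V :=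
  act (Yy k r a) v - nu al a *: v.

(* p'_i(nu, j) and q'_i(nu, j): each x_a is replaced by y_a - nu_a *)
Definition qop' (i : 'I_n.-1) (al : wt) : V -> V :=
  qop (Yweight zeta act al) (yshift al) i al.
Definition pop' (i : 'I_n.-1) (al : wt) : V -> V :=
  pop (Yweight zeta act al) (yshift al) i al.

End phi.

End Formulas.

Section Functors.
Variables (k : fieldType) (I : set k) (r n : nat) (zeta : k).
Local Notation wt := (weight I r n).
Local Notation C := (module_category (CGamma I r n)).
Local Notation D := (module_category (CK r n I zeta)).

Definition Phi_formulas (F : same_space_functor (CGamma I r n)
                                                (CK r n I zeta)) : Prop :=
  forall (M : C) (al : wt) (v : carrier M), Hweight (@mact _ _ _ M) al v ->
    let x a := mact (Hx a al) : carrier M -> carrier M in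
    let W := Hweight (@mact _ _ _ M) al in
    [/\ forall a, new_act F (Yt k r a) v = zeta ^+ jj al a *: v,
        forall a, new_act F (Yy k r a) v = x a v + nu al a *: v &
        forall i, new_act F (Yf k r i) v =
                  mact (Ht i al) (qop W x i al v) - pop W x i al v].

Definition Psi_formulas (G : same_space_functor (CK r n I zeta)
                                                (CGamma I r n)) : Prop :=
  forall (N : D) (al : wt),
    let f i := mact (Yf k r i) : carrier N -> carrier N in
    let W := Yweight zeta (@mact _ _ _ N) al in
    let q' i := qop' zeta (@mact _ _ _ N) i al in
    let p' i := pop' zeta (@mact _ _ _ N) i al in
    (forall v : carrier N,
       new_act G (H1 al) v = eproj zeta (@mact _ _ _ N) al v)
    /\ forall v : carrier N, W v ->
      [/\ forall a, new_act G (Hx a al) v = mact (Yy k r a) v - nu al a *: v,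
          forall i, new_act G (Ht i al) v =
                    phi I zeta (@mact _ _ _ N) i (inv_on W (q' i) v) &
          forall i, phi I zeta (@mact _ _ _ N) i (inv_on W (q' i) v) =
                    f i (inv_on W (q' i) v) + p' i (inv_on W (q' i) v)].

End Functors.

(* Main.v *)
(* On the weight space of (nu, j) the two module structures determine each    *)
(* other through f_i b = tau_i a - c, where q_i = a / b and p_i = c / b with  *)
(* polynomials a, b, c in the x_a; a and b have nonzero constant term, hence  *)
(* act bijectively because the x_a are locally nilpotent.  It remains to      *)
(* match the defining relations, weight space by weight space.  The quadratic *)
(* relation corresponds to f_i^2 = 1 because Q a a' = 1 - d^2 for j_i =       *)
(* j_(i+1) and nu_i <> nu_(i+1), where d = y_i - y_(i+1) and a' is the a of   *)
(* the swapped weight with x_i and x_(i+1) exchanged.  For the braid          *)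
(* relations, moving all polynomials to the left gives                        *)
(*   f_1 f_2 f_1 G - f_2 f_1 f_2 G                                            *)
(*     = E (tau_1 tau_2 tau_1 - tau_2 tau_1 tau_2 + D)                        *)
(* with G and E invertible and D the divided difference of Q, so that each    *)
(* braid relation implies the other.  Finitely generated modules correspond   *)
(* because a subspace graded by weights is stable under one algebra iff it is *)
(* stable under the other.                                                    *)
Require Import Defs.
From mathcomp Require Import all_boot all_order perm all_algebra.
From mathcomp Require Import mpoly.
From mathcomp Require Import boolp classical_sets cardinality fsbigop.
From mathcomp Require Import ssrAC bigenough ssrcomplements ring zify.

Set Implicit Arguments.
Unset Strict Implicit.
Unset Printing Implicit Defensive.

Import GRing.Theory BigEnough.
Local Open Scope ring_scope.

(** * Linear maps, subspaces and direct sums *)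

(** Everything takes place on one space that is the direct sum of weight spaces [W al] and carries
    commuting locally nilpotent operators [x a]. A polynomial ['X_a - 'X_b + c] with [c != 0] is a
    nonzero scalar plus a locally nilpotent operator, hence bijective on every [x]-stable subspace
    ([unit_act_lin]). The power series of the statement are fractions of products of such
    polynomials, so they can be handled with denominators cleared: on [W al], [f i] after [den_at]
    equals [tau i] after [qnum_at], minus [pnum_at] ([intertwining]). As [den_at] and [qnum_at] act
    bijectively, this equation determines [f] from [tau] and [tau] from [f].

    The relations are then compared on each weight space. The commutation of [f] with the y's and
    that of [tau] with the x's both come down to one polynomial identity, [den_relation], once [e_i]
    is known to act by 1 or 0 according to whether [j_i = j_(i+1)] ([teval_eY]). For the other
    relations there are invertible polynomials [G] and [E], depending on the weight, with f_i^2 G -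
    G = E (tau_i^2 - Q) ([f_quadratic]), [f_i, f_l] G = [tau_i, tau_l] E for distant i and l
    ([f_far]), (f_i f_l f_i - f_l f_i f_l) G = E (tau_i tau_l tau_i - tau_l tau_i tau_l + D)
    ([f_braid_tau_braid]), the last one granted the quadratic relation. Surjectivity of [G] yields
    the relations of [f] from those of [tau]; bijectivity of [E] yields the converse.

    [build_Y] and [build_H] turn this into a [realization], a space with both actions. There the
    weight spaces of the two actions coincide ([HweightE], [YweightE]), finite generation is the
    same condition ([fg_Y_of_H], [fg_H_of_Y]), and a linear map commutes with one action iff it
    commutes with the other ([hom_YH_of_HY], [hom_HY_of_YH]). The last fact gives functoriality and,
    for the identity map, that both composites of functors return the original action. *)

Section RawLinear.
Variables (k : fieldType) (U V : lmodType k) (f : U -> V).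
Hypothesis fL : linear f.

Lemma rlin0 : f 0 = 0.
Proof. by have := fL (-1) 0 0; rewrite scaler0 addr0 scaleN1r addNr. Qed.

Lemma rlinD u v : f (u + v) = f u + f v.
Proof. by have := fL 1 u v; rewrite !scale1r. Qed.

Lemma rlinZ a u : f (a *: u) = a *: f u.
Proof. by have := fL a u 0; rewrite rlin0 !addr0. Qed.

Lemma rlinN u : f (- u) = - f u.
Proof. by rewrite -scaleN1r rlinZ scaleN1r. Qed.

Lemma rlinB u v : f (u - v) = f u - f v.
Proof. by rewrite rlinD rlinN. Qed.

Lemma rlin_sum (T : Type) (s : seq T) (F : T -> U) :
  f (\sum_(t <- s) F t) = \sum_(t <- s) f (F t).
Proof.
elim: s => [|t s IH]; first by rewrite !big_nil rlin0.
by rewrite !big_cons rlinD IH.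
Qed.

End RawLinear.

Lemma iter_linear (k : fieldType) (V : lmodType k) (f : V -> V) d :
  linear f -> linear (iter d f).
Proof. by move=> fL; elim: d => [//|d IH] a u v /=; rewrite IH fL. Qed.

Section Subspaces.
Variables (k : fieldType) (V : lmodType k).
Implicit Types S : set V.

Definition subspace S :=
  S 0 /\ forall a u v, S u -> S v -> S (a *: u + v).

Lemma subspace0 S : subspace S -> S 0. Proof. by case. Qed.

Lemma subspaceD S u v : subspace S -> S u -> S v -> S (u + v).
Proof. by move=> [_ H] Su Sv; rewrite -[u]scale1r; apply: H. Qed.

Lemma subspaceZ S a u : subspace S -> S u -> S (a *: u).
Proof. by move=> [S0 H] Su; rewrite -[a *: u]addr0; apply: H. Qed.

Lemma subspaceN S u : subspace S -> S u -> S (- u).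
Proof. by rewrite -scaleN1r; apply: subspaceZ. Qed.

Lemma subspaceB S u v : subspace S -> S u -> S v -> S (u - v).
Proof. by move=> H Su Sv; apply: subspaceD => //; apply: subspaceN. Qed.

Lemma subspace_sum S (T : Type) (s : seq T) (F : T -> V) :
  subspace S -> (forall t, S (F t)) -> S (\sum_(t <- s) F t).
Proof.
move=> HS SF; elim: s => [|t s IH]; first by rewrite big_nil; apply: subspace0.
by rewrite big_cons; apply: subspaceD.
Qed.

Lemma subspaceI S S' : subspace S -> subspace S' -> subspace (S `&` S').
Proof.
move=> [S0 H] [S0' H']; split; first by split.
by move=> a u v [? ?] [? ?]; split; [apply: H|apply: H'].
Qed.

Lemma iter_kill (f : V -> V) d e v : linear f -> (d <= e)%N ->
  iter d f v = 0 -> iter e f v = 0.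
Proof.
move=> fL /subnK <- fv; rewrite iterD fv.
by apply: (rlin0 (iter_linear _ fL)).
Qed.

Lemma subspace_nil (f : V -> V) :
  linear f -> subspace [set v | exists d, iter d f v = 0].
Proof.
move=> fL; split; first by exists 0%N.
move=> a u v [d fu] [e fv]; exists (maxn d e).
rewrite (iter_linear _ fL) (iter_kill fL (leq_maxl d e) fu).
by rewrite (iter_kill fL (leq_maxr d e) fv) scaler0 addr0.
Qed.

End Subspaces.

Section DirectSum.
Variables (k : fieldType) (V : lmodType k) (X : choiceType) (W : X -> set V).

(** The list only has to contain the support, so it can be enlarged to serve several vectors at
    once. *)
Lemma decompositionP v c : decomposition W v c <->
  (forall al, W al (c al)) /\ exists s : seq X,
    [/\ uniq s, forall al, al \notin s -> c al = 0 & v = \sum_(al <- s) c al].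
Proof.
split=> [[Wc fin ->]|[Wc [s [us cs vE]]]].
  split=> //; exists (finmap.enum_fset (fset_set [set x | c x != 0])); split.
  - exact: finmap.fset_uniq.
  - move=> al; rewrite in_fset_set // notin_setE /= => /negP.
    by rewrite negbK => /eqP.
  - apply: fsbigTE => al; rewrite in_fset_set // notin_setE /= => /negP.
    by rewrite negbK => /eqP.
split=> //.
- apply: (sub_finite_set (B := [set` s])); last exact: finite_seq.
  by move=> al /= nz; apply: contraNT nz => /cs ->.
- rewrite vE fsbig_seq //; apply: fsbig_widen => // al [_ /= /negP /cs].
  by [].
Qed.

Hypothesis Wsub : forall al, subspace (W al).
Hypothesis Wds : direct_sum W.

Lemma projE v c al : decomposition W v c -> projection W al v = c al.
Proof.
move=> dc; rewrite /projection; case: xgetP => [w _ /= [c' dc' ->]|none].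
  by have [c0 [_ u]] := Wds v; rewrite -(u _ dc) -(u _ dc').
by case: (none (c al)); exists c.
Qed.

Lemma proj_decomposition v : decomposition W v (projection W ^~ v).
Proof.
have [c [dc _]] := Wds v.
by have -> : projection W ^~ v = c by apply/funext => al; apply: projE.
Qed.

Lemma proj_in al v : W al (projection W al v).
Proof. by have [H _ _] := proj_decomposition v. Qed.

Lemma proj_on al be v : W al v ->
  projection W be v = if be == al then v else 0.
Proof.
move=> Wv; rewrite (@projE _ (fun be => if be == al then v else 0)) //.
apply/decompositionP; split=> [ga|].
  by case: eqP => [->|_] //; apply: subspace0.
exists [:: al]; split=> // [ga|]; last by rewrite big_seq1 eqxx.
by rewrite inE => /negbTE ->.
Qed.

Lemma proj_id al v : W al v -> projection W al v = v.
Proof. by move=> /(@proj_on _ al) ->; rewrite eqxx. Qed.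

Lemma proj_sum v : exists s : seq X, [/\ uniq s,
  forall al, al \notin s -> projection W al v = 0 &
  v = \sum_(al <- s) projection W al v].
Proof. by have /decompositionP[] := proj_decomposition v. Qed.

Lemma proj_sum_super (s : seq X) v : uniq s ->
  (forall al, al \notin s -> projection W al v = 0) ->
  v = \sum_(al <- s) projection W al v.
Proof.
move=> us cs; have [_ _ {1}->] := proj_decomposition v.
rewrite [RHS]fsbig_seq //; apply/esym/fsbig_widen => // al [_ /= /negP /cs].
by [].
Qed.

Lemma proj_supp (vs : seq V) : exists2 s : seq X, uniq s &
  forall v, v \in vs -> forall al, al \notin s -> projection W al v = 0.
Proof.
elim: vs => [|v vs [s us H]]; first by exists [::].
have [s' [us' H' _]] := proj_sum v.
exists (undup (s ++ s')) => [|w]; first exact: undup_uniq.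
rewrite inE => /predU1P[->|wvs] al; rewrite mem_undup mem_cat negb_or.
  by case/andP => _; apply: H'.
by case/andP => + _; apply: H.
Qed.

Lemma proj_linear al : linear (projection W al).
Proof.
move=> a u v; have [s us H] := proj_supp [:: u; v].
have Hu be := H u (mem_head _ _) be.
have Hv be : be \notin s -> projection W be v = 0.
  by apply: H; rewrite !inE eqxx orbT.
apply: (@projE _ (fun be => a *: projection W be u + projection W be v)).
apply/decompositionP; split=> [be|].
  by have [_] := Wsub be; apply; apply: proj_in.
exists s; split=> // [be nbe|]; first by rewrite Hu // Hv // scaler0 addr0.
by rewrite big_split -scaler_sumr -!proj_sum_super.
Qed.

Lemma ds_ind (P : V -> Prop) : P 0 -> (forall u v, P u -> P v -> P (u + v)) ->
  (forall al v, W al v -> P v) -> forall v, P v.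
Proof.
move=> P0 PD PW v; have [s [_ _ ->]] := proj_sum v.
elim: s => [|al s IH]; first by rewrite big_nil.
by rewrite big_cons; apply: PD => //; apply: (PW al); apply: proj_in.
Qed.

Lemma ds_eq (V' : lmodType k) (f g : V -> V') : linear f -> linear g ->
  (forall al v, W al v -> f v = g v) -> f =1 g.
Proof.
move=> fL gL fg; apply: ds_ind => // [|u v fgu fgv].
  by rewrite (rlin0 fL) (rlin0 gL).
by rewrite (rlinD fL) (rlinD gL) fgu fgv.
Qed.

(** Extends maps given weight by weight to all of [V]. Linearity of [g al] is later required on
    [W al] only, because formulas with [inv_on] are meaningful only there. *)
Definition glue (V' : lmodType k) (g : X -> V -> V') (v : V) : V' :=
  \sum_(al \in [set: X]) g al (projection W al v).

Section Glue.
Variables (V' : lmodType k) (g : X -> V -> V').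
Hypothesis gL : forall al a u v, W al u -> W al v ->
  g al (a *: u + v) = a *: g al u + g al v.

Lemma glue_seq (s : seq X) v : uniq s ->
  (forall al, al \notin s -> projection W al v = 0) ->
  glue g v = \sum_(al <- s) g al (projection W al v).
Proof.
have g0 al : g al 0 = 0.
  have W0 := subspace0 (Wsub al).
  by have := gL (-1) W0 W0; rewrite scaler0 addr0 scaleN1r addNr.
move=> us cs; rewrite [RHS]fsbig_seq //; apply/esym/fsbig_widen => // al [_ /=].
by move/negP/cs => ->.
Qed.

Lemma glue_on al v : W al v -> glue g v = g al v.
Proof.
move=> Wv; rewrite (@glue_seq [:: al]) ?big_seq1 ?proj_id // => be.
by rewrite inE (proj_on _ Wv) => /negbTE ->.
Qed.

Lemma glue_linear : linear (glue g).
Proof.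
move=> a u v; have [s us H] := proj_supp [:: u; v; a *: u + v].
have G w : w \in [:: u; v; a *: u + v] ->
    glue g w = \sum_(al <- s) g al (projection W al w).
  by move=> /H; apply: glue_seq.
rewrite !G ?inE ?eqxx ?orbT //.
rewrite scaler_sumr -big_split; apply: eq_bigr => al _.
by rewrite proj_linear gL //; apply: proj_in.
Qed.

End Glue.
End DirectSum.

(** Applying [g] to the decomposition of [v] gives a decomposition of [g v], and decompositions are
    unique. *)
Lemma proj_comm (k : fieldType) (V V' : lmodType k) (X : choiceType)
    (W : X -> set V) (W' : X -> set V') (g : V -> V') be v :
  direct_sum W -> direct_sum W' -> linear g ->
  (forall al u, W al u -> W' al (g u)) ->
  projection W' be (g v) = g (projection W be v).
Proof.
move=> Wds Wds' gL gW; have [s [us cs vE]] := proj_sum Wds v.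
apply: (@projE _ _ _ _ Wds' _ (fun al => g (projection W al v))).
apply/decompositionP; split=> [al|]; first by apply/gW/(proj_in Wds).
exists s; split=> // [al /cs ->|]; first exact: rlin0.
by rewrite {1}vE (rlin_sum gL).
Qed.

(** * Modules over presented algebras *)

Section PresentedModules.
Variables (k : fieldType) (G : Type) (rel : term k G -> term k G -> Prop).
Local Notation A := (presented rel).
Local Notation mulA := (@palg_mul k G rel).

Section Eval.
Variables (V : lmodType k) (rho : G -> V -> V).

Fixpoint teval (u : term k G) : V -> V :=
  match u with
  | Gen g => rho g
  | Zero => fun=> 0
  | Add u v => fun w => teval u w + teval v w
  | Opp u => fun w => - teval u w
  | Scale a u => fun w => a *: teval u w
  | Mul u v => fun w => teval u (teval v w)
  end.

Definition ev_act (b : A) : V -> V := teval (repr b).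

Hypothesis rhoL : forall g, linear (rho g).

Lemma teval_linear u : linear (teval u).
Proof.
elim: u => [g||u IHu v IHv|u IHu|b u IHu|u IHu v IHv] a x y //=.
- exact: rhoL.
- by rewrite scaler0 addr0.
- by rewrite IHu IHv scalerDr addrACA.
- by rewrite IHu scalerN opprD.
- by rewrite IHu scalerDr !scalerA mulrC.
- by rewrite IHv IHu.
Qed.

Hypothesis rho_rel : forall u v, rel u v -> teval u =1 teval v.

(** Linear operators satisfy the axioms of an associative algebra, so only the defining relations
    have to be checked on the generators. *)
Lemma teval_cong u v : cong rel u v -> teval u =1 teval v.
Proof.
elim=> {u v} //=.
- by move=> u v _ IH w; rewrite IH.
- by move=> u v w _ IH _ IH' z; rewrite IH IH'.
- by move=> u u' v v' _ IH _ IH' w; rewrite IH IH'.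
- by move=> u u' _ IH w; rewrite IH.
- by move=> a u u' _ IH w; rewrite IH.
- by move=> u u' v v' _ IH _ IH' w; rewrite IH' IH.
- by move=> * ?; rewrite addrA.
- by move=> * ?; rewrite addrC.
- by move=> * ?; rewrite add0r.
- by move=> * ?; rewrite addNr.
- by move=> * ?; rewrite scalerA.
- by move=> * ?; rewrite scale1r.
- by move=> * ?; rewrite scalerDr.
- by move=> * ?; rewrite scalerDl.
- by move=> u v w z; rewrite (rlinD (teval_linear u)).
- by move=> a u v w; rewrite (rlinZ (teval_linear u)).
Qed.

Lemma ev_act_pi u v : ev_act (pi_alg rel u) v = teval u v.
Proof. exact/teval_cong/repr_cong. Qed.

Lemma ev_act_module : is_module mulA ev_act.
Proof.
split=> [a|v|a b v]; first exact: teval_linear.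
  move=> a b c; have [u ->] := pi_alg_surj b; have [w ->] := pi_alg_surj c.
  by rewrite pi_algZ pi_algD !ev_act_pi.
have [u ->] := pi_alg_surj a; have [w ->] := pi_alg_surj b.
by rewrite Defs.pi_mul !ev_act_pi.
Qed.

End Eval.

Section Module.
Variables (V : lmodType k) (act : A -> V -> V).
Hypothesis Hact : is_module mulA act.
Local Notation gact g := (act (pi_alg rel (Gen g))).

Lemma mod_linear a : linear (act a). Proof. by case: Hact. Qed.

Lemma mod_mul a b v : act (mulA a b) v = act a (act b v).
Proof. by case: Hact. Qed.

Lemma mod_teval u v : act (pi_alg rel u) v = teval (fun g => gact g) u v.
Proof.
have aL w : linear (act^~ w) by case: Hact.
have a0 w : act (pi_alg rel Zero) w = 0 := rlin0 (aL w).
elim: u v => [g||u IHu w IHw|u IHu|b u IHu|u IHu w IHw] v //=.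
- by rewrite -IHu -IHw -(rlinD (aL v)) pi_algD.
- rewrite -IHu -(rlinN (aL v)); congr (act _ v); exact/esym/Defs.pi_opp.
- by rewrite -IHu -(rlinZ (aL v)) pi_algZ.
- by rewrite -Defs.pi_mul mod_mul IHw IHu.
Qed.

Lemma mod_rel u v w : rel u v ->
  teval (fun g => gact g) u w = teval (fun g => gact g) v w.
Proof.
by move=> uv; rewrite -!mod_teval; congr (act _ w); apply/pi_algP/cong_rel.
Qed.

Lemma mod_stable (S : set V) : subspace S ->
  (forall g v, S v -> S (gact g v)) -> forall a v, S v -> S (act a v).
Proof.
move=> HS Sg a; have [u ->] := pi_alg_surj a.
elim: u {a} => [g||u IHu w IHw|u IHu|b u IHu|u IHu w IHw] v Sv;
  rewrite mod_teval /= -?mod_teval.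
- exact: Sg.
- exact: subspace0.
- by apply: subspaceD => //; [apply: IHu|apply: IHw].
- by apply: subspaceN => //; apply: IHu.
- by apply: subspaceZ => //; apply: IHu.
- by apply: IHu; apply: IHw.
Qed.

(* For a nonunital algebra the vectors [s`_i] need not lie in the submodule   *)
(* of all [\sum_i act (c i) s`_i], whence the hypothesis on local units.      *)
Lemma fg_stable : (forall v, exists a, act a v = v) ->
  finitely_generated act <->
  exists s : seq V, forall S : set V, subspace S ->
    (forall g v, S v -> S (gact g v)) -> (forall v, v \in s -> S v) ->
    forall v, S v.
Proof.
have aL w : linear (act^~ w) by case: Hact.
move=> loc; split=> [[s Hs]|[s Hs]].
  exists s => S HS Sg Ss v; have [c ->] := Hs v.
  apply: subspace_sum => // i; apply: mod_stable => //.
  exact/Ss/mem_nth.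
exists s; pose S : set V := [set v | exists c : 'I_(size s) -> A,
  v = \sum_(i < size s) act (c i) s`_i]%classic.
suff : forall v, S v by [].
apply: (Hs S) => [|g v [c ->]|v vs].
- split=> [|a u v [c ->] [c' ->]].
    exists (fun=> 0); rewrite big1 // => i _; exact: (rlin0 (aL _)).
  exists (fun i => a *: c i + c' i).
  by rewrite scaler_sumr -big_split; apply: eq_bigr => i _; rewrite (aL _).
- exists (fun i => mulA (pi_alg rel (Gen g)) (c i)).
  rewrite (rlin_sum (mod_linear _)).
  by apply: eq_bigr => i _; rewrite mod_mul.
- have [a av] := loc v; have vi : (index v s < size s)%N by rewrite index_mem.
  exists (fun i => if i == Ordinal vi then a else 0).
  rewrite (bigD1 (Ordinal vi)) //= eqxx nth_index // av big1 ?addr0 // => i.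
  by move=> /negbTE ->; apply: (rlin0 (aL _)).
Qed.

End Module.

Lemma mod_hom (V V' : lmodType k) (act : A -> V -> V) (act' : A -> V' -> V')
    (phi : V -> V') :
  is_module mulA act -> is_module mulA act' -> linear phi ->
  (forall g v, phi (act (pi_alg rel (Gen g)) v) =
               act' (pi_alg rel (Gen g)) (phi v)) ->
  forall a v, phi (act a v) = act' a (phi v).
Proof.
move=> H H' pL Hg a; have [u ->] := pi_alg_surj a => {a}.
elim: u => [g||u IHu w IHw|u IHu|b u IHu|u IHu w IHw] v;
  rewrite ?(mod_teval H) ?(mod_teval H') /= -?(mod_teval H) -?(mod_teval H').
- exact: Hg.
- exact: rlin0.
- by rewrite (rlinD pL) IHu IHw.
- by rewrite (rlinN pL) IHu.
- by rewrite (rlinZ pL) IHu.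
- by rewrite IHu IHw.
Qed.

End PresentedModules.

(** * Polynomials in locally nilpotent commuting operators *)

(** The binomial expansion is replaced by an induction: applying [f] or [g] to [v] lowers one of the
    two exponents. *)
Lemma nil_sub (k : fieldType) (V : lmodType k) (f g : V -> V) (d e : nat) v :
  linear f -> linear g -> (forall w, f (g w) = g (f w)) ->
  iter d f v = 0 -> iter e g v = 0 ->
  iter (d + e) (fun w => f w - g w) v = 0.
Proof.
move=> fL gL fg; pose h w := f w - g w.
have hL : linear h by move=> a u w; rewrite /h fL gL scalerBr opprD addrACA.
have itf w m : iter m f (g w) = g (iter m f w) by elim: m => //= m ->.
have itg w m : iter m g (f w) = f (iter m g w) by elim: m => //= m ->.
(* With [N] a bound on [d + e], the induction applies to [f v] with exponents [d - 1], [e] and to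
   [g v] with exponents [d], [e - 1]. *)
suff : forall N d e v, (d + e <= N)%N ->
    iter d f v = 0 -> iter e g v = 0 -> iter N h v = 0.
  by apply; apply: leqnn.
have it0 N : iter N h 0 = 0 := rlin0 (iter_linear N hL).
elim=> [|N IH] {}d {}e {}v.
  by rewrite leqn0 addn_eq0 => /andP[/eqP -> _].
case: d => [_ /= ->|d]; first by rewrite -iterS it0.
case: e => [_ _ /= ->|e le dv ev]; first by rewrite -iterS it0.
rewrite iterSr {2}/h (rlinB (iter_linear _ hL)).
rewrite (IH d e.+1) ?(IH d.+1 e) ?subrr -?iterSr //.
- by rewrite -ltnS (leq_trans _ le) // addnS.
- by rewrite itf dv (rlin0 gL).
- by rewrite itg ev (rlin0 fL).
Qed.

Lemma nil_eigen (k : fieldType) (V : lmodType k) (f : V -> V) (c : k) d v :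
  linear f -> c != 0 -> iter d f v = 0 -> f v = c *: v -> v = 0.
Proof.
move=> fL c0 fv0 fv; suff E : iter d f v = c ^+ d *: v.
  move/eqP: fv0; rewrite E scaler_eq0 expf_eq0 (negbTE c0) andbF.
  by move/eqP.
elim: {fv0} d => [|d IH]; first by rewrite scale1r.
by rewrite iterS IH (rlinZ fL) fv scalerA exprSr.
Qed.

Section PolyAction.
Variables (k : fieldType) (V : lmodType k) (n : nat) (x : 'I_n -> V -> V).

Definition xmon (m : 'X_{1..n}) (v : V) : V :=
  foldr (fun a u => iter (m a) (x a) u) v (enum 'I_n).

Definition pact (p : {mpoly k[n]}) (v : V) : V :=
  \sum_(m <- msupp p) p@_m *: xmon m v.

Hypothesis xL : forall a, linear (x a).
Hypothesis xC : forall a b v, x a (x b v) = x b (x a v).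

Lemma xmon_linear m : linear (xmon m).
Proof.
rewrite /xmon => a u v; elim: (enum 'I_n) => //= b s IH.
by rewrite IH (iter_linear _ (xL b)).
Qed.

Lemma xmon0 v : xmon 0%MM v = v.
Proof. by rewrite /xmon; elim: (enum 'I_n) => //= b s IH; rewrite mnm0E. Qed.

Lemma xmonD m1 m2 v : xmon (m1 + m2)%MM v = xmon m1 (xmon m2 v).
Proof.
have xitC a b d e w : iter d (x a) (iter e (x b) w) = iter e (x b) (iter d (x a) w).
  have H c : x a (iter c (x b) w) = iter c (x b) (x a w).
    by elim: c => //= c IH; rewrite xC IH.
  elim: d => //= d IH; rewrite IH.
  elim: e {IH H} => //= e IH; by rewrite xC IH.
rewrite /xmon; elim: (enum 'I_n) => //= b s ->.
rewrite mnmDE iterD; congr (iter _ _ _).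
move: (foldr _ v s) => z; elim: s => //= c s IH; by rewrite xitC IH.
Qed.

Lemma xmonU a v : xmon U_(a)%MM v = x a v.
Proof.
have H s w : a \notin s -> foldr (fun b u => iter (U_(a)%MM b) (x b) u) w s = w.
  elim: s => //= b s IH; rewrite inE negb_or => /andP[ab /IH ->].
  by rewrite mnm1E (negbTE ab).
rewrite /xmon; have := enum_uniq 'I_n; have : a \in enum 'I_n by rewrite mem_enum.
elim: (enum 'I_n) => //= b s IH; rewrite inE => /predU1P[<-|as_] /andP[bs us].
  by rewrite H // mnm1E eqxx.
by rewrite IH // mnm1E; case: eqP => // ab; rewrite -ab as_ in bs.
Qed.

(** The support depends on the polynomial; monomials of bounded degree form a common index set, from
    which linearity in [p] follows. *)
Lemma pactE i p v : (msize p <= i)%N ->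
  pact p v = \sum_(m : 'X_{1..n < i}) p@_m *: xmon m v.
Proof.
move=> le_pi; set I : subFinType _ := 'X_{1..n < i}.
rewrite /pact (big_mksub I) ?msupp_uniq //=; first last.
  by move=> m /msize_mdeg_lt /leq_trans; apply.
rewrite big_rmcond //= => j /memN_msupp_eq0 ->.
by rewrite scale0r.
Qed.

Lemma pact_linear p : linear (pact p).
Proof.
move=> a u v; rewrite /pact scaler_sumr -big_split /=; apply: eq_bigr => m _.
by rewrite xmon_linear scalerDr !scalerA mulrC.
Qed.

Lemma pact_lin v : linear (pact^~ v).
Proof.
move=> a p q; pose_big_enough i.
  rewrite !(@pactE i) // scaler_sumr -big_split /=; apply: eq_bigr => m _.
  by rewrite mcoeffD mcoeffZ scalerDl scalerA.
by close.
Qed.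

Lemma pactD p q v : pact (p + q) v = pact p v + pact q v.
Proof. exact: (rlinD (pact_lin v)). Qed.

Lemma pactB p q v : pact (p - q) v = pact p v - pact q v.
Proof. exact: (rlinB (pact_lin v)). Qed.

Lemma pactN p v : pact (- p) v = - pact p v.
Proof. exact: (rlinN (pact_lin v)). Qed.

Lemma pact0 v : pact 0 v = 0.
Proof. exact: (rlin0 (pact_lin v)). Qed.

Lemma pactXm m v : pact 'X_[m] v = xmon m v.
Proof. by rewrite /pact msuppX big_seq1 mcoeffX eqxx scale1r. Qed.

Lemma pactX a v : pact 'X_a v = x a v.
Proof. by rewrite pactXm xmonU. Qed.

Lemma pact1 v : pact 1 v = v.
Proof. by rewrite -mpolyX0 pactXm xmon0. Qed.

Lemma pactZ c p v : pact (c *: p) v = c *: pact p v.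
Proof. exact: (rlinZ (pact_lin v)). Qed.

Lemma pactC c v : pact c%:MP v = c *: v.
Proof. by rewrite -[c%:MP]mulr1 mul_mpolyC pactZ pact1. Qed.

Lemma pactM p q v : pact (p * q) v = pact p (pact q v).
Proof.
rewrite (mpolyE p) (mpolyE q) mulr_suml (rlin_sum (pact_lin v)).
rewrite (rlin_sum (pact_lin _)); apply: eq_bigr => m _.
rewrite mulr_sumr !(rlin_sum (pact_lin v)) (rlin_sum (pact_linear _)).
apply: eq_bigr => m' _; rewrite -scalerAl -scalerAr -mpolyXD !pactZ.
by rewrite (rlinZ (pact_linear _)) !pactXm xmonD.
Qed.

Lemma pact_comm p q v : pact p (pact q v) = pact q (pact p v).
Proof. by rewrite -!pactM mulrC. Qed.

Lemma pact_stable (S : set V) p v : subspace S ->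
  (forall a v, S v -> S (x a v)) -> S v -> S (pact p v).
Proof.
move=> HS Sx Sv; apply: subspace_sum => // m; apply: subspaceZ => //.
rewrite /xmon; elim: (enum 'I_n) => //= a s IH.
by elim: (m a) => //= d IHd; apply: Sx.
Qed.

Hypothesis xN : forall a v, exists d, iter d (x a) v = 0.

(** Bijectivity, with preimages inside any [x]-stable subspace. The subspaces used are a weight
    space and its intersection with a given stable subspace. *)
Definition unit_act (p : {mpoly k[n]}) : Prop :=
  (forall v, pact p v = 0 -> v = 0) /\
  (forall S : set V, subspace S -> (forall a v, S v -> S (x a v)) ->
     forall v, S v -> exists2 w, S w & v = pact p w).

Lemma unit_act_inj p v w : unit_act p -> pact p v = pact p w -> v = w.
Proof.
move=> [inj _] e; apply/eqP; rewrite -subr_eq0; apply/eqP/inj.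
by rewrite (rlinB (pact_linear p)) e subrr.
Qed.

Lemma unit_act1 : unit_act 1.
Proof.
by split=> [v|S _ _ v Sv]; [rewrite pact1 | exists v; rewrite ?pact1].
Qed.

Lemma unit_actM p q : unit_act p -> unit_act q -> unit_act (p * q).
Proof.
move=> [ip sp] [iq sq]; split=> [v|S HS Sx v Sv]; first by rewrite pactM => /ip/iq.
have [w Sw ->] := sp S HS Sx v Sv; have [z Sz ->] := sq S HS Sx w Sw.
by exists z => //; rewrite pactM.
Qed.

(** The operator is [T + c] with [T] locally nilpotent: a kernel vector would be an eigenvector of
    [T] for [- c], and preimages are found by induction on the exponent killing [v] under [T]. *)
Lemma unit_act_lin (a b : 'I_n) (c : k) :
  c != 0 -> unit_act ('X_a - 'X_b + c%:MP).
Proof.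
move=> c0; pose T v := x a v - x b v.
have TL : linear T by move=> d u w; rewrite /T !xL scalerBr opprD addrACA.
have E v : pact ('X_a - 'X_b + c%:MP) v = T v + c *: v.
  by rewrite pactD pactB !pactX pactC.
have TN v : exists d, iter d T v = 0.
  have [d dv] := xN a v; have [e ev] := xN b v.
  by exists (d + e)%N; apply: nil_sub.
have TZ u : T (c *: u) = c *: T u := rlinZ TL c u.
split=> [v|S HS Sx v Sv].
  rewrite E => /eqP; rewrite addr_eq0 -scaleNr => /eqP Tv; have [d Td] := TN v.
  by apply: (nil_eigen TL _ Td Tv); rewrite oppr_eq0.
have [d] := TN v; elim: d v Sv => [|d IH] v Sv.
  by move=> /= ->; exists 0; [exact: subspace0|rewrite (rlin0 (pact_linear _))].
rewrite iterSr => /IH[]; first by apply: subspaceB => //; apply: Sx.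
(* If [w] is a preimage of [T v], then [v - w] is sent to [T v + c v - T v = c v]. *)
move=> w Sw; rewrite E => Tw; exists (c^-1 *: (v - w)).
  by apply: subspaceZ => //; apply: subspaceB.
rewrite E (rlinZ TL) (rlinB TL) Tw scalerA mulfV // scale1r.
by rewrite addrAC subrr add0r scalerA mulVf // scale1r addrC subrK.
Qed.

End PolyAction.

(** * The rational functions p_i and q_i *)

Section PairPolynomials.
Variables (k : fieldType) (I : set k) (r n : nat).
Local Notation P := {mpoly k[n]}.
Local Notation K := (vertex I r).
Implicit Types (x y : K) (u v : P).

Lemma vertex_eqE x y : (x == y) = (x.2 == y.2) && (val x.1 == val y.1).
Proof.
case: x y => [i j] [i' j'] /=; apply/eqP/andP => [[-> ->]//|[/eqP -> /eqP e]].
by congr (_, _); apply: val_inj.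
Qed.

Definition dpoly x y u v : P := u - v + (val x.1 - val y.1)%:MP.

(* On a vector of weight al with al_i = x and al_(i+1) = y, the power series  *)
(* of the statement are q_i = qnum / den and p_i = pnum / den, evaluated at   *)
(* u = x_i and v = x_(i+1).                                                   *)
Definition den x y u v : P :=
  if x.2 == y.2 then if val x.1 == val y.1 then 1 else dpoly x y u v else 1.

Definition qnum x y u v : P :=
  if x.2 == y.2 then
    if val x.1 == val y.1 then v - u + 1
    else if val y.1 == val x.1 + 1 then 1
    else v - u + (val y.1 - val x.1 - 1)%:MP
  else 1.

Definition pnum x y : P := if x.2 == y.2 then 1 else 0.

Lemma den_eq x u v : den x x u v = 1.
Proof. by rewrite /den !eqxx. Qed.
Lemma qnum_eq x u v : qnum x x u v = v - u + 1.
Proof. by rewrite /qnum !eqxx. Qed.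
Lemma pnum_eq x : pnum x x = 1.
Proof. by rewrite /pnum eqxx. Qed.

Lemma den_j x y u v : x.2 != y.2 -> den x y u v = 1.
Proof. by rewrite /den => /negbTE ->. Qed.
Lemma qnum_j x y u v : x.2 != y.2 -> qnum x y u v = 1.
Proof. by rewrite /qnum => /negbTE ->. Qed.
Lemma pnum_j x y : x.2 != y.2 -> pnum x y = 0.
Proof. by rewrite /pnum => /negbTE ->. Qed.

Lemma neq_val x y : x != y -> x.2 = y.2 -> (val x.1 == val y.1) = false.
Proof. by rewrite vertex_eqE => + e; rewrite e eqxx /= => /negbTE. Qed.

Lemma den_ne x y u v : x != y -> x.2 = y.2 -> den x y u v = dpoly x y u v.
Proof. by move=> ne e; rewrite /den (neq_val ne e) e eqxx. Qed.
Lemma pnum_ne x y : x.2 = y.2 -> pnum x y = 1.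
Proof. by move=> e; rewrite /pnum e eqxx. Qed.

Lemma Q_eq x u v : Q x x u v = 0.
Proof. by rewrite /Q eqxx. Qed.

Lemma Q_j x y u v : x.2 != y.2 -> Q x y u v = 1.
Proof.
by move=> ne; rewrite /Q vertex_eqE /arrow [y.2 == _]eq_sym (negbTE ne).
Qed.

(** With d for [dpoly x y u v], write 1 - d^2 as (- d - 1)(d - 1). Each factor is a [qnum] when the
    corresponding arrow is absent; when it is present, that [qnum] is 1 and the factor sits in
    [Q]. *)
Lemma Q_quadratic x y u v : x != y -> x.2 = y.2 ->
  Q x y u v * (qnum x y u v * qnum y x v u) = 1 - dpoly x y u v ^+ 2.
Proof.
move=> ne e; have nv := neq_val ne e.
have nv' : (val y.1 == val x.1) = false by rewrite eq_sym.
rewrite /Q (negbTE ne) /arrow /arrow1 /qnum e eqxx !andTb nv nv' /dpoly.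
 case: (eqVneq (val y.1)) => [yE|ny].
  case: (eqVneq (val x.1)) => [xE|nx].
    (* Arrows in both directions force characteristic 2, and the two sides differ by a multiple of
       2. *)
    have two : (2%:R : P) = 0.
      rewrite -mpolyC_nat; suff -> : (2%:R : k) = 0 by rewrite mpolyC0.
      have := xE; rewrite yE -addrA => /eqP; rewrite addrC -subr_eq subrr eq_sym.
      by move=> /eqP; rewrite -mulr2n.
    have -> : (val x.1 - val y.1)%:MP = (-1 : P).
      by rewrite yE opprD addrA subrr add0r mpolyCN mpolyC1.
    have -> : - (u - v) ^+ 2 * (1 * 1) =
      1 - (u - v + -1) ^+ 2 - 2%:R * (u - v) by ring.
    by rewrite two mul0r subr0.
  rewrite yE; have -> : (val x.1 - (val x.1 + 1))%:MP = (-1 : P).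
    by rewrite opprD addrA subrr add0r mpolyCN mpolyC1.
  have -> : (val x.1 - (val x.1 + 1) - 1)%:MP = (-2%:R : P).
    by rewrite opprD addrA subrr add0r -opprD mpolyCN mpolyCD mpolyC1.
  by ring.
have E : (val y.1 - val x.1 - 1)%:MP = - (val x.1 - val y.1)%:MP - 1 :> P.
  by rewrite !mpolyCB mpolyC1; ring.
rewrite E; case: (eqVneq (val x.1)) => [xE|nx].
  have -> : (val x.1 - val y.1)%:MP = (1 : P).
    by rewrite xE addrAC subrr add0r mpolyC1.
  by ring.
have -> : (val x.1 - val y.1 - 1)%:MP = (val x.1 - val y.1)%:MP - 1 :> P.
  by rewrite mpolyCB mpolyC1.
by ring.
Qed.

Lemma dpolyN x y u v : dpoly y x v u = - dpoly x y u v.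
Proof. by rewrite /dpoly !mpolyCB; ring. Qed.

Section Units.
Variables (V : lmodType k) (xx : 'I_n -> V -> V).
Hypothesis xL : forall a, linear (xx a).
Hypothesis xC : forall a b w, xx a (xx b w) = xx b (xx a w).
Hypothesis xN : forall a w, exists d, iter d (xx a) w = 0.

Lemma den_unit x y a b : unit_act xx (den x y 'X_a 'X_b).
Proof.
rewrite /den; case: eqP => [e|_]; last exact: unit_act1.
case: eqVneq => [_|ne]; first exact: unit_act1.
by apply: unit_act_lin => //; rewrite subr_eq0.
Qed.

Lemma qnum_unit x y a b : unit_act xx (qnum x y 'X_a 'X_b).
Proof.
rewrite /qnum; case: eqP => [e|_]; last exact: unit_act1.
case: eqVneq => [_|ne].
  rewrite -[1 in X in unit_act _ X]mpolyC1.
  exact/unit_act_lin/oner_neq0.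
case: eqVneq => [_|ne1]; first exact: unit_act1.
by apply: unit_act_lin => //; rewrite subr_eq0 subr_eq addrC.
Qed.

End Units.
End PairPolynomials.

(** * Adjacent transpositions acting on variables and on weights *)

Section Places.
Variables (k : fieldType) (I : set k) (r n : nat).
Local Notation P := {mpoly k[n]}.
Local Notation wt := (weight I r n).

Definition sg (i : 'I_n.-1) (p : P) : P := msym (sperm i) p.

Lemma sgD i : {morph sg i : p q / p + q}. Proof. exact: msymD. Qed.
Lemma sgB i : {morph sg i : p q / p - q}. Proof. exact: msymB. Qed.
Lemma sgN i : {morph sg i : p / - p}. Proof. exact: msymN. Qed.
Lemma sgM i : {morph sg i : p q / p * q}. Proof. exact: msymM. Qed.
Lemma sg1 i : sg i 1 = 1. Proof. exact: msym1. Qed.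
Lemma sg0 i : sg i 0 = 0. Proof. exact: msym0. Qed.

Lemma sgC i c : sg i c%:MP = c%:MP.
Proof. by rewrite -[c%:MP]mulr1 mul_mpolyC /sg msymZ msym1. Qed.

Lemma sgX i a : sg i 'X_a = 'X_(sperm i a).
Proof.
rewrite /sg msymX tpermV; congr ('X_[_]); apply/mnmP => b.
by rewrite mnmE !mnm1E -(inj_eq (@perm_inj _ (sperm i))) tpermK.
Qed.

Lemma lo_neq_hi (i : 'I_n.-1) : lo i != hi i.
Proof. by rewrite -val_eqE /= neq_ltn leqnn. Qed.

Lemma sperm_lo (i : 'I_n.-1) : sperm i (lo i) = hi i.
Proof. exact: tpermL. Qed.
Lemma sperm_hi (i : 'I_n.-1) : sperm i (hi i) = lo i.
Proof. exact: tpermR. Qed.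
Lemma sperm_D (i : 'I_n.-1) a : a != lo i -> a != hi i -> sperm i a = a.
Proof. by move=> al ah; apply: tpermD; rewrite eq_sym. Qed.

Lemma sgX_lo i : sg i 'X_(lo i) = 'X_(hi i). Proof. by rewrite sgX sperm_lo. Qed.
Lemma sgX_hi i : sg i 'X_(hi i) = 'X_(lo i). Proof. by rewrite sgX sperm_hi. Qed.
Lemma sgX_D i a : a != lo i -> a != hi i -> sg i 'X_a = 'X_a.
Proof. by move=> al ah; rewrite sgX sperm_D. Qed.

Lemma swtE i (al : wt) a : swt i al a = al (sperm i a).
Proof. by rewrite ffunE. Qed.

Lemma swt_id i (al : wt) : al (lo i) = al (hi i) -> swt i al = al.
Proof.
move=> e; apply/ffunP => a; rewrite swtE.
have [->|al_] := eqVneq a (lo i); first by rewrite sperm_lo e.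
have [->|ah] := eqVneq a (hi i); first by rewrite sperm_hi e.
by rewrite sperm_D.
Qed.

Lemma swt_lo i (al : wt) : swt i al (lo i) = al (hi i).
Proof. by rewrite swtE sperm_lo. Qed.
Lemma swt_hi i (al : wt) : swt i al (hi i) = al (lo i).
Proof. by rewrite swtE sperm_hi. Qed.
Lemma swt_D i (al : wt) a : a != lo i -> a != hi i -> swt i al a = al a.
Proof. by move=> ? ?; rewrite swtE sperm_D. Qed.

Lemma far_places (i l : 'I_n.-1) : far i l ->
  [/\ lo l != lo i, lo l != hi i, hi l != lo i & hi l != hi i].
Proof.
by rewrite /far -!val_eqE /= => /orP[] h; split; apply/eqP; lia.
Qed.

Lemma far_sym (i l : 'I_n.-1) : far i l -> far l i.
Proof. by rewrite /far orbC. Qed.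

Lemma den_sg i x y (u v : P) : sg i (@den k I r n x y u v) = den x y (sg i u) (sg i v).
Proof.
rewrite /den /dpoly; case: eqP => _; last exact: sg1.
by case: eqP => _; rewrite ?sg1 // !(sgD, sgN, sgC).
Qed.

Lemma qnum_sg i x y (u v : P) :
  sg i (@qnum k I r n x y u v) = qnum x y (sg i u) (sg i v).
Proof.
rewrite /qnum; case: eqP => _; last exact: sg1.
case: eqP => _; first by rewrite !(sgD, sgN, sg1).
by case: eqP => _; rewrite ?sg1 // !(sgD, sgN, sgC).
Qed.

Lemma pnum_sg i (x y : vertex I r) : sg i (pnum n x y) = pnum n x y.
Proof. by rewrite /pnum; case: eqP => _; rewrite ?sg1 ?sg0. Qed.

End Places.

(** * Intertwining operators *)

Section IntertwiningData.
Variables (k : fieldType) (I : set k) (r n : nat) (V : lmodType k).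
Local Notation P := {mpoly k[n]}.
Local Notation wt := (weight I r n).

Definition den_at i (al : wt) : P := den (al (lo i)) (al (hi i)) 'X_(lo i) 'X_(hi i).
Definition qnum_at i (al : wt) : P :=
  qnum (al (lo i)) (al (hi i)) 'X_(lo i) 'X_(hi i).
Definition pnum_at i (al : wt) : P := pnum n (al (lo i)) (al (hi i)).

Record nil_action (x : 'I_n -> V -> V) : Prop := NilAction {
  nil_lin : forall a, linear (x a);
  nil_comm : forall a b v, x a (x b v) = x b (x a v);
  nil_nil : forall a v, exists d, iter d (x a) v = 0 }.

(* The last field is f_i = tau_i q_i - p_i with the denominator of the two    *)
(* power series cleared.                                                      *)
Record intertwining (W : wt -> set V) (x : 'I_n -> V -> V)
    (tau f : 'I_n.-1 -> V -> V) : Prop := Intertwining {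
  itw_sub : forall al, subspace (W al);
  itw_nil : nil_action x;
  itw_xW : forall al a v, W al v -> W al (x a v);
  itw_tauL : forall i, linear (tau i);
  itw_fL : forall i, linear (f i);
  itw_tauW : forall i al v, W al v -> W (swt i al) (tau i v);
  itw_tau_x : forall i al a v, W al v ->
    tau i (x a v) = x (sperm i a) (tau i v) +
      (if al (lo i) == al (hi i) then
         if a == lo i then - v else if a == hi i then v else 0
       else 0);
  itw_f : forall i al v, W al v ->
    f i (pact x (den_at i al) v) =
    tau i (pact x (qnum_at i al) v) - pact x (pnum_at i al) v }.

End IntertwiningData.

Section Intertwiners.
Variables (k : fieldType) (I : set k) (r n : nat) (V : lmodType k).
Local Notation P := {mpoly k[n]}.
Local Notation wt := (weight I r n).
Variables (W : wt -> set V) (x : 'I_n -> V -> V) (tau f : 'I_n.-1 -> V -> V).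
Hypothesis itw : intertwining W x tau f.

Let Wsub := itw_sub itw.
Let xL := nil_lin (itw_nil itw).
Let xC := nil_comm (itw_nil itw).
Let xN := nil_nil (itw_nil itw).
Let xW := itw_xW itw.
Let tauL := itw_tauL itw.
Let fL := itw_fL itw.
Let tauW := itw_tauW itw.
Let tau_x := itw_tau_x itw.
Let f_tau := itw_f itw.

Local Notation "p \@ v" := (pact x p v) (at level 42, right associativity).

Lemma pactW al p v : W al v -> W al (p \@ v).
Proof. by move=> Wv; apply: pact_stable => // a w; apply: xW. Qed.

(** Moving [tau i] past a polynomial produces the divided difference of [p]. The property holds for
    constants and variables and is closed under sums and products; quantifying over [D]
    existentially avoids dividing polynomials. *)
Lemma tau_pact_ex i al (p : P) : exists2 D : P,
  ('X_(hi i) - 'X_(lo i)) * D = p - sg i p &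
  forall v, W al v -> tau i (p \@ v) = sg i p \@ tau i v +
    (if al (lo i) == al (hi i) then D else 0) \@ v.
Proof.
pose ok (p : P) := exists2 D : P,
  ('X_(hi i) - 'X_(lo i)) * D = p - sg i p &
  forall v, W al v -> tau i (p \@ v) = sg i p \@ tau i v +
    (if al (lo i) == al (hi i) then D else 0) \@ v.
rewrite -/(ok p).
have okC c : ok c%:MP.
  exists 0 => [|v Wv]; first by rewrite sgC subrr mulr0.
  by rewrite if_same pact0 addr0 sgC !pactC // (rlinZ (tauL i)).
have okX a : ok 'X_a.
  exists (if a == lo i then -1 else if a == hi i then 1 else 0).
    case: eqVneq => [->|al_]; first by rewrite sgX_lo; ring.
    case: eqVneq => [->|ah]; first by rewrite sgX_hi mulr1.
    by rewrite sgX_D // mulr0 subrr.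
  move=> v Wv; rewrite sgX !pactX // (tau_x _ _ Wv); congr (_ + _).
  case: (_ == _); last by rewrite pact0.
  by do 2?case: (_ == _); rewrite ?pactN ?pact1 ?pact0.
have okD p1 q : ok p1 -> ok q -> ok (p1 + q).
  move=> [D DE Dt] [E EE Et]; exists (D + E) => [|v Wv].
    by rewrite mulrDr DE EE sgD; ring.
  rewrite sgD !pactD (rlinD (tauL i)) (Dt _ Wv) (Et _ Wv) addrACA.
  by congr (_ + _); case: (_ == _); rewrite ?pactD // pact0 addr0.
have okM p1 q : ok p1 -> ok q -> ok (p1 * q).
  (* Twisted Leibniz rule for the divided difference. *)
  move=> [D DE Dt] [E EE Et]; exists (sg i p1 * E + D * q) => [|v Wv].
    rewrite mulrDr mulrCA EE mulrA DE sgM; ring.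
  rewrite pactM // (Dt _ (pactW q Wv)) (Et _ Wv) sgM.
  rewrite (rlinD (pact_linear xL _)) -addrA pactM //; congr (_ + _).
  by case: (_ == _); rewrite ?pactD ?pactM // !pact0 (rlin0 (pact_linear xL _)) addr0.
have ok1 : ok 1 by rewrite -mpolyC1.
elim/mpolyind: p => [|c m p _ _ IH]; first by rewrite -mpolyC0.
apply: (okD _ _ _ IH); rewrite -mul_mpolyC; apply: (okM _ _ (okC c)).
rewrite mpolyXE_id; apply: (big_ind ok ok1 okM) => a _.
elim: (m a) => [|d IHd]; first by rewrite expr0; exact: (ok1).
by rewrite exprS; exact: (okM _ _ (okX a) IHd).
Qed.

(** The polynomial ring is a domain and ['X_(hi i) - 'X_(lo i)] is nonzero, so any [D] with the
    right product is the divided difference. *)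
Lemma tau_pact i al (p D : P) v : W al v ->
  (if al (lo i) == al (hi i) then ('X_(hi i) - 'X_(lo i)) * D = p - sg i p
   else D = 0) ->
  tau i (p \@ v) = sg i p \@ tau i v + D \@ v.
Proof.
move=> Wv HD; have [D' D'E D't] := tau_pact_ex i al p.
rewrite (D't _ Wv); case: (_ == _) HD => [|-> //]; rewrite -D'E => DD.
suff -> : D' = D by [].
apply: (mulfI _ (esym DD)); rewrite subr_eq0; apply/eqP => /(congr1 (mcoeff U_(hi i))).
rewrite !mcoeffX eqxx eq_mnm1 (negbTE (lo_neq_hi i)) /= => /eqP.
by rewrite oner_eq0.
Qed.

Lemma tau_pact_sym i al (p : P) v : W al v -> sg i p = p ->
  tau i (p \@ v) = p \@ tau i v.
Proof.
move=> Wv sp; rewrite (tau_pact (D := 0) Wv) ?sp ?pact0 ?addr0 //.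
by rewrite mulr0 subrr if_same.
Qed.

Lemma tau_pact_neq i al (p : P) v : W al v -> al (lo i) != al (hi i) ->
  tau i (p \@ v) = sg i p \@ tau i v.
Proof.
by move=> Wv ne; rewrite (tau_pact (D := 0) Wv) ?(negbTE ne) // pact0 addr0.
Qed.

(** Here [f] is [tau (x_(i+1) - x_i + 1) - 1]. The divided difference of [(x_(i+1) - x_i + 1) * g]
    is [sg i g + D + g], and its last term cancels against the - 1. *)
Lemma f_eq i al (g D : P) v : W al v -> al (lo i) = al (hi i) ->
  ('X_(lo i) - 'X_(hi i)) * D = sg i g - g ->
  f i (g \@ v) = ((1 + 'X_(lo i) - 'X_(hi i)) * sg i g) \@ tau i v
                 + (sg i g + D) \@ v.
Proof.
move=> Wv e DE; have Wg := pactW g Wv.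
have := f_tau i Wg; rewrite /den_at /qnum_at /pnum_at e den_eq qnum_eq pnum_eq.
rewrite !pact1 // => ->; rewrite -pactM //.
have sE : sg i (('X_(hi i) - 'X_(lo i) + 1) * g)
    = (1 + 'X_(lo i) - 'X_(hi i)) * sg i g.
  by rewrite sgM !(sgD, sgN, sg1) sgX_lo sgX_hi; ring.
rewrite (tau_pact (D := sg i g + D + g) Wv); last first.
  rewrite e eqxx sE mulrDr mulrDr.
  have -> : ('X_(hi i) - 'X_(lo i)) * D = g - sg i g.
    by rewrite -opprB mulNr DE; ring.
  by ring.
by rewrite sE -addrA -pactB addrK.
Qed.

(** For distinct vertices [tau] has no correction term, but [g] must contain the denominator as a
    factor for [f] to be computed with polynomials alone. *)
Lemma f_neq i al (g g' : P) v : W al v -> al (lo i) != al (hi i) ->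
  g = den_at i al * g' ->
  f i (g \@ v) = (qnum (al (lo i)) (al (hi i)) 'X_(hi i) 'X_(lo i) * sg i g')
                   \@ tau i v - (pnum_at i al * g') \@ v.
Proof.
move=> Wv ne ->; rewrite pactM // (f_tau i (pactW _ Wv)) -!pactM //.
by rewrite (tau_pact_neq _ Wv ne) sgM qnum_sg sgX_lo sgX_hi.
Qed.

(** For distinct vertices [G] is the product of the denominators met by the two applications of [f],
    and [E] is the product of the two numerators, so that [Q_quadratic] evaluates [E * Q]. For equal
    vertices no denominator occurs and [Q] vanishes. *)
Lemma f_quadratic i al : exists G E : P,
  [/\ unit_act x G, unit_act x E & forall z, W al z ->
  f i (f i (G \@ z)) - G \@ z = E \@ (tau i (tau i z)
    - Q (al (lo i)) (al (hi i)) 'X_(lo i) 'X_(hi i) \@ z)].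
Proof.
set x1 : P := 'X_(lo i); set x2 : P := 'X_(hi i).
have sx1 : sg i x1 = x2 := sgX_lo k i.
have sx2 : sg i x2 = x1 := sgX_hi k i.
have u1 : unit_act x (x1 - x2 + 1) by rewrite -mpolyC1; exact/unit_act_lin/oner_neq0.
have u2 : unit_act x (x2 - x1 + 1) by rewrite -mpolyC1; exact/unit_act_lin/oner_neq0.
have [e|ne] := eqVneq (al (lo i)) (al (hi i)).
  exists 1, ((x1 - x2 + 1) * (x2 - x1 + 1)); split; [exact: unit_act1|exact: unit_actM|].
  move=> z Wz; have Wt := tauW i Wz; rewrite swt_id // in Wt.
  rewrite (f_eq (D := 0) Wz e) ?sg1 ?mulr0 ?subrr // mulr1 addr0.
  rewrite (rlinD (fL i)) (f_eq (D := 0) Wz e) ?sg1 ?mulr0 ?subrr //.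
  (* The divided difference of [1 + x1 - x2], the coefficient produced by the first application of
     [f]. *)
  rewrite (f_eq (D := -2%:R) Wt e); last first.
    by rewrite !(sgD, sgN, sg1, sx1, sx2); rewrite -/x1 -/x2; ring.
  rewrite !(sgD, sgN, sg1, sx1, sx2) e Q_eq pact0 subr0 pact1 // mulr1 addr0 pact1 //.
  rewrite addrA addrK -addrA -pactD -/x1 -/x2.
  have -> : 1 + x2 - x1 + -2%:R + (1 + x1 - x2) = 0 by ring.
  by rewrite pact0 addr0; congr (pact _ _ _); ring.
set A := al (lo i) in ne *; set B := al (hi i) in ne *.
have ne' : swt i al (lo i) != swt i al (hi i) by rewrite swt_lo swt_hi eq_sym.
exists (den A B x1 x2 * den B A x2 x1), (qnum A B x1 x2 * qnum B A x2 x1).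
split; [by apply: unit_actM => //; apply: den_unit
  |by apply: unit_actM => //; apply: qnum_unit|].
move=> z Wz; have Wt := tauW i Wz.
rewrite (f_neq (g' := den B A x2 x1) Wz ne) // (rlinB (fL i)) den_sg sx1 sx2.
rewrite (f_neq (g' := qnum A B x2 x1) Wt ne'); last first.
  by rewrite mulrC /den_at swt_lo swt_hi.
rewrite swt_lo swt_hi -/A -/B qnum_sg -/x1 -/x2 sx1 sx2 /pnum_at swt_lo swt_hi -/A -/B.
have [e|nj] := eqVneq A.2 B.2; last first.
  have nj' : B.2 != A.2 by rewrite eq_sym.
  rewrite !qnum_j // !den_j // !pnum_j // Q_j // !mulr1 ?mul0r !pact0 !pact1 //.
  by rewrite subr0 (rlin0 (fL i)) subr0.
rewrite !pnum_ne // !den_ne // 1?eq_sym // !mul1r.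
(* The denominators of a weight and of its swap, with the variables exchanged as well, are opposite
   to each other. *)
rewrite (f_neq (g' := -1) Wz ne); last first.
  by rewrite /den_at den_ne // dpolyN -/x1 -/x2 -/A -/B; ring.
rewrite /pnum_at pnum_ne // sgN sg1 -/A -/B -/x1 -/x2 !mulrN1 !pactN pact1 //.
rewrite (rlinB (pact_linear xL _)) -pactM //.
have -> : qnum A B x1 x2 * qnum B A x2 x1 * Q A B x1 x2 =
    1 - dpoly A B x1 x2 ^+ 2 by rewrite mulrC Q_quadratic.
rewrite (dpolyN A B) mulrN pactN pactB pact1 // -expr2 [qnum B A _ _ * _]mulrC.
by rewrite !opprK opprD opprK addrA subrK opprB addrA addrAC.
Qed.

(** The polynomials at the places of [i] are fixed by the transposition of [l] and conversely. In
    the expansion of [f i (f l _)] every term except the one with both tau's is then symmetric in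
    [i] and [l] and cancels in the commutator. *)
Lemma f_far i l al : far i l -> exists G E : P,
  [/\ unit_act x G, unit_act x E & forall z, W al z ->
  f i (f l (G \@ z)) - f l (f i (G \@ z)) =
    tau i (tau l (E \@ z)) - tau l (tau i (E \@ z))].
Proof.
move=> fil; exists (den_at i al * den_at l al), (qnum_at i al * qnum_at l al).
split; [by apply: unit_actM => //; apply: den_unit
  |by apply: unit_actM => //; apply: qnum_unit|].
move=> z Wz.
have half j m : far j m -> f j (f m ((den_at j al * den_at m al) \@ z)) =
    tau j (tau m ((qnum_at j al * qnum_at m al) \@ z))
    - pnum_at m al \@ tau j (qnum_at j al \@ z)
    - (pnum_at j al \@ tau m (qnum_at m al \@ z))
    + (pnum_at j al * pnum_at m al) \@ z.
  move=> fjm; have [ll lh hl hh] := far_places fjm.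
  have [ll' lh' hl' hh'] := far_places (far_sym fjm).
  have mj : den_at j (swt m al) = den_at j al by rewrite /den_at !swt_D.
  have mq : qnum_at j (swt m al) = qnum_at j al by rewrite /qnum_at !swt_D.
  have mp : pnum_at j (swt m al) = pnum_at j al by rewrite /pnum_at !swt_D.
  have sd : sg m (den_at j al) = den_at j al by rewrite den_sg !sgX_D.
  have sq : sg m (qnum_at j al) = qnum_at j al by rewrite qnum_sg !sgX_D.
  have ps i' w : tau i' (pnum_at m al \@ w) = pnum_at m al \@ tau i' w.
    rewrite /pnum_at /pnum; case: eqP => _; first by rewrite !pact1.
    by rewrite !pact0 (rlin0 (tauL i')).
  have F1 := f_tau j (tauW m (pactW (qnum_at m al) Wz)).
  rewrite mj mq mp in F1.
  rewrite [den_at j al * _]mulrC (pactM xL xC (den_at m al)).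
  rewrite (f_tau m (pactW _ Wz)) (pact_comm xL xC (qnum_at m al)).
  rewrite (tau_pact_sym (pactW _ Wz) sd).
  rewrite (pact_comm xL xC (pnum_at m al) (den_at j al)).
  rewrite (rlinB (fL j)) F1 (f_tau j (pactW _ Wz)).
  rewrite -(tau_pact_sym (pactW _ Wz) sq) -(pactM xL xC (qnum_at j al)).
  rewrite (pact_comm xL xC (qnum_at j al)) ps -(pactM xL xC (pnum_at j al)).
  by rewrite opprB [_ \@ z - _]addrC addrA [_ - _ - pnum_at m al \@ _]addrAC.
rewrite half // [den_at i al * _]mulrC half 1?far_sym //.
rewrite [qnum_at l al * _]mulrC [pnum_at l al * _]mulrC.
set T1 := tau i (tau l _); set T2 := tau l (tau i _).
set b := pact _ _ (tau i _); set c := pact _ _ (tau l _); set d := pact _ _ z.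
rewrite [T2 - c - b]addrAC opprD addrACA subrr addr0.
by rewrite -[T1 - b - c]addrA -[T2 - b - c]addrA -opprD opprB addrA subrK.
Qed.

End Intertwiners.

(** * Braid relations *)

Section Braid.
Variables (k : fieldType) (I : set k) (r n : nat) (V : lmodType k).
Local Notation P := {mpoly k[n]}.
Local Notation wt := (weight I r n).
Local Notation K := (vertex I r).
Variable x : 'I_n -> V -> V.
Hypothesis xact : nil_action x.
Let xL := nil_lin xact.
Let xC := nil_comm xact.
Let xN := nil_nil xact.

Local Notation "p \@ v" := (pact x p v) (at level 42, right associativity).

(* In the first clause D is the divided difference of g.                      *)
Definition f_step (F : V -> V) (s : P -> P) (u v : P) (y z : K) (w w' : V) :=
  (y = z -> forall g D, (u - v) * D = s g - g ->
     F (g \@ w) = ((1 + u - v) * s g) \@ w' + (s g + D) \@ w) /\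
  (y != z -> forall a g, a = den y z u v * g ->
     F (a \@ w) = (qnum y z v u * s g) \@ w' + (- (pnum n y z * g)) \@ w).

(** Normal form of the word [F1 F2 F1] with all polynomials on the left. The digits in a name spell
    a word in the tau's applied to [z0], leftmost letter last; [S] is the polynomial by which tau_1
    squared acts on [z0]. *)
Lemma f_word (F1 F2 : V -> V) z0 z1 z2 z12 z21 z121
    (S G L M a0 a1 a2 a21 l0 m0 l1 m1 l2 m2 l21 m21 : P) :
  linear F1 -> linear F2 ->
  F1 (G \@ z0) = L \@ z1 + M \@ z0 ->
  F2 (M \@ z0) = a2 \@ z2 + a0 \@ z0 ->
  F2 (L \@ z1) = a21 \@ z21 + a1 \@ z1 ->
  F1 (a0 \@ z0) = l0 \@ z1 + m0 \@ z0 ->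
  F1 (a1 \@ z1) = l1 \@ (S \@ z0) + m1 \@ z1 ->
  F1 (a2 \@ z2) = l2 \@ z12 + m2 \@ z2 ->
  F1 (a21 \@ z21) = l21 \@ z121 + m21 \@ z21 ->
  F1 (F2 (F1 (G \@ z0))) = (m0 + l1 * S) \@ z0 + (l0 + m1) \@ z1 + m2 \@ z2
    + l2 \@ z12 + m21 \@ z21 + l21 \@ z121.
Proof.
move=> L1 L2 -> ; rewrite (rlinD L2) => -> ->.
rewrite !(rlinD L1) => -> -> -> ->; rewrite !pactD // pactM //.
set A0 := l0 \@ z1; set A1 := m0 \@ z0; set A2 := l2 \@ z12; set A3 := m2 \@ z2.
set A4 := l21 \@ z121; set A5 := m21 \@ z21; set A6 := pact _ l1 _; set A7 := m1 \@ z1.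
by rewrite (AC ((2*2)*(2*2)) ((8*3)*(7*4)*6*5*2*1)).
Qed.

Lemma f_words_sub z0 z1 z2 z12 z21 z121 z212
    (u0 u1 u2 u12 u21 v0 v1 v2 v12 v21 E F D : P) :
  u0 - v0 = E * D -> u1 = v1 -> u2 = v2 -> u12 = v12 -> u21 = v21 -> F = E ->
  (u0 \@ z0 + u1 \@ z1 + u2 \@ z2 + u12 \@ z12 + u21 \@ z21 + E \@ z121) -
  (v0 \@ z0 + v2 \@ z2 + v1 \@ z1 + v21 \@ z21 + v12 \@ z12 + F \@ z212) =
  E \@ (z121 - z212 + D \@ z0).
Proof.
move=> e0 -> -> -> -> ->; rewrite (rlinD (pact_linear xL E)).
rewrite (rlinB (pact_linear xL E)) -pactM // -e0 pactB //.
rewrite !opprD (AC (6*6) ((6*12)*(1*7)*((2*9)*(3*8)*(4*11)*(5*10)))) /=.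
by rewrite !subrr !addr0.
Qed.

Definition vN (y : K) : P := (val y.1)%:MP.

Lemma pair_same (y z : K) : y != z -> y.2 = z.2 ->
  ((forall u v : P, (den y z u v = u - v + (vN y - vN z))%R) *
   (forall u v : P, (den z y u v = u - v + (vN z - vN y))%R) *
   (pnum n y z = 1)%R * (pnum n z y = 1)%R)%type.
Proof.
move=> ne e; have ne' : z != y by rewrite eq_sym.
by rewrite /vN -!mpolyCB; do !split; move=> *; rewrite ?den_ne ?pnum_ne.
Qed.

Lemma pair_diff (y z : K) : y.2 != z.2 ->
  ((forall u v : P, (den y z u v = 1)%R) * (forall u v : P, (den z y u v = 1)%R) *
   (pnum n y z = 0)%R * (pnum n z y = 0)%R *
   (forall u v : P, (qnum y z u v = 1)%R) * (forall u v : P, (qnum z y u v = 1)%R) *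
   (forall u v : P, (Q y z u v = 1)%R) * (forall u v : P, (Q z y u v = 1)%R))%type.
Proof.
move=> ne; have ne' : z.2 != y.2 by rewrite eq_sym.
by do !split; move=> *; rewrite ?den_j ?pnum_j ?qnum_j ?Q_j.
Qed.

(** The sign [s] merges the cases of equal and different second components, so that the witnesses in
    the braid computations need not be split. *)
Lemma pair_quadratic (y z : K) : y != z -> exists s : P,
  [/\ (s = -1 /\ y.2 = z.2) \/ (s = 1 /\ y.2 != z.2),
    forall u v : P, den y z u v = s * den z y v u &
    forall u v : P, Q y z u v * (qnum y z u v * qnum z y v u)
                = s * (den y z u v ^+ 2 - pnum n y z)].
Proof.
move=> ne; have [e|nj] := eqVneq y.2 z.2.
  exists (-1); split; [by left| |] => u v.
    by rewrite !(pair_same ne e) /=; ring.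
  by rewrite Q_quadratic // !(pair_same ne e) /dpoly mpolyCB -!/(vN _); ring.
exists 1; split; [by right| |] => *; rewrite ?(pair_diff nj).
- by rewrite mul1r.
- by rewrite subr0 expr1n !mul1r.
Qed.

(* The signs are arranged so that 2 = 0 is not needed when arrows in both     *)
(* directions exist: there -(u - v)^2 = 1 - (u - v - 1)^2.                    *)
Lemma pair_arrows (y z : K) : y != z -> y.2 = z.2 ->
  let d (y z : K) (u v : P) := u - v + (vN y - vN z) in
  exists b b' : bool,
   ((forall u v : P, (qnum y z u v = if b then 1 else - d y z u v - 1)%R) *
    (forall u v : P, (qnum z y u v = if b' then 1 else - d z y u v - 1)%R) *
    (forall u v : P, (Q y z u v = (if b then - d y z u v - 1 else 1) *
                                 (if b' then d y z u v - 1 else 1))%R) *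
    (forall u v : P, (Q z y u v = (if b' then - d z y u v - 1 else 1) *
                                 (if b then d z y u v - 1 else 1))%R))%type.
Proof.
move=> ne e d; have nv := neq_val ne e.
have nv' : (val z.1 == val y.1) = false by rewrite eq_sym.
have ne' : z != y by rewrite eq_sym.
exists (val z.1 == val y.1 + 1), (val y.1 == val z.1 + 1).
rewrite /Q (negbTE ne) (negbTE ne') /arrow /arrow1 /qnum e eqxx !andTb nv nv'.
rewrite !mpolyCB !mpolyC1 -!/(vN _) /d.
have vE (y1 z1 : K) : val z1.1 = val y1.1 + 1 -> vN z1 = vN y1 + 1.
  by move=> h; rewrite /vN h mpolyCD mpolyC1.
have [zE|nz] := eqVneq (val z.1) (val y.1 + 1);
  have [yE|ny] := eqVneq (val y.1) (val z.1 + 1);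
  do !split; move=> u v //=; try ring; rewrite ?(vE _ _ zE); try ring.
- have vy := vE _ _ yE; rewrite (vE _ _ zE) in vy.
  have two : (2%:R : P) = 0.
    by apply: (addrI (vN y)); rewrite addr0 {2}vy; ring.
  by apply/eqP; rewrite -subr_eq0 -[X in X == _](_ : 2%:R * (v - u) = _);
    [rewrite two mul0r|ring].
- have vy := vE _ _ yE; rewrite (vE _ _ zE) in vy.
  have two : (2%:R : P) = 0.
    by apply: (addrI (vN y)); rewrite addr0 {2}vy; ring.
  by apply/eqP; rewrite -subr_eq0 -[X in X == _](_ : 2%:R * (u - v) = _);
    [rewrite two mul0r|ring].
all: rewrite ?(vE _ _ yE); ring.
Qed.

End Braid.

Ltac sg_simp := rewrite ?(sgM, sgD, sgB, sgN, sg1, sg0, den_sg, qnum_sg, pnum_sg).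

(** * The braid relation, by coincidences among three consecutive vertices *)

Section BraidWords.
Variables (k : fieldType) (I : set k) (r n : nat) (V : lmodType k).
Local Notation P := {mpoly k[n]}.
Local Notation wt := (weight I r n).
Local Notation K := (vertex I r).
Variable x : 'I_n -> V -> V.
Hypothesis xact : nil_action x.
Let xL := nil_lin xact.
Let xC := nil_comm xact.
Let xN := nil_nil xact.

Local Notation "p \@ v" := (pact x p v) (at level 42, right associativity).

Variables (i l : 'I_n.-1).
Hypothesis il : l = i.+1 :> nat.
Local Notation X1 := ('X_(lo i) : P).
Local Notation X2 := ('X_(hi i) : P).
Local Notation X3 := ('X_(hi l) : P).

Lemma lo_succ : lo l = hi i.
Proof. exact: val_inj. Qed.

Lemma hi_succ : hi l != lo i /\ hi l != hi i.
Proof.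
by split; rewrite -val_eqE /= il; apply/eqP; lia.
Qed.

Lemma lo_nsucc : lo i != lo l /\ lo i != hi l.
Proof.
by split; rewrite -val_eqE /= ?il; apply/eqP; lia.
Qed.

Lemma sg_places :
  ((sg i X1 = X2) * (sg i X2 = X1) * (sg i X3 = X3) *
   (sg l X1 = X1) * (sg l X2 = X3) * (sg l X3 = X2))%type.
Proof.
have [h1 h2] := hi_succ; have [h3 h4] := lo_nsucc.
split; [split; [split; [split; [split|]|]|]|].
- exact: sgX_lo.
- exact: sgX_hi.
- exact: sgX_D.
- exact: sgX_D.
- by rewrite -lo_succ sgX_lo.
- by rewrite sgX_hi lo_succ.
Qed.

Variables F1 F2 : V -> V.
Local Notation f_step := (f_step x).
Hypotheses (L1 : linear F1) (L2 : linear F2).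

(** [A], [B], [C] are the vertices of [z0] at the three places, and each field shows the two
    vertices that the word has brought to the places acted on. In [h11] and [h22] the square of a
    tau has been replaced by [Q], so the quadratic relation is presupposed. *)
Record braid_steps (z0 z1 z2 z12 z21 z121 z212 : V) (A B C : K) : Prop :=
  BraidSteps {
  h10 : f_step F1 (sg i) X1 X2 A B z0 z1;
  h11 : f_step F1 (sg i) X1 X2 B A z1 (Q A B X1 X2 \@ z0);
  h12 : f_step F1 (sg i) X1 X2 A C z2 z12;
  h121 : f_step F1 (sg i) X1 X2 B C z21 z121;
  h20 : f_step F2 (sg l) X2 X3 B C z0 z2;
  h21 : f_step F2 (sg l) X2 X3 A C z1 z21;
  h22 : f_step F2 (sg l) X2 X3 C B z2 (Q B C X2 X3 \@ z0);
  h212 : f_step F2 (sg l) X2 X3 A B z12 z212 }.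

(* G clears the denominators met along both words; E is the coefficient of    *)
(* the longest word when all polynomials have been moved to the left.         *)
Definition braid_conclusion (A B C : K) : Prop := exists G E : P,
  [/\ unit_act x G, unit_act x E & forall z0 z1 z2 z12 z21 z121 z212,
    braid_steps z0 z1 z2 z12 z21 z121 z212 A B C -> forall D : P,
    (if A == C then (X3 - X1) * D = Q A B X3 X2 - Q A B X1 X2 else D = 0) ->
    F1 (F2 (F1 (G \@ z0))) - F2 (F1 (F2 (G \@ z0)))
    = E \@ (z121 - z212 + D \@ z0)].

(** All intermediate coefficients are variables, to be left open by [eapply] and filled in by the
    fourteen applications of [F1] and [F2]. What remains is one polynomial identity for each
    tau-word: coefficients of the shorter words agree, those of the two longest equal [E], and those
    of [z0] differ by [E * D]. *)
Lemma braid_words (z0 z1 z2 z12 z21 z121 z212 : V) (G E D : P)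
  (S T L M a0 a1 a2 a21 l0 m0 l1 m1 l2 m2 l21 m21 : P)
  (L' M' b0 b2 b1 b12 l0' m0' l2' m2' l1' m1' l12' m12' : P) :
  F1 (G \@ z0) = L \@ z1 + M \@ z0 ->
  F2 (M \@ z0) = a2 \@ z2 + a0 \@ z0 ->
  F2 (L \@ z1) = a21 \@ z21 + a1 \@ z1 ->
  F1 (a0 \@ z0) = l0 \@ z1 + m0 \@ z0 ->
  F1 (a1 \@ z1) = l1 \@ (S \@ z0) + m1 \@ z1 ->
  F1 (a2 \@ z2) = l2 \@ z12 + m2 \@ z2 ->
  F1 (a21 \@ z21) = l21 \@ z121 + m21 \@ z21 ->
  F2 (G \@ z0) = L' \@ z2 + M' \@ z0 ->
  F1 (M' \@ z0) = b1 \@ z1 + b0 \@ z0 ->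
  F1 (L' \@ z2) = b12 \@ z12 + b2 \@ z2 ->
  F2 (b0 \@ z0) = l0' \@ z2 + m0' \@ z0 ->
  F2 (b2 \@ z2) = l2' \@ (T \@ z0) + m2' \@ z2 ->
  F2 (b1 \@ z1) = l1' \@ z21 + m1' \@ z1 ->
  F2 (b12 \@ z12) = l12' \@ z212 + m12' \@ z12 ->
  m0 + l1 * S - (m0' + l2' * T) = E * D ->
  l0 + m1 = m1' -> m2 = l0' + m2' -> l2 = m12' -> m21 = l1' ->
  l21 = E -> l12' = E ->
  F1 (F2 (F1 (G \@ z0))) - F2 (F1 (F2 (G \@ z0)))
    = E \@ (z121 - z212 + D \@ z0).
Proof.
move=> h1 h2 h3 h4 h5 h6 h7 g1 g2 g3 g4 g5 g6 g7 e0 e1 e2 e12 e21 eE eE'.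
rewrite (f_word xact L1 L2 h1 h2 h3 h4 h5 h6 h7).
rewrite (f_word xact L2 L1 g1 g2 g3 g4 g5 g6 g7) eE.
exact: f_words_sub.
Qed.



Tactic Notation "neq_step" constr(H) constr(ne) uconstr(g) := refine (proj2 H ne _ g _).
Tactic Notation "eq_step" constr(H) uconstr(D) := refine (proj1 H erefl _ D _).

(** Lets [ring] prove an identity modulo the relation [a = b], given the cofactor [c]. *)
Lemma eq_modulo (a b c L R : P) : a = b -> L = R + c * (a - b) -> L = R.
Proof. by move=> ->; rewrite subrr mulr0 addr0. Qed.

Lemma unit_act_succ a b : unit_act x (1 + 'X_a - 'X_b).
Proof.
have -> : 1 + 'X_a - 'X_b = 'X_a - 'X_b + 1%:MP :> P by rewrite mpolyC1; ring.
exact/unit_act_lin/oner_neq0.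
Qed.

Ltac places := do 2!(sg_simp; rewrite ?sg_places).

Lemma braid_all_eq A : braid_conclusion A A A.
Proof.
exists 1, ((1 + X1 - X2) * (1 + X1 - X3) * (1 + X2 - X3)).
split; [exact: unit_act1 | by do !apply: unit_actM => //; apply: unit_act_succ |].
move=> z0 z1 z2 z12 z21 z121 z212 H D; rewrite eqxx !Q_eq subrr => DE.
have -> : D = 0.
  apply/eqP; move/eqP: DE; rewrite mulf_eq0 => /orP[|//].
  rewrite subr_eq0 => /eqP /(congr1 (mcoeff U_(hi l))).
  rewrite !mcoeffX eqxx eq_mnm1 eq_sym (negbTE (proj1 hi_succ)) /= => /eqP.
  by rewrite oner_eq0.
eapply braid_words.
- eq_step (h10 H) 0; sg_simp; ring.
- eq_step (h20 H) 0; sg_simp; ring.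
- eq_step (h21 H) 1; sg_simp; rewrite !sg_places; ring.
- eq_step (h10 H) 0; sg_simp; ring.
- eq_step (h11 H) (-1); sg_simp; rewrite !sg_places; ring.
- eq_step (h12 H) 1; sg_simp; rewrite !sg_places; ring.
- eq_step (h121 H) 0; sg_simp; rewrite !sg_places; ring.
- eq_step (h20 H) 0; sg_simp; ring.
- eq_step (h10 H) 0; sg_simp; ring.
- eq_step (h12 H) 1; sg_simp; rewrite !sg_places; ring.
- eq_step (h20 H) 0; sg_simp; ring.
- eq_step (h22 H) (-1); sg_simp; rewrite !sg_places; ring.
- eq_step (h21 H) 1; sg_simp; rewrite !sg_places; ring.
- eq_step (h212 H) 0; sg_simp; rewrite !sg_places; ring.
all: rewrite ?Q_eq; sg_simp; rewrite !sg_places; sg_simp; rewrite ?sg_places; ring.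
Qed.


(** The denominator at [X2], [X3] is met twice, at [z0] and on the way back from [z2], hence its
    square. Squaring the other factor too makes [G] symmetric in [X1] and [X2], so the first
    application of [F1] has divided difference 0. *)
Lemma braid_eq12 A C : A != C -> braid_conclusion A A C.
Proof.
move=> ne; pose b u v : P := den A C u v; pose q u v : P := qnum A C u v.
pose p := pnum n A C.
exists (b X1 X3 * b X1 X3 * (b X2 X3 * b X2 X3)).
exists (q X2 X1 * q X3 X1 * (1 + X2 - X3) * (b X2 X1 * b X3 X1)).
split.
- by do !apply: unit_actM => //; apply: den_unit.
- by do !apply: unit_actM => //;
    first [exact: den_unit|exact: qnum_unit|exact: unit_act_succ].
move=> z0 z1 z2 z12 z21 z121 z212 H D; rewrite (negbTE ne) => ->.
rewrite /b /q /p.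
have [s [sE bs Qs]] := pair_quadratic n ne.
eapply braid_words.
- eq_step (h10 H) 0; places; ring.
- neq_step (h20 H) ne (b X1 X3 * b X1 X3 * b X2 X3); rewrite /b; places; ring.
- neq_step (h21 H) ne ((1 + X1 - X2) * (b X1 X3 * b X1 X3 * b X2 X3));
    rewrite /b; places; ring.
- eq_step (h10 H) (p * b X1 X3 * b X2 X3); rewrite /b /p; places.
  case: sE => [] [_ h]; rewrite ?(pair_diff n h) ?(pair_same n ne h); ring.
- eq_step (h11 H) (p * b X1 X3 * b X2 X3 * (1 + b X1 X3 + b X2 X3));
    rewrite /b /p; places.
  case: sE => [] [_ h]; rewrite ?(pair_diff n h) ?(pair_same n ne h); ring.
- neq_step (h12 H) ne (q X3 X2 * b X1 X2 * b X3 X2);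
    rewrite /b /q; places; ring.
- neq_step (h121 H) ne (q X3 X2 * (1 + X1 - X3) * b X1 X2 * b X3 X2);
    rewrite /b /q; places; ring.
- neq_step (h20 H) ne (b X1 X3 * b X1 X3 * b X2 X3); rewrite /b; places; ring.
- eq_step (h10 H) (p * b X1 X3 * b X2 X3); rewrite /b /p; places.
  case: sE => [] [_ h]; rewrite ?(pair_diff n h) ?(pair_same n ne h); ring.
- neq_step (h12 H) ne (q X3 X2 * b X1 X2 * b X3 X2);
    rewrite /b /q; places; ring.
- neq_step (h20 H) ne (p * b X1 X3 * (1 - b X2 X3));
    rewrite /b /p; places; ring.
- have ne' : C != A by rewrite eq_sym.
  neq_step (h22 H) ne' (- (p * q X3 X2 * b X1 X2 * s)); rewrite /b /q /p; places.
  by rewrite (bs X3 X2); ring.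
- neq_step (h21 H) ne (- ((1 + X1 - X2) * p * b X2 X3 * b X1 X3));
    rewrite /b /q /p; places; ring.
- eq_step (h212 H) 0; rewrite /b /q; places; ring.
- rewrite Q_eq; apply: (eq_modulo (Qs X2 X3) (c := p * b X1 X3 * s)).
  rewrite /b /q /p; places.
  by case: sE => [] [-> h]; places; rewrite ?(pair_diff n h) ?(pair_same n ne h); ring.
all: rewrite /b /q /p; places.
all: by case: sE => [] [sv h]; rewrite ?sv ?(pair_diff n h) ?(pair_same n ne h); ring.
Qed.


(** The mirror image of [braid_eq12]: [G] is now symmetric in [X2] and [X3], and the square that
    contributes is that of tau_i. *)
Lemma braid_eq23 A B : A != B -> braid_conclusion A B B.
Proof.
move=> ne; pose b u v : P := den A B u v; pose q u v : P := qnum A B u v.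
pose p := pnum n A B.
exists (b X1 X2 * b X1 X2 * (b X1 X3 * b X1 X3)).
exists (q X3 X2 * q X3 X1 * (1 + X1 - X2) * (b X3 X1 * b X3 X2)).
split.
- by do !apply: unit_actM => //; apply: den_unit.
- by do !apply: unit_actM => //;
    first [exact: den_unit|exact: qnum_unit|exact: unit_act_succ].
move=> z0 z1 z2 z12 z21 z121 z212 H D; rewrite (negbTE ne) => ->.
have [s [sE bs Qs]] := pair_quadratic n ne.
have ne' : B != A by rewrite eq_sym.
eapply braid_words.
- neq_step (h10 H) ne (b X1 X2 * (b X1 X3 * b X1 X3)); rewrite /b; places; ring.
- eq_step (h20 H) (p * b X1 X2 * b X1 X3); rewrite /b /p; places.
  by case: sE => [] [_ h]; rewrite ?(pair_diff n h) ?(pair_same n ne h); ring.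
- neq_step (h21 H) ne (q X2 X1 * b X2 X1 * b X2 X3);
    rewrite /b /q; places; ring.
- neq_step (h10 H) ne (p * b X1 X3 * (1 - b X1 X2));
    rewrite /b /p; places; ring.
- neq_step (h11 H) ne' (- (p * q X2 X1 * s * b X2 X3));
    rewrite /b /q /p; places.
  by rewrite (bs X2 X1); ring.
- neq_step (h12 H) ne (- ((1 + X2 - X3) * p * b X1 X3 * b X1 X2));
    rewrite /b /q /p; places; ring.
- eq_step (h121 H) 0; rewrite /b /q; places; ring.
- eq_step (h20 H) 0; rewrite /b; places; ring.
- neq_step (h10 H) ne (b X1 X2 * (b X1 X3 * b X1 X3)); rewrite /b; places; ring.
- neq_step (h12 H) ne ((1 + X2 - X3) * b X1 X2 * (b X1 X3 * b X1 X3));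
    rewrite /b; places; ring.
- eq_step (h20 H) (p * b X1 X2 * b X1 X3); rewrite /b /p; places.
  by case: sE => [] [_ h]; rewrite ?(pair_diff n h) ?(pair_same n ne h); ring.
- eq_step (h22 H) (p * b X1 X2 * b X1 X3 * (1 + b X1 X2 + b X1 X3));
    rewrite /b /p; places.
  by case: sE => [] [_ h]; rewrite ?(pair_diff n h) ?(pair_same n ne h); ring.
- neq_step (h21 H) ne (q X2 X1 * b X2 X1 * b X2 X3);
    rewrite /b /q; places; ring.
- neq_step (h212 H) ne (q X2 X1 * (1 + X1 - X3) * b X2 X1 * b X2 X3);
    rewrite /b /q; places; ring.
- rewrite Q_eq; apply: (eq_modulo (Qs X1 X2) (c := - (p * b X1 X3 * s))).
  rewrite /b /q /p; places.
  by case: sE => [] [-> h]; places; rewrite ?(pair_diff n h) ?(pair_same n ne h); ring.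
all: rewrite /b /q /p; places.
all: by case: sE => [] [sv h]; rewrite ?sv; places;
  rewrite ?(pair_diff n h) ?(pair_same n ne h); ring.
Qed.

(** The only coincidence in which [D] can be nonzero. Values of [Q] at different pairs of variables
    occur together, so the product formula of [pair_quadratic] gives way to the explicit formulas of
    [pair_arrows]. *)
Lemma braid_eq13 A B : A != B -> braid_conclusion A B A.
Proof.
move=> ne; pose b u v : P := den A B u v; pose q u v : P := qnum A B u v.
pose b' u v : P := den B A u v; pose q' u v : P := qnum B A u v.
pose p := pnum n A B; have ne' : B != A by rewrite eq_sym.
(* [e] and [e'] are the coefficients of [v] in [qnum A B u v] and [qnum B A u v]: 0 when the
   numerator is the constant 1, and 1 otherwise. They enter the divided differences of products
   containing these numerators. *)
have [s [e [e' cases]]] : exists s e e' : P,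
    (A.2 != B.2 /\ [/\ s = 1, e = 0 & e' = 0]) \/
    (A.2 = B.2 /\ exists b b' : bool,
      [/\ s = -1, e = if b then 0 else 1 & e' = if b' then 0 else 1] /\
      let d (y z : K) (u v : P) := u - v + (vN n y - vN n z) in
   ((forall u v : P, (qnum A B u v = if b then 1 else - d A B u v - 1)%R) *
    (forall u v : P, (qnum B A u v = if b' then 1 else - d B A u v - 1)%R) *
    (forall u v : P, (Q A B u v = (if b then - d A B u v - 1 else 1) *
                                 (if b' then d A B u v - 1 else 1))%R) *
    (forall u v : P, (Q B A u v = (if b' then - d B A u v - 1 else 1) *
                                 (if b then d B A u v - 1 else 1))%R))%type).
  have [h|h] := eqVneq A.2 B.2; last by exists 1, 0, 0; left.
  have [c [c' R]] := pair_arrows n ne h.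
  exists (-1), (if c then 0 else 1), (if c' then 0 else 1); right.
  by split=> //; exists c, c'.
exists (b X1 X2 * b X1 X2 * (b' X2 X3 * b' X2 X3)).
exists (q' X2 X1 * (1 + X1 - X3) * q X3 X2 * (b X3 X2 * b' X2 X1)).
split.
- by do !apply: unit_actM => //; apply: den_unit.
- by do !apply: unit_actM => //;
    first [exact: den_unit|exact: qnum_unit|exact: unit_act_succ].
move=> z0 z1 z2 z12 z21 z121 z212 H D; rewrite eqxx => DE.
have X31 : X3 - X1 != 0.
  rewrite subr_eq0; apply/eqP => /(congr1 (mcoeff U_(hi l))).
  rewrite !mcoeffX eqxx eq_mnm1 eq_sym (negbTE (proj1 hi_succ)) /= => /eqP.
  by rewrite oner_eq0.
eapply braid_words.
- neq_step (h10 H) ne (b X1 X2 * (b' X2 X3 * b' X2 X3));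
    rewrite /b; places; ring.
- neq_step (h20 H) ne' (- (p * b X1 X2 * b' X2 X3)); rewrite /b /b' /p; places.
  case: cases => [[h [Es Ee Ee']]|[h [e0 [e0' [[Es Ee Ee'] R]]]]];
    [by rewrite ?Es ?Ee ?Ee'; places; rewrite ?(pair_diff n h); ring|].
  by rewrite ?Es ?Ee ?Ee' {Ee Ee'}; case: e0 R; case: e0' => R; places;
    rewrite ?(pair_same n ne h) ?R; ring.
- eq_step (h21 H) (- (p * b X2 X1 * b' X1 X3 * (e * b X2 X1 + q X2 X1)));
    rewrite /b /b' /q /p; places.
  case: cases => [[h [Es Ee Ee']]|[h [e0 [e0' [[Es Ee Ee'] R]]]]];
    [by rewrite ?Es ?Ee ?Ee'; places; rewrite ?(pair_diff n h); ring|].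
  by rewrite ?Es ?Ee ?Ee' {Ee Ee'}; case: e0 R; case: e0' => R; places;
    rewrite ?(pair_same n ne h) ?R; ring.
- neq_step (h10 H) ne (p * p * b' X2 X3); rewrite /b /b' /p; places.
  case: cases => [[h [Es Ee Ee']]|[h [e0 [e0' [[Es Ee Ee'] R]]]]];
    [by rewrite ?Es ?Ee ?Ee'; places; rewrite ?(pair_diff n h); ring|].
  by rewrite ?Es ?Ee ?Ee' {Ee Ee'}; case: e0 R; case: e0' => R; places;
    rewrite ?(pair_same n ne h) ?R; ring.
- neq_step (h11 H) ne' (q X3 X1 * b X3 X1 * b' X1 X2
     - p * s * b' X1 X3 * (e * b X2 X1 + q X2 X1)); rewrite /b /b' /q /p; places.
  case: cases => [[h [Es Ee Ee']]|[h [e0 [e0' [[Es Ee Ee'] R]]]]];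
    [by rewrite ?Es ?Ee ?Ee'; places; rewrite ?(pair_diff n h); ring|].
  by rewrite ?Es ?Ee ?Ee' {Ee Ee'}; case: e0 R; case: e0' => R; places;
    rewrite ?(pair_same n ne h) ?R; ring.
- eq_step (h12 H) (- (p * e' * b' X3 X2 * b X1 X3));
    rewrite /b /b' /q /p; places.
  case: cases => [[h [Es Ee Ee']]|[h [e0 [e0' [[Es Ee Ee'] R]]]]];
    [by rewrite ?Es ?Ee ?Ee'; places; rewrite ?(pair_diff n h); ring|].
  by rewrite ?Es ?Ee ?Ee' {Ee Ee'}; case: e0 R; case: e0' => R; places;
    rewrite ?(pair_same n ne h) ?R; ring.
- neq_step (h121 H) ne' ((1 + X2 - X3) * q X3 X1 * b X3 X1 * b' X1 X2);
    rewrite /b /b' /q /p; places; ring.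
- neq_step (h20 H) ne' (b X1 X2 * b X1 X2 * b' X2 X3);
    rewrite /b /b'; places; ring.
- neq_step (h10 H) ne (- (p * b X1 X2 * b' X2 X3)); rewrite /b /b' /p; places.
  case: cases => [[h [Es Ee Ee']]|[h [e0 [e0' [[Es Ee Ee'] R]]]]];
    [by rewrite ?Es ?Ee ?Ee'; places; rewrite ?(pair_diff n h); ring|].
  by rewrite ?Es ?Ee ?Ee' {Ee Ee'}; case: e0 R; case: e0' => R; places;
    rewrite ?(pair_same n ne h) ?R; ring.
- eq_step (h12 H) (- (p * b' X3 X2 * b X1 X3 * (e' * b' X3 X2 + q' X3 X2)));
    rewrite /b /b' /q' /p; places.
  case: cases => [[h [Es Ee Ee']]|[h [e0 [e0' [[Es Ee Ee'] R]]]]];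
    [by rewrite ?Es ?Ee ?Ee'; places; rewrite ?(pair_diff n h); ring|].
  by rewrite ?Es ?Ee ?Ee' {Ee Ee'}; case: e0 R; case: e0' => R; places;
    rewrite ?(pair_same n ne h) ?R; ring.
- neq_step (h20 H) ne' (p * p * b X1 X2); rewrite /b /b' /p; places.
  case: cases => [[h [Es Ee Ee']]|[h [e0 [e0' [[Es Ee Ee'] R]]]]];
    [by rewrite ?Es ?Ee ?Ee'; places; rewrite ?(pair_diff n h); ring|].
  by rewrite ?Es ?Ee ?Ee' {Ee Ee'}; case: e0 R; case: e0' => R; places;
    rewrite ?(pair_same n ne h) ?R; ring.
- neq_step (h22 H) ne (q' X3 X1 * b X2 X3 * b' X3 X1
     - p * s * b X1 X3 * (e' * b' X3 X2 + q' X3 X2)); rewrite /b /b' /q' /p; places.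
  case: cases => [[h [Es Ee Ee']]|[h [e0 [e0' [[Es Ee Ee'] R]]]]];
    [by rewrite ?Es ?Ee ?Ee'; places; rewrite ?(pair_diff n h); ring|].
  by rewrite ?Es ?Ee ?Ee' {Ee Ee'}; case: e0 R; case: e0' => R; places;
    rewrite ?(pair_same n ne h) ?R; ring.
- eq_step (h21 H) (- (p * e * b X2 X1 * b' X1 X3));
    rewrite /b /b' /q /p; places.
  case: cases => [[h [Es Ee Ee']]|[h [e0 [e0' [[Es Ee Ee'] R]]]]];
    [by rewrite ?Es ?Ee ?Ee'; places; rewrite ?(pair_diff n h); ring|].
  by rewrite ?Es ?Ee ?Ee' {Ee Ee'}; case: e0 R; case: e0' => R; places;
    rewrite ?(pair_same n ne h) ?R; ring.
- neq_step (h212 H) ne ((1 + X1 - X2) * q' X3 X1 * b X2 X3 * b' X3 X1);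
    rewrite /b /b' /q' /p; places; ring.
(* [D] is known only through its product with [X3 - X1], so the identity for [z0] is multiplied by
   this nonzero factor. *)
- apply: (mulfI X31); rewrite [in RHS]mulrCA DE.
  rewrite /b /b' /q /q' /p; places.
  case: cases => [[h [Es Ee Ee']]|[h [e0 [e0' [[Es Ee Ee'] R]]]]];
    [by rewrite ?Es ?Ee ?Ee'; places; rewrite ?(pair_diff n h); ring|].
  by rewrite ?Es ?Ee ?Ee' {Ee Ee'}; case: e0 R; case: e0' => R; places;
    rewrite ?(pair_same n ne h) ?R; ring.
all: rewrite /b /b' /q /q' /p; places.
all: by case: cases => [[h [Es Ee Ee']]|[h [e0 [e0' [[Es Ee Ee'] R]]]]];
    [rewrite ?Es ?Ee ?Ee'; places; rewrite ?(pair_diff n h); ring|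
     rewrite ?Es ?Ee ?Ee' {Ee Ee'}; case: e0 R; case: e0' => R; places;
    rewrite ?(pair_same n ne h) ?R; ring].
Qed.

(** A word can exchange [A] with [B], or [B] with [C], there and back, so these denominators are
    squared in [G]; [A] and [C] are exchanged at most once. *)
Lemma braid_distinct A B C : A != B -> A != C -> B != C ->
  braid_conclusion A B C.
Proof.
move=> nAB nAC nBC; pose b (y z : K) u v : P := den y z u v.
pose q (y z : K) u v : P := qnum y z u v; pose p (y z : K) := pnum n y z.
have nBA : B != A by rewrite eq_sym.
have nCB : C != B by rewrite eq_sym.
have [s [sE bs Qs]] := pair_quadratic n nAB.
have [t [tE bt Qt]] := pair_quadratic n nBC.
exists (b A B X1 X2 * b A B X1 X2 * (b A C X1 X3) * (b B C X2 X3 * b B C X2 X3)).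
exists (q B C X2 X1 * q A C X3 X1 * q A B X3 X2 * b B C X2 X1 * b A B X3 X2).
split.
- by do !apply: unit_actM => //; apply: den_unit.
- by do !apply: unit_actM => //; first [exact: den_unit|exact: qnum_unit].
move=> z0 z1 z2 z12 z21 z121 z212 H D; rewrite (negbTE nAC) => ->.
eapply braid_words.
- neq_step (h10 H) nAB (b A C X1 X3 * b B C X2 X3 * b A B X1 X2 * b B C X2 X3);
    rewrite /b; places; ring.
- neq_step (h20 H) nBC (- (p A B * b A C X1 X3 * b A B X1 X2 * b B C X2 X3));
    rewrite /b /p; places; ring.
- neq_step (h21 H) nAC (q A B X2 X1 * b B C X1 X3 * b A B X2 X1 * b B C X1 X3);
    rewrite /b /q; places; ring.
- neq_step (h10 H) nAB (p B C * p A B * b A C X1 X3 * b B C X2 X3);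
    rewrite /b /p; places; ring.
- neq_step (h11 H) nBA (- (p A C * q A B X2 X1 * b B C X1 X3 * b B C X1 X3 * s));
    rewrite /b /p /q; places.
  by rewrite (bs X2 X1); ring.
- neq_step (h12 H) nAC (- (q B C X3 X2 * p A B * b A B X1 X3 * b B C X3 X2));
    rewrite /b /p /q; places; ring.
- neq_step (h121 H) nBC (q A C X3 X2 * q A B X3 X1 * b B C X1 X2 * b A B X3 X1);
    rewrite /b /p /q; places; ring.
- neq_step (h20 H) nBC (b A B X1 X2 * b A C X1 X3 * b A B X1 X2 * b B C X2 X3);
    rewrite /b /p /q; places; ring.
- neq_step (h10 H) nAB (- (p B C * b A C X1 X3 * b A B X1 X2 * b B C X2 X3));
    rewrite /b /p /q; places; ring.
- neq_step (h12 H) nAC (q B C X3 X2 * b A B X1 X3 * b A B X1 X3 * b B C X3 X2);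
    rewrite /b /p /q; places; ring.
- neq_step (h20 H) nBC (p A B * p B C * b A C X1 X3 * b A B X1 X2);
    rewrite /b /p /q; places; ring.
- neq_step (h22 H) nCB (- (p A C * q B C X3 X2 * b A B X1 X3 * b A B X1 X3 * t));
    rewrite /b /p /q; places.
  by rewrite (bt X3 X2); ring.
- neq_step (h21 H) nAC (- (q A B X2 X1 * p B C * b A B X2 X1 * b B C X1 X3));
    rewrite /b /p /q; places; ring.
- neq_step (h212 H) nAB (q A C X2 X1 * q B C X3 X1 * b A B X2 X3 * b B C X3 X1);
    rewrite /b /p /q; places; ring.
(* The coefficients of [z0] contain one [Q] from each of the words 1·1 and 2·2; both are eliminated
   by the quadratic identities. *)
- apply: (eq_modulo (Qs X1 X2) (c := - (p A C * s * (b B C X2 X3 * b B C X2 X3)))).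
  apply: (eq_modulo (Qt X2 X3) (c := p A C * t * (b A B X1 X2 * b A B X1 X2))).
  rewrite /b /q /p; places.
  case: sE => [] [-> h]; case: tE => [] [-> h']; places;
    rewrite ?(pair_diff n h) ?(pair_same n nAB h) ?(pair_diff n h') ?(pair_same n nBC h').
  + have h2 : A.2 = C.2 by rewrite h.
    by rewrite ?(pair_same n nAC h2); ring.
  + have h2 : A.2 != C.2 by rewrite h.
    by rewrite ?(pair_diff n h2); ring.
  + have h2 : A.2 != C.2 by rewrite -h'.
    by rewrite ?(pair_diff n h2); ring.
  + by case: (eqVneq A.2 C.2) => h2; rewrite ?(pair_diff n h2) ?(pair_same n nAC h2); ring.
all: rewrite /b /q /p; places; try ring.
all: case: sE => [] [sv h]; case: tE => [] [tv h']; rewrite ?sv ?tv; 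
    rewrite ?(pair_diff n h) ?(pair_same n nAB h) ?(pair_diff n h') ?(pair_same n nBC h').
all: by case: (eqVneq A.2 C.2) => h2;
  rewrite ?(pair_diff n h2) ?(pair_same n nAC h2);
  first [ring | by move: h2; rewrite h h' eqxx | by move: h'; rewrite -h h2 eqxx
        | by move: h; rewrite h2 h' eqxx].
Qed.

Lemma braid_cases A B C : braid_conclusion A B C.
Proof.
have [<-|nAB] := eqVneq A B.
  by have [<-|nAC] := eqVneq A C; [exact: braid_all_eq|exact: braid_eq12].
have [<-|nBC] := eqVneq B C; first exact: braid_eq23.
by have [<-|nAC] := eqVneq A C; [exact: braid_eq13|exact: braid_distinct].
Qed.

End BraidWords.

(** * Equivalence of the two sets of relations *)

Section Transfer.
Variables (k : fieldType) (I : set k) (r n : nat) (V : lmodType k).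
Local Notation P := {mpoly k[n]}.
Local Notation wt := (weight I r n).
Variables (W : wt -> set V) (x : 'I_n -> V -> V) (tau f : 'I_n.-1 -> V -> V).
Hypothesis itw : intertwining W x tau f.
Hypothesis Wds : direct_sum W.

Let Wsub := itw_sub itw.
Let xL := nil_lin (itw_nil itw).
Let xC := nil_comm (itw_nil itw).
Let xN := nil_nil (itw_nil itw).
Let xW := itw_xW itw.
Let tauL := itw_tauL itw.
Let fL := itw_fL itw.
Let tauW := itw_tauW itw.

Local Notation "p \@ v" := (pact x p v) (at level 42, right associativity).
Local Notation QQ i al := (Q (al (lo i)) (al (hi i)) : P -> P -> P).

Definition divided_difference (i l : 'I_n.-1) (al : wt) (D : P) : Prop :=
  if al (lo i) == al (hi l) then
    ('X_(hi l) - 'X_(lo i)) * D =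
      QQ i al 'X_(hi l) 'X_(hi i) - QQ i al 'X_(lo i) 'X_(hi i)
  else D = 0.

Lemma divided_difference_ex i l al : exists D, divided_difference i l al D.
Proof.
rewrite /divided_difference; case: (_ == _); last by exists 0.
rewrite /Q; case: (_ == _); first by exists 0; rewrite subrr mulr0.
case: (arrow _ _); case: (arrow _ _).
- exists (2%:R * 'X_(hi i) - 'X_(hi l) - 'X_(lo i)); ring.
- exists (-1); ring.
- exists 1; ring.
- by exists 0; rewrite subrr mulr0.
Qed.

Definition tau_quadratic := forall i al v, W al v ->
  tau i (tau i v) = QQ i al 'X_(lo i) 'X_(hi i) \@ v.

Definition tau_far := forall i l al v, far i l -> W al v ->
  tau i (tau l v) = tau l (tau i v).

Definition tau_braid := forall (i l : 'I_n.-1) al v D,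
  l = i.+1 :> nat -> W al v -> divided_difference i l al D ->
  tau l (tau i (tau l v)) - tau i (tau l (tau i v)) = D \@ v.

Definition f_involutive := forall i v, f i (f i v) = v.

Definition f_commute := forall i l v, far i l -> f i (f l v) = f l (f i v).

Definition f_braid := forall (i l : 'I_n.-1) v, l = i.+1 :> nat ->
  f i (f l (f i v)) = f l (f i (f l v)).

Lemma unit_surj al p v : unit_act x p -> W al v -> exists2 w, W al w & v = p \@ w.
Proof. by move=> [_ sp] Wv; apply: sp => // a w; apply: xW. Qed.

Lemma comp_linear (g h : V -> V) : linear g -> linear h -> linear (g \o h).
Proof. by move=> gL hL a u v /=; rewrite hL gL. Qed.

(** Every vector of a weight space is [G] applied to a vector of the same weight space, so this
    direction uses surjectivity of [G]; the converse uses injectivity of [E]. *)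
Lemma quadratic_f : tau_quadratic -> f_involutive.
Proof.
move=> tq i; apply: (@ds_eq _ _ _ _ Wds V (f i \o f i) id) => [||al v Wv] //.
  exact: comp_linear.
have [G [E [uG _ H]]] := f_quadratic itw i al.
have [z Wz ->] := unit_surj uG Wv; have := H z Wz.
rewrite (tq _ _ _ Wz) subrr (rlin0 (pact_linear xL E)) => /eqP.
by rewrite subr_eq0 => /eqP.
Qed.

Lemma f_quadratic_tau : f_involutive -> tau_quadratic.
Proof.
move=> fq i al v Wv; have [G [E [_ [iE _] H]]] := f_quadratic itw i al.
have := H v Wv; rewrite fq subrr => /esym/iE/eqP.
by rewrite subr_eq0 => /eqP.
Qed.

Lemma far_f : tau_far -> f_commute.
Proof.
move=> tf i l v fil; move: v.
apply: (@ds_eq _ _ _ _ Wds V (f i \o f l) (f l \o f i)) => [||al v Wv] /=;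
  try exact: comp_linear.
have [G [E [uG _ H]]] := f_far itw al fil.
have [z Wz ->] := unit_surj uG Wv; have := H z Wz.
rewrite (tf _ _ _ _ fil (pactW itw _ Wz)).
by rewrite subrr => /eqP; rewrite subr_eq0 => /eqP.
Qed.

Lemma f_far_tau : f_commute -> tau_far.
Proof.
move=> ff i l al v fil Wv; have [G [E [_ uE H]]] := f_far itw al fil.
have [z Wz ->] := unit_surj uE Wv; have := H z Wz.
by rewrite ff // subrr => /esym/eqP; rewrite subr_eq0 => /eqP.
Qed.

Lemma f_stepP i al v : W al v -> f_step x (f i) (sg i) 'X_(lo i) 'X_(hi i)
  (al (lo i)) (al (hi i)) v (tau i v).
Proof.
move=> Wv; split=> [e g D gD|ne a g aE]; first exact: (f_eq itw Wv e gD).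
by rewrite (f_neq itw Wv ne aE) pactN.
Qed.

(** Feeds the actual tau-words into [braid_cases]; [tq] supplies the two steps in which a tau is
    applied twice in a row. *)
Lemma f_braid_tau_braid (i l : 'I_n.-1) al : tau_quadratic -> l = i.+1 :> nat ->
  exists G E : P, [/\ unit_act x G, unit_act x E & forall v D, W al v ->
    divided_difference i l al D ->
    f i (f l (f i (G \@ v))) - f l (f i (f l (G \@ v))) =
    E \@ (tau i (tau l (tau i v)) - tau l (tau i (tau l v)) + D \@ v)].
Proof.
move=> tq il; have [h1 h2] := hi_succ il; have [h3 h4] := lo_nsucc il.
have lhi := lo_succ il.
have [G [E [uG uE H]]] := braid_cases (itw_nil itw) il (fL i) (fL l)
  (al (lo i)) (al (hi i)) (al (hi l)).
exists G, E; split=> // v D Wv DD.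
apply: (H v (tau i v) (tau l v) (tau i (tau l v)) (tau l (tau i v))) => //.
have Wi := tauW i Wv; have Wl := tauW l Wv.
have Wil := tauW i Wl; have Wli := tauW l Wi.
have sl1 be : swt l be (lo i) = be (lo i) by rewrite swt_D.
have sl2 be : swt l be (hi i) = be (hi l) by rewrite -lhi swt_lo.
have sl3 be : swt l be (hi l) = be (hi i) by rewrite swt_hi lhi.
have si3 be : swt i be (hi l) = be (hi l) by rewrite swt_D.
split.
- exact: f_stepP.
- by rewrite -(tq _ _ _ Wv); have := f_stepP i Wi; rewrite swt_lo swt_hi.
- by have := f_stepP i Wl; rewrite sl1 sl2.
- by have := f_stepP i Wli; rewrite sl1 sl2 swt_lo si3.
- by have := f_stepP l Wv; rewrite lhi.
- by have := f_stepP l Wi; rewrite lhi swt_hi si3.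
- by have := f_stepP l Wl; rewrite (tq _ _ _ Wv) lhi sl2 sl3.
- by have := f_stepP l Wil; rewrite lhi swt_hi si3 sl1 sl3.
Qed.

Lemma braid_f : tau_quadratic -> tau_braid -> f_braid.
Proof.
move=> tq tb i l v il; move: v.
apply: (@ds_eq _ _ _ _ Wds V (f i \o (f l \o f i)) (f l \o (f i \o f l)))
  => [||al v Wv] /=.
- exact: (comp_linear (fL i) (comp_linear (fL l) (fL i))).
- exact: (comp_linear (fL l) (comp_linear (fL i) (fL l))).
have [G [E [uG _ H]]] := f_braid_tau_braid al tq il.
have [z Wz ->] := unit_surj uG Wv; have [D DD] := divided_difference_ex i l al.
have := H z D Wz DD; rewrite -(tb _ _ _ _ _ il Wz DD).
have cancel (a b : V) : a - b + (b - a) = 0 by rewrite -opprB addNr.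
rewrite cancel (rlin0 (pact_linear xL E)) => /eqP.
by rewrite subr_eq0 => /eqP.
Qed.

Lemma f_braid_tau : tau_quadratic -> f_braid -> tau_braid.
Proof.
move=> tq fb i l al v D il Wv DD.
have [G [E [_ [iE _] H]]] := f_braid_tau_braid al tq il.
have := H v D Wv DD; rewrite fb // subrr => /esym/iE/eqP.
by rewrite addr_eq0 => /eqP e; rewrite -opprB e opprK.
Qed.

End Transfer.

(** * The power series of the statement as fractions of polynomials *)

Section Operators.
Variables (k : fieldType) (I : set k) (r n : nat) (V : lmodType k).
Local Notation P := {mpoly k[n]}.
Local Notation wt := (weight I r n).

Lemma inv_onE (S : set V) (T : V -> V) w : S w ->
  (forall w', S w' -> T w' = T w -> w' = w) -> inv_on S T (T w) = w.
Proof.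
move=> Sw inj; rewrite /inv_on; case: xgetP => [w' _ /= [Sw' Tw']|none].
  exact: inj.
by case: (none w).
Qed.

Lemma nu_swt i (al : wt) a : nu (swt i al) (sperm i a) = nu al a.
Proof. by rewrite /nu swtE tpermK. Qed.

Lemma jj_swt i (al : wt) a : jj (swt i al) (sperm i a) = jj al a.
Proof. by rewrite /jj swtE tpermK. Qed.

Definition place_sign (i : 'I_n.-1) (a : 'I_n) : k :=
  if a == lo i then -1 else if a == hi i then 1 else 0.

Variable x : 'I_n -> V -> V.
Hypothesis xact : nil_action x.
Let xL := nil_lin xact.
Let xC := nil_comm xact.
Let xN := nil_nil xact.
Local Notation "p \@ v" := (pact x p v) (at level 42, right associativity).

Section QP.
Variables (S : set V) (X : 'I_n -> V -> V) (i : 'I_n.-1) (al : wt).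
Hypothesis XE : forall a u, S u -> X a u = x a u.

Lemma inv_on_pact (p : P) (T : V -> V) w : unit_act x p ->
  (forall u, S u -> T u = p \@ u) -> S w -> inv_on S T (p \@ w) = w.
Proof.
move=> up TE Sw; rewrite -TE // inv_onE // => w' Sw'; rewrite !TE //.
exact: unit_act_inj.
Qed.

(** Applied to a multiple of the denominator, the choice in [inv_on] is forced by injectivity.
    Together with [pop_den] this translates the stated formulas into the polynomial equation of
    [intertwining]. *)
Lemma qop_den w : S w -> qop S X i al (den_at i al \@ w) = qnum_at i al \@ w.
Proof.
move=> Sw; have ud : unit_act x (den_at i al) by apply: den_unit.
move: ud; rewrite /qop /jj /nu /qnum_at /qnum.
case ej : ((al (lo i)).2 == (al (hi i)).2); last first.
  by rewrite /den_at den_j ?ej // !pact1.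
case: ifP => ev.
  rewrite /den_at /den ej ev pact1 // => _.
  by rewrite !XE // !pactD // pactN // !pactX // pact1.
case: ifP => ea ud.
  rewrite inv_on_pact ?pact1 // => u Su; rewrite /den_at /den ej ev /dpoly (eqP ea).
  rewrite pactD // pactB // !pactX // pactC // !XE //.
  by rewrite opprD addrA subrr add0r scaleN1r.
rewrite inv_on_pact //.
  by rewrite !XE // pactD // pactB // !pactX // pactC.
move=> u Su; rewrite /denominator /den_at /den ej ev /dpoly !XE //.
by rewrite pactD // pactB // !pactX // pactC.
Qed.

Lemma pop_den w : S w -> pop S X i al (den_at i al \@ w) = pnum_at i al \@ w.
Proof.
move=> Sw; have ud : unit_act x (den_at i al) by apply: den_unit.
move: ud; rewrite /pop /jj /nu /pnum_at /pnum.
case ej : ((al (lo i)).2 == (al (hi i)).2); last by rewrite pact0.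
case: ifP => ev ud; first by rewrite /den_at /den ej ev !pact1.
rewrite inv_on_pact ?pact1 // => u Su; rewrite /denominator /den_at /den ej ev.
by rewrite /dpoly !XE // pactD // pactB // !pactX // pactC.
Qed.

End QP.

Lemma teval_big (G T : Type) (rho : G -> V -> V) (s : seq T) (F : T -> term k G) v :
  teval rho (\big[Add/Zero]_(t <- s) F t) v = \sum_(t <- s) teval rho (F t) v.
Proof.
elim: s => [|t s IH]; first by rewrite !big_nil.
by rewrite !big_cons /= IH.
Qed.

Lemma teval_poly1 (W : wt -> set V) (rho : Hgen I r n -> V -> V) (p : P) (al : wt) v :
  (forall a u, W al u -> W al (x a u)) -> (forall u, W al (rho (H1gen al) u)) ->
  (forall a u, W al u -> rho (Hxgen a al) u = x a u) ->
  teval rho (poly1 p al) v = p \@ rho (H1gen al) v.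
Proof.
move=> xW eW xE; rewrite teval_big; apply: eq_bigr => m _ /=; congr (_ *: _).
rewrite /monomial1 /xmon.
suff : teval rho (foldr (fun a u => iter (m a) (Mul (x1 a al)) u) (e1 al) (enum 'I_n)) v
   = foldr (fun a u => iter (m a) (x a) u) (rho (H1gen al) v) (enum 'I_n) /\
   W al (foldr (fun a u => iter (m a) (x a) u) (rho (H1gen al) v) (enum 'I_n)).
  by case.
elim: (enum 'I_n) => //= a s [IH IW].
elim: (m a) => [//|d [IHd IWd]] /=; rewrite IHd xE //; split=> //; exact: xW.
Qed.

(** The left side collects the correction of [tau x] and the commutator of [y] with the [p] term,
    the right side is the action of [e_i] on a vector multiplied by the denominator. This makes the
    two commutation relations equivalent. *)
Lemma den_relation i (al : wt) :
  (if al (lo i) == al (hi i) then qnum_at i al else 0)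
    + pnum_at i al * dpoly (al (lo i)) (al (hi i)) 'X_(lo i) 'X_(hi i) =
  (if jj al (lo i) == jj al (hi i) then den_at i al else 0).
Proof.
rewrite vertex_eqE /jj /qnum_at /pnum_at /den_at /qnum /pnum /den /dpoly.
case: (_.2 == _) => /=; last by rewrite mul0r addr0.
case: eqP => [->|_]; last by rewrite add0r mul1r.
by rewrite subrr mpolyC0; ring.
Qed.

Lemma pact_x (p : P) a v : x a (p \@ v) = p \@ x a v.
Proof. by rewrite -!(@pactX _ _ _ x) pact_comm. Qed.

Lemma pnum_place i (al : wt) a w :
  (x a (pnum_at i al \@ w) + nu al a *: (pnum_at i al \@ w)) -
  (x (sperm i a) (pnum_at i al \@ w)
    + nu al (sperm i a) *: (pnum_at i al \@ w)) =
  - (place_sign i a *: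
     (pnum_at i al * dpoly (al (lo i)) (al (hi i)) 'X_(lo i) 'X_(hi i))) \@ w.
Proof.
rewrite -!(@pactX _ _ _ x) -!(@pactC _ _ _ x) -!pactM // -!pactD // -pactB //.
congr (_ \@ _); rewrite /place_sign /dpoly -!/(nu _ _).
have [->|al_] := eqVneq a (lo i).
  by rewrite sperm_lo mpolyCB scaleN1r; ring.
have [->|ah] := eqVneq a (hi i).
  by rewrite sperm_hi mpolyCB scale1r; ring.
by rewrite sperm_D // subrr scale0r oppr0.
Qed.

End Operators.

(** * The element [e_i] acts by 0 or 1 on weight vectors *)

Section Idempotent.
Variables (k : fieldType) (r n : nat) (zeta : k).
Hypothesis zetaP : r.-primitive_root zeta.
Variables (V : lmodType k) (rho : Ygen n -> V -> V).
Hypothesis rhoL : forall g, linear (rho g).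
Hypothesis rho1 : forall v, rho (Y1gen n) v = v.

Lemma teval_tpow a s (c : k) v : rho (Ytgen a) v = c *: v ->
  teval rho (tpow k a s) v = c ^+ s *: v.
Proof.
move=> tv; elim: s => [|s IH] /=; first by rewrite rho1 scale1r.
by rewrite IH (rlinZ (rhoL _)) tv scalerA exprSr.
Qed.

Lemma teval_eY i (p q : 'I_r) v :
  rho (Ytgen (lo i)) v = zeta ^+ p *: v -> rho (Ytgen (hi i)) v = zeta ^+ q *: v ->
  teval rho (eY k r i) v = if p == q then v else 0.
Proof.
move=> tp tq; rewrite /eY /= teval_big.
have z0 : zeta != 0 by rewrite (prim_root_eq0 zetaP) -lt0n (prim_order_gt0 zetaP).
pose w := zeta ^+ p / zeta ^+ q.
have qr c : (zeta ^+ c) ^+ r = 1 by rewrite exprAC (prim_expr_order zetaP) expr1n.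
have E s : (s < r)%N -> teval rho (Mul (tpow k (lo i) s) (tpow k (hi i) (r - s))) v
    = w ^+ s *: v.
  move=> sr /=; rewrite (teval_tpow _ tq) (rlinZ (teval_linear rhoL _)).
  rewrite (teval_tpow _ tp) scalerA; congr (_ *: _).
  rewrite /w expr_div_n mulrC; congr (_ * _).
  apply: (mulfI (expf_neq0 s (expf_neq0 q z0))).
  by rewrite -exprD subnKC ?(ltnW sr) // qr mulfV // !expf_neq0.
rewrite big_nat (eq_bigr (fun s => w ^+ s *: v)); last by move=> s /andP[_ /E].
rewrite -big_nat -scaler_suml big_mkord.
have r0 : r%:R != 0 :> k by apply: prim_root_natf_neq0 zetaP.
case: eqP => [pq|pq].
  rewrite /w pq mulfV ?expf_neq0 //.
  rewrite (eq_bigr (fun=> 1)) => [|s _]; last by rewrite expr1n.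
  by rewrite sumr_const card_ord scalerA mulVf // scale1r.
suff -> : \sum_(s < r) w ^+ s = 0 by rewrite scale0r scaler0.
have w1 : w - 1 != 0.
  rewrite subr_eq0; apply/eqP => w1; apply: pq; apply/val_inj.
  have : zeta ^+ p = zeta ^+ q.
    by rewrite -[RHS]mul1r -w1 /w divfK // expf_neq0.
  by move/eqP; rewrite (eq_prim_root_expr zetaP) !modn_small // => /eqP.
(* Geometric sum: [w] is an r-th root of unity different from 1. *)
apply: (mulfI w1); rewrite mulr0 -subrX1 /w expr_div_n !qr divr1.
by rewrite subrr.
Qed.

End Idempotent.

(** * Spaces carrying both module structures *)

Section Realizations.
Variables (k : fieldType) (I : set k) (r n : nat) (zeta : k).
Local Notation P := {mpoly k[n]}.
Local Notation wt := (weight I r n).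

(* Each of actH and actY determines the other, see hom_YH_of_HY and           *)
(* hom_HY_of_YH below for g = id.                                             *)
Record realization (V : lmodType k) (actH : Halg I r n -> V -> V)
    (actY : Yalg k r n -> V -> V) (W : wt -> set V) (x : 'I_n -> V -> V)
    (tau f : 'I_n.-1 -> V -> V) : Prop := Realization {
  rl_H : is_module (@Hmul k I r n) actH;
  rl_Y : is_module (@Ymul k r n) actY;
  rl_itw : intertwining W x tau f;
  rl_ds : direct_sum W;
  rl_H1 : forall al v, actH (H1 al) v = projection W al v;
  rl_Hx : forall a al v, actH (Hx a al) v = x a (projection W al v);
  rl_Ht : forall i al v, actH (Ht i al) v = tau i (projection W al v);
  rl_Y1 : forall v, actY (Y1 k r n) v = v;
  rl_Yt : forall al a v, W al v -> actY (Yt k r a) v = zeta ^+ jj al a *: v;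
  rl_Yy : forall al a v, W al v -> actY (Yy k r a) v = x a v + nu al a *: v;
  rl_Yf : forall i v, actY (Yf k r i) v = f i v }.

Hypothesis zetaP : r.-primitive_root zeta.

Section Realization.
Variables (V : lmodType k) (actH : Halg I r n -> V -> V).
Variables (actY : Yalg k r n -> V -> V) (W : wt -> set V) (x : 'I_n -> V -> V).
Variables tau f : 'I_n.-1 -> V -> V.
Hypothesis R : realization actH actY W x tau f.

Let itw := rl_itw R.
Let Wds := rl_ds R.
Let Wsub := itw_sub itw.
Let xact := itw_nil itw.
Let xL := nil_lin xact.
Let xC := nil_comm xact.
Let xN := nil_nil xact.
Let xW := itw_xW itw.
Local Notation "p \@ v" := (pact x p v) (at level 42, right associativity).

Lemma actY_linear b : linear (actY b). Proof. exact: (mod_linear (rl_Y R)). Qed.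
Lemma HweightE al : Hweight actH al = W al.
Proof.
apply/seteqP; split=> [_ [v _ <-]|v Wv]; first by rewrite (rl_H1 R); apply: proj_in.
by exists v => //; rewrite (rl_H1 R) proj_id.
Qed.

Lemma actY_W al a v : W al v ->
  W al (actY (Yt k r a) v) /\ W al (actY (Yy k r a) v).
Proof.
move=> Wv; rewrite (rl_Yt R _ Wv) (rl_Yy R _ Wv); split; first exact: subspaceZ.
by apply: subspaceD => //; [apply: xW|apply: subspaceZ].
Qed.

Lemma Yweight_iter al a v d : W al v ->
  iter d (fun w => actY (Yy k r a) w - nu al a *: w) v = iter d (x a) v.
Proof.
move=> Wv; suff [] : iter d (fun w => actY (Yy k r a) w - nu al a *: w) v
    = iter d (x a) v /\ W al (iter d (x a) v) by [].
elim: d => [//|d [IH IW]] /=; rewrite IH (rl_Yy R _ IW) addrK.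
by split=> //; apply: xW.
Qed.

(** A component of [v] in another [W be] vanishes. Either some [t_a] has two different eigenvalues
    on it, as [zeta] is primitive, or some power of [x_a] plus a nonzero scalar kills it while that
    operator is injective. *)
Lemma YweightE al : Yweight zeta actY al = W al.
Proof.
apply/seteqP; split=> [v Yv|v Wv]; last first.
  move=> a; rewrite (rl_Yt R _ Wv); split=> //; have [d dv] := xN a v.
  by exists d; rewrite Yweight_iter.
suff E be : be != al -> projection W be v = 0.
  rewrite (proj_sum_super Wds (s := [:: al]) (v := v)) // => [|be].
    by rewrite big_seq1; apply: proj_in.
  by rewrite inE; apply: E.
move=> ne; set u := projection W be v.
have Wu : W be u by apply: proj_in.
have tu a : actY (Yt k r a) u = zeta ^+ jj al a *: u.
  rewrite /u -(proj_comm be v Wds Wds (actY_linear _)).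
    by have [_ ->] := Yv a; rewrite (rlinZ (proj_linear Wsub Wds _)).
  by move=> ga w /(@actY_W _ a)[].
have yu a : exists d, iter d (fun w => x a w + (nu be a - nu al a) *: w) u = 0.
  have [[d dv] _] := Yv a; exists d.
  pose g w := actY (Yy k r a) w - nu al a *: w.
  have gL : linear g.
    move=> c w w'; rewrite /g actY_linear scalerBr !scalerDr opprD addrACA.
    by rewrite !scalerA [_ * c]mulrC.
  have gW ga w : W ga w -> W ga (iter d g w).
    move=> Ww; elim: d {dv} => //= d IH; apply: subspaceB => //.
      by case: (actY_W a IH).
    exact: (subspaceZ _ (Wsub ga)).
  have := proj_comm be v Wds Wds (iter_linear d gL) gW.
  rewrite dv (rlin0 (proj_linear Wsub Wds _)) -/u => /esym gu.
  suff [-> _] : iter d (fun w => x a w + (nu be a - nu al a) *: w) u = iter d g u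
    /\ W be (iter d g u) by [].
  elim: d {dv gW gu} => [//|d [IH IW]] /=; rewrite IH {1 3}/g (rl_Yy R _ IW).
  rewrite scalerBl addrA; split=> //.
  apply: (subspaceB (Wsub be)); last exact: (subspaceZ _ (Wsub be)).
  by case: (actY_W a IW).
have : [exists a, be a != al a].
  apply: contraNT ne; rewrite negb_exists => /forallP e.
  by apply/eqP/ffunP => a; apply/eqP; have := e a; rewrite negbK.
case/existsP => a; rewrite vertex_eqE negb_and => /orP[nj|nn].
  have /eqP := tu a; rewrite (rl_Yt R _ Wu) -subr_eq0 -scalerBl scaler_eq0.
  case/orP => [|/eqP //]; rewrite subr_eq0 (eq_prim_root_expr zetaP).
  by rewrite !modn_small // => /eqP e; rewrite -val_eqE /= e eqxx in nj.
have [d] := yu a; set c := _ - _; have c0 : c != 0 by rewrite subr_eq0.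
have hL : linear (fun w => x a w + c *: w).
  by move=> e w w'; rewrite xL !scalerDr addrACA !scalerA mulrC.
elim: d => //= d IH; set w := iter d _ u => e.
apply: IH; rewrite -/w; have [m xm] := xN a w.
apply: (nil_eigen (xL a) _ xm (c := - c)); first by rewrite oppr_eq0.
by move/eqP: e; rewrite addr_eq0 scaleNr => /eqP.
Qed.

Lemma tau_on i al v w : W al w -> v = qnum_at i al \@ w ->
  tau i v = f i (den_at i al \@ w) + pnum_at i al \@ w.
Proof. by move=> Ww ->; rewrite (itw_f itw) // subrK. Qed.

Lemma den_at_surj i al v : W al v -> exists2 w, W al w & v = den_at i al \@ w.
Proof. by move=> Wv; apply: (unit_surj itw _ Wv); apply: den_unit. Qed.

Lemma qnum_at_surj i al v : W al v -> exists2 w, W al w & v = qnum_at i al \@ w.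
Proof. by move=> Wv; apply: (unit_surj itw _ Wv); apply: qnum_unit. Qed.

Lemma Phi_formulas_on al v : W al v ->
  let X a := actH (Hx a al) in
  [/\ forall a, actY (Yt k r a) v = zeta ^+ jj al a *: v,
      forall a, actY (Yy k r a) v = X a v + nu al a *: v &
      forall i, actY (Yf k r i) v =
        actH (Ht i al) (qop (W al) X i al v) - pop (W al) X i al v].
Proof.
move=> Wv X; have XE a u : W al u -> X a u = x a u.
  by move=> Wu; rewrite /X (rl_Hx R) proj_id.
split=> [a|a|i]; first exact: (rl_Yt R).
  by rewrite (rl_Yy R _ Wv) XE.
have [w Ww ->] := den_at_surj i Wv.
rewrite (qop_den xact i al XE Ww) (pop_den xact i al XE Ww).
have Wq := pactW itw (qnum_at i al) Ww.
by rewrite (rl_Ht R) (proj_id Wsub Wds Wq) (rl_Yf R) (itw_f itw).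
Qed.

(** On a vector of weight [al] all projections other than that onto [W al] vanish, so at most one
    term of the two sums over weights survives. *)
Lemma phi_on i al v : W al v ->
  phi I zeta actY i v = actY (Yf k r i) v + pop' zeta actY i al v.
Proof.
move=> Wv; have YE : (fun be : wt => Yweight zeta actY be) = W.
  by apply/funext => be; rewrite YweightE.
have pE be : eproj zeta actY be v = if be == al then v else 0.
  by rewrite /eproj YE; apply: proj_on.
have dE be u : W be u -> actY (Yy k r (lo i)) u - actY (Yy k r (hi i)) u =
    dpoly (be (lo i)) (be (hi i)) 'X_(lo i) 'X_(hi i) \@ u.
  move=> Wu; rewrite !(rl_Yy R _ Wu) /dpoly pactD // pactB // !pactX // pactC //.
  by rewrite opprD addrACA -scalerBl.
(* [inv_on] is a choice of preimage, so its value at 0 is 0 only because the operator is injective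
   on this weight space. *)
have inv0 (be : wt) : nu be (lo i) <> nu be (hi i) -> inv_on (Yweight zeta actY be)
    (fun w => actY (Yy k r (lo i)) w - actY (Yy k r (hi i)) w) 0 = 0.
  move=> ne; rewrite YweightE -{1}(rlin0 (pact_linear xL
    (dpoly (be (lo i)) (be (hi i)) 'X_(lo i) 'X_(hi i)))).
    apply: (inv_on_pact xact) => [|u Wu|]; last exact: subspace0.
    by apply: unit_act_lin => //; rewrite subr_eq0; apply/eqP.
  exact: dE.
rewrite /phi -addrA; congr (_ + _); rewrite /pop' /pop YweightE.
have onlyal (S : set wt) (g : wt -> V) : (forall be, S be -> be != al -> g be = 0) ->
    \sum_(be \in S) g be = if al \in S then g al else 0.
  move=> g0; case: ifP => aS.
    have <- : \sum_(be \in [set al]%classic) g be = g al by rewrite fsbig_set1.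
    apply/esym/fsbig_widen => [be ->|be [Sb /= /eqP nb]].
      by rewrite -in_setE.
    exact: g0.
  apply: fsbig1 => be Sb; apply: g0 => //; apply: contraFN aS => /eqP <-.
  by rewrite in_setE.
rewrite !onlyal => [|be Sb nb|be [nb _] nab].
- rewrite !pE eqxx; case: (eqVneq (jj al (lo i))) => [ej|nj]; last first.
    rewrite !ifF ?addr0 //; apply/negP; rewrite in_setE => -[_ /eqP];
      by rewrite (negbTE nj).
  case: (eqVneq (nu al (lo i))) => [en|nn].
    rewrite ifF; last by apply/negP; rewrite in_setE => -[].
    by rewrite ifT ?add0r // in_setE.
  rewrite ifT; last by rewrite in_setE; split=> //; apply/eqP.
  rewrite ifF ?addr0; last by apply/negP; rewrite in_setE => -[/eqP]; rewrite (negbTE nn).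
  rewrite YweightE; congr (inv_on _ _ _); apply/funext => w.
  rewrite /denominator /yshift scalerBl opprB.
  by rewrite (AC (2*2*2) ((1*4)*((2*5)*(3*6)))) /= addNr subrr !addr0.
- by rewrite pE (negbTE nb).
- by rewrite pE (negbTE nab); apply: inv0.
Qed.

Lemma inv_qop i al (X : 'I_n -> V -> V) w : (forall a u, W al u -> X a u = x a u) ->
  W al w -> inv_on (W al) (qop (W al) X i al) (qnum_at i al \@ w) = den_at i al \@ w.
Proof.
move=> XE Ww; rewrite -(qop_den xact i al XE Ww).
rewrite inv_onE ?(pactW itw) // => [|w' Ww']; first exact: (pactW itw).
have [w1 Ww1 ->] := den_at_surj i Ww'; rewrite !(qop_den xact) // => e.
by congr (_ \@ _); apply: unit_act_inj e => //; apply: qnum_unit.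
Qed.

Lemma yshift_on al a v : W al v -> yshift actY al a v = x a v.
Proof. by move=> Wv; rewrite /yshift (rl_Yy R _ Wv) addrK. Qed.

Lemma Psi_formulas_on al :
  let q' i := qop' zeta actY i al in
  (forall v, actH (H1 al) v = eproj zeta actY al v) /\
  forall v, W al v ->
    [/\ forall a, actH (Hx a al) v = actY (Yy k r a) v - nu al a *: v,
        forall i, actH (Ht i al) v = phi I zeta actY i (inv_on (W al) (q' i) v) &
        forall i, phi I zeta actY i (inv_on (W al) (q' i) v) =
          actY (Yf k r i) (inv_on (W al) (q' i) v)
          + pop' zeta actY i al (inv_on (W al) (q' i) v)].
Proof.
move=> q'; split=> [v|v Wv].
  rewrite (rl_H1 R) /eproj; congr (projection _ _ _).
  by apply/funext => be; rewrite YweightE.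
have inv i : exists2 w, W al w & v = qnum_at i al \@ w /\
    inv_on (W al) (q' i) v = den_at i al \@ w.
  have [w Ww vE] := qnum_at_surj i Wv; exists w => //; split=> //.
  by rewrite vE /q' /qop' YweightE inv_qop // => a u; apply: yshift_on.
split=> [a|i|i].
- by rewrite (rl_Hx R) (proj_id Wsub Wds Wv) (rl_Yy R _ Wv) addrK.
- have [w Ww [vE ->]] := inv i; have Wd := pactW itw (den_at i al) Ww.
  rewrite (phi_on _ Wd) /pop' YweightE (pop_den xact) => [|a u|] //.
    by rewrite (rl_Ht R) (proj_id Wsub Wds Wv) (tau_on Ww vE) (rl_Yf R).
  exact: yshift_on.
- by have [w Ww [vE ->]] := inv i; rewrite (phi_on _ (pactW itw _ Ww)).
Qed.

End Realization.

Section Homomorphisms.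
Variables (V : lmodType k) (actH : Halg I r n -> V -> V).
Variables (actY : Yalg k r n -> V -> V) (W : wt -> set V) (x : 'I_n -> V -> V).
Variables tau f : 'I_n.-1 -> V -> V.
Hypothesis R : realization actH actY W x tau f.
Variables (V' : lmodType k) (actH' : Halg I r n -> V' -> V').
Variables (actY' : Yalg k r n -> V' -> V') (W' : wt -> set V') (x' : 'I_n -> V' -> V').
Variables tau' f' : 'I_n.-1 -> V' -> V'.
Hypothesis R' : realization actH' actY' W' x' tau' f'.
Variable g : V -> V'.
Hypothesis gL : linear g.

Let Wsub := itw_sub (rl_itw R).
Let Wds := rl_ds R.
Let Wsub' := itw_sub (rl_itw R').
Let Wds' := rl_ds R'.

Lemma hom_pact al (p : P) v : (forall a u, W al u -> g (x a u) = x' a (g u)) ->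
  W al v -> g (pact x p v) = pact x' p (g v).
Proof.
move=> gx Wv; rewrite (rlin_sum gL); apply: eq_bigr => m _.
rewrite (rlinZ gL); congr (_ *: _); rewrite /xmon.
suff [] : g (foldr (fun a u => iter (m a) (x a) u) v (enum 'I_n))
   = foldr (fun a u => iter (m a) (x' a) u) (g v) (enum 'I_n) /\
   W al (foldr (fun a u => iter (m a) (x a) u) v (enum 'I_n)) by [].
elim: (enum 'I_n) => //= a s [IH IW].
elim: (m a) => [//|d [IHd IWd]] /=; rewrite gx // IHd; split=> //.
exact: (itw_xW (rl_itw R)).
Qed.

(** The idempotents force [g] to respect weights, hence it commutes with [x], with [tau] and with
    polynomials in [x]; writing a weight vector as a multiple of [den_at] transfers this to [f]. *)
Lemma hom_YH_of_HY : (forall b v, g (actH b v) = actH' b (g v)) ->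
  forall b v, g (actY b v) = actY' b (g v).
Proof.
move=> gH; have gW al v : W al v -> W' al (g v).
  move=> Wv; rewrite -(proj_id Wsub Wds Wv) -(rl_H1 R) gH (rl_H1 R').
  exact: proj_in.
have gx al a v : W al v -> g (x a v) = x' a (g v).
  move=> Wv; rewrite -{1}(proj_id Wsub Wds Wv) -(rl_Hx R) gH (rl_Hx R').
  by rewrite (proj_id Wsub' Wds') //; apply: gW.
have gt al i v : W al v -> g (tau i v) = tau' i (g v).
  move=> Wv; rewrite -{1}(proj_id Wsub Wds Wv) -(rl_Ht R) gH (rl_Ht R').
  by rewrite (proj_id Wsub' Wds') //; apply: gW.
apply: (mod_hom (rl_Y R) (rl_Y R') gL) => -[|a|i|a] v.
- by rewrite (rl_Y1 R) (rl_Y1 R').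
all: move: v; apply: (ds_eq Wds) => [||al v Wv];
  try by move=> c u w; rewrite ?gL ?(actY_linear R) ?(actY_linear R') ?gL.
- by rewrite (rl_Yt R _ Wv) (rl_Yt R' _ (gW _ _ Wv)) (rlinZ gL).
- have [w Ww ->] := den_at_surj R i Wv.
  rewrite (rl_Yf R) (rl_Yf R') (itw_f (rl_itw R)) // (rlinB gL).
  have H p := hom_pact p (gx al) Ww.
  rewrite (gt al _ _ (pactW (rl_itw R) _ Ww)) !H.
  by rewrite (itw_f (rl_itw R') _ (gW _ _ Ww)).
- rewrite (rl_Yy R _ Wv) (rl_Yy R' _ (gW _ _ Wv)) (rlinD gL) (gx _ _ _ Wv).
  by rewrite (rlinZ gL).
Qed.

(** Weights are respected because they are defined by the actions of the t's and y's; a weight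
    vector is now written as a multiple of [qnum_at]. *)
Lemma hom_HY_of_YH : (forall b v, g (actY b v) = actY' b (g v)) ->
  forall b v, g (actH b v) = actH' b (g v).
Proof.
move=> gY; have gW al v : W al v -> W' al (g v).
  rewrite -(YweightE R) -(YweightE R') => Yv a.
  have [[d dv] tv] := Yv a; split; last by rewrite -gY tv (rlinZ gL).
  exists d; have -> : iter d (fun w => actY' (Yy k r a) w - nu al a *: w) (g v) =
      g (iter d (fun w => actY (Yy k r a) w - nu al a *: w) v).
    by elim: d {dv} => //= d ->; rewrite (rlinB gL) gY (rlinZ gL).
  by rewrite dv (rlin0 gL).
have gx al a v : W al v -> g (x a v) = x' a (g v).
  move=> Wv; rewrite -(yshift_on R a Wv) -(yshift_on R' a (gW _ _ Wv)) /yshift.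
  by rewrite (rlinB gL) gY (rlinZ gL).
have gp al v : g (projection W al v) = projection W' al (g v).
  by rewrite (proj_comm al v Wds Wds' gL).
apply: (mod_hom (rl_H R) (rl_H R') gL) => -[al|a al|i al] v.
- by rewrite (rl_H1 R) (rl_H1 R') gp.
- by rewrite (rl_Hx R) (rl_Hx R') -gp (gx al) //; apply: proj_in.
rewrite (rl_Ht R) (rl_Ht R') -gp; move: (projection _ _ _) (proj_in Wds al v).
move=> u Wu; have [w Ww uE] := qnum_at_surj R i Wu.
have H p := hom_pact p (gx al) Ww.
rewrite (tau_on R Ww uE) (tau_on R' (gW _ _ Ww) (etrans (congr1 g uE) (H _))).
by rewrite (rlinD gL) -(rl_Yf R) gY (rl_Yf R') !H.
Qed.

End Homomorphisms.
End Realizations.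

(** * Constructing either action from the other *)

Section Build.
Variables (k : fieldType) (I : set k) (r n : nat) (zeta : k).
Local Notation P := {mpoly k[n]}.
Local Notation wt := (weight I r n).
Hypothesis zetaP : r.-primitive_root zeta.
Variables (V : lmodType k) (W : wt -> set V) (x : 'I_n -> V -> V).
Variables tau f : 'I_n.-1 -> V -> V.
Hypothesis itw : intertwining W x tau f.
Hypothesis Wds : direct_sum W.

Let Wsub := itw_sub itw.
Let xact := itw_nil itw.
Let xL := nil_lin xact.
Let xC := nil_comm xact.
Let xN := nil_nil xact.
Let xW := itw_xW itw.
Let tauL := itw_tauL itw.
Let fL := itw_fL itw.
Let tauW := itw_tauW itw.
Local Notation "p \@ v" := (pact x p v) (at level 42, right associativity).

Definition rho_Y (g : Ygen n) : V -> V :=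
  match g with
  | Y1gen => id
  | Ytgen a => glue W (fun al v => zeta ^+ jj al a *: v)
  | Yfgen i => f i
  | Yygen a => glue W (fun al v => x a v + nu al a *: v)
  end.

Definition rho_H (g : Hgen I r n) : V -> V :=
  match g with
  | H1gen al => projection W al
  | Hxgen a al => x a \o projection W al
  | Htgen i al => tau i \o projection W al
  end.

Arguments rho_Y : simpl never.
Arguments rho_H : simpl never.

Lemma rho_Yt al a v : W al v -> rho_Y (Ytgen a) v = zeta ^+ jj al a *: v.
Proof.
move=> Wv; apply: (glue_on Wsub Wds _ Wv) => be b u w _ _.
by rewrite scalerDr !scalerA mulrC.
Qed.

Lemma rho_Yy al a v : W al v -> rho_Y (Yygen a) v = x a v + nu al a *: v.
Proof.
move=> Wv; apply: (glue_on Wsub Wds _ Wv) => be b u w _ _.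
by rewrite xL !scalerDr addrACA !scalerA mulrC.
Qed.

Lemma rho_Y_linear g : linear (rho_Y g).
Proof.
case: g => [|a|i|a]; [by []| |exact: fL|]; apply: (glue_linear Wsub Wds) => be b u w _ _.
  by rewrite scalerDr !scalerA mulrC.
by rewrite xL !scalerDr addrACA !scalerA mulrC.
Qed.

Lemma rho_H_linear g : linear (rho_H g).
Proof.
have pL al := proj_linear Wsub Wds al.
by case: g => [al|a al|i al] b u v; rewrite /rho_H /= pL ?xL ?tauL.
Qed.

Lemma jj_sperm i (al : wt) a : jj al (lo i) = jj al (hi i) ->
  jj al (sperm i a) = jj al a.
Proof.
move=> e; have [->|al_] := eqVneq a (lo i); first by rewrite sperm_lo.
have [->|ah] := eqVneq a (hi i); first by rewrite sperm_hi.
by rewrite sperm_D.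
Qed.

(** [tau i] moves the weight along the transposition; the [p] term keeps the weight but is nonzero
    only if [j_i = j_(i+1)]. *)
Lemma f_t i al a v : W al v ->
  f i (rho_Y (Ytgen a) v) = rho_Y (Ytgen (sperm i a)) (f i v).
Proof.
move=> Wv; rewrite (rho_Yt _ Wv) (rlinZ (fL i)).
have ud : unit_act x (den_at i al) by apply: den_unit.
have [w Ww ->] := unit_surj itw ud Wv.
rewrite (itw_f itw) // (rlinB (rho_Y_linear _)).
rewrite (rho_Yt _ (tauW i (pactW itw _ Ww))) jj_swt.
rewrite (rho_Yt _ (pactW itw _ Ww)) scalerBr; congr (_ - _).
rewrite /pnum_at /pnum; case: eqP => [e|_]; last by rewrite pact0 !scaler0.
by rewrite jj_sperm.
Qed.

(** With [v] written as [den_at] applied to [w], two errors arise: the correction of [tau x] on the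
    numerator and the shift of [y] past the [p] term ([pnum_place]). [den_relation] adds them up. *)
Lemma f_y i al a v : W al v ->
  f i (rho_Y (Yygen a) v) = rho_Y (Yygen (sperm i a)) (f i v) +
    (if jj al (lo i) == jj al (hi i) then place_sign k i a *: v else 0).
Proof.
move=> Wv; rewrite (rho_Yy _ Wv) (rlinD (fL i)) (rlinZ (fL i)).
have ud : unit_act x (den_at i al) by apply: den_unit.
have [w Ww vE] := unit_surj itw ud Wv.
have xp p b u : x b (p \@ u) = p \@ x b u by rewrite -!pactX // pact_comm.
have Wq := pactW itw (qnum_at i al) Ww; have Wp := pactW itw (pnum_at i al) Ww.
rewrite {1 2 3}vE xp !(itw_f itw) //; last exact: xW.
rewrite (rlinB (rho_Y_linear _)) (rho_Yy _ (tauW i Wq)) nu_swt (rho_Yy _ Wp).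
rewrite -xp (itw_tau_x itw i a Wq).
set T := tau i _; set Y := x _ T; set e := if al (lo i) == _ then _ else _.
suff E : e = (x a (pnum_at i al \@ w) + nu al a *: (pnum_at i al \@ w)) -
    (x (sperm i a) (pnum_at i al \@ w) + nu al (sperm i a) *: (pnum_at i al \@ w)) +
    (if jj al (lo i) == jj al (hi i) then place_sign k i a *: v else 0).
  rewrite E -xp scalerBr; set p1 := x a _; set p2 := nu al a *: (_ \@ w).
  set p4 := x (sperm i a) _ + _; set d := if _ then _ else _.
  by rewrite (AC (1*4*1*2) ((1*7*4*5)*((2*6)*(3*8)))) /= !subrr !addr0.
set c := place_sign k i a.
have cE : e = (c *: (if al (lo i) == al (hi i) then qnum_at i al else 0)) \@ w.
  rewrite /e /c /place_sign; case: (al _ == al _); last by rewrite scaler0 pact0.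
  by do 2!(case: (a == _)); rewrite ?scaleN1r ?pactN ?scale1r ?scale0r ?pact0.
have dE : (if jj al (lo i) == jj al (hi i) then c *: v else 0) =
    (c *: (if jj al (lo i) == jj al (hi i) then den_at i al else 0)) \@ w.
  by case: (jj al _ == _); rewrite pactZ -?vE // pact0 scaler0.
rewrite cE (pnum_place xact) dE -pactD //; congr (_ \@ _).
by rewrite -den_relation scalerDr addrCA addNr addr0.
Qed.

Lemma rho_Y_rel u v : f_involutive f -> f_commute f -> f_braid f ->
  @Yrel k r n u v -> teval rho_Y u =1 teval rho_Y v.
Proof.
move=> f2 ff fb uv.
have tW al a w : W al w -> W al (rho_Y (Ytgen a) w).
  by move=> Ww; rewrite (rho_Yt _ Ww); apply: subspaceZ.
have yW al a w : W al w -> W al (rho_Y (Yygen a) w).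
  move=> Ww; rewrite (rho_Yy _ Ww); apply: subspaceD => //; first exact: xW.
  exact: subspaceZ.
have onW (u0 v0 : term k (Ygen n)) :
    (forall al w, W al w -> teval rho_Y u0 w = teval rho_Y v0 w) ->
    teval rho_Y u0 =1 teval rho_Y v0.
  exact: (ds_eq Wds (teval_linear rho_Y_linear _) (teval_linear rho_Y_linear _)).
have fE i w : rho_Y (Yfgen i) w = f i w by [].
have idem i al w : W al w ->
    teval rho_Y (eY k r i) w = if jj al (lo i) == jj al (hi i) then w else 0.
  by move=> Ww; apply: (teval_eY zetaP rho_Y_linear) => //; apply: rho_Yt.
case: uv => {u v} [u|u|i l il|i l il|a b|i a|a|i|a b|i|i a al_ ah|a b] //.
- by move=> w; apply: ff.
- by move=> w; apply: fb.
- apply: onW => al w Ww /=.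
  rewrite !(rho_Yt _ Ww) !(rlinZ (rho_Y_linear _)) !(rho_Yt _ Ww) !scalerA.
  by rewrite mulrC.
- by apply: onW => al w Ww /=; apply: f_t Ww.
- apply: onW => al w Ww /=; rewrite (teval_tpow rho_Y_linear _ _ (rho_Yt a Ww)) //.
  by rewrite exprAC (prim_expr_order zetaP) expr1n scale1r.
- by move=> w; apply: f2.
- apply: onW => al w Ww /=; rewrite (rho_Yy _ Ww) (rho_Yy a Ww).
  have Wxa := xW a Ww; have Wxb := xW b Ww.
  rewrite !(rlinD (rho_Y_linear _)) !(rlinZ (rho_Y_linear _)).
  rewrite !(rho_Yy _ Wxa) !(rho_Yy _ Wxb) !(rho_Yy _ Ww) xC !scalerDr !scalerA.
  rewrite -!addrA [nu al b * _]mulrC; congr (_ + _).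
  by rewrite addrCA.
- apply: onW => al w Ww; rewrite -[RHS]/(_ + teval rho_Y (eY k r i) w) (idem _ _ _ Ww) /=.
  rewrite !fE (f_y _ _ Ww) sperm_hi /place_sign eqxx.
  by rewrite [hi i == _]eq_sym (negbTE (lo_neq_hi i)) scale1r.
- apply: onW => al w Ww /=; rewrite !fE (f_y _ _ Ww) sperm_D // /place_sign.
  by rewrite (negbTE al_) (negbTE ah) scale0r if_same addr0.
- apply: onW => al w Ww /=.
  have Wt := tW al a w Ww; have Wy := yW al b w Ww.
  by rewrite (rho_Yt a Wy) (rho_Yt a Ww) (rlinZ (rho_Y_linear _)).
Qed.

Lemma build_Y (actH : Halg I r n -> V -> V) :
  is_module (@Hmul k I r n) actH ->
  (forall al v, actH (H1 al) v = projection W al v) ->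
  (forall a al v, actH (Hx a al) v = x a (projection W al v)) ->
  (forall i al v, actH (Ht i al) v = tau i (projection W al v)) ->
  tau_quadratic W x tau -> tau_far W tau -> tau_braid W x tau ->
  realization zeta actH (@ev_act _ _ (@Yrel k r n) _ rho_Y) W x tau f.
Proof.
move=> HM H1E HxE HtE tq tf tb.
have rel u v : @Yrel k r n u v -> teval rho_Y u =1 teval rho_Y v.
  apply: rho_Y_rel; [exact: (quadratic_f itw)|exact: (far_f itw)|].
  exact: (braid_f itw).
have gE g v : @ev_act _ _ (@Yrel k r n) _ rho_Y (pi_alg (@Yrel k r n) (Gen g)) v
    = rho_Y g v.
  exact: (ev_act_pi rho_Y_linear rel).
split=> //.
- exact: (ev_act_module rho_Y_linear rel).
- by move=> v; apply: gE.
- by move=> al a v Wv; rewrite gE; apply: rho_Yt.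
- by move=> al a v Wv; rewrite gE; apply: rho_Yy.
- by move=> i v; apply: gE.
Qed.

Lemma rho_H_rel u v : tau_quadratic W x tau -> tau_far W tau ->
  tau_braid W x tau -> @Hrel k I r n u v -> teval rho_H u =1 teval rho_H v.
Proof.
move=> tq tf tb uv; have pin al w : W al (projection W al w) by apply: proj_in.
have pid al w : W al w -> projection W al w = w by apply: proj_id.
have e1 al w : rho_H (H1gen al) w = projection W al w by [].
have ex a al w : rho_H (Hxgen a al) w = x a (projection W al w) by [].
have et i al w : rho_H (Htgen i al) w = tau i (projection W al w) by [].
have poly p al w : teval rho_H (poly1 p al) w = p \@ projection W al w.
  apply: (@teval_poly1 _ _ _ _ _ x W) => [a u0|u0|a u0 Wu]; first exact: xW.
    exact: pin.
  by rewrite ex pid.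
case: uv => {u v} [al be|a al|a al|i al|i al|a b al|i l al il|i a al|i al
  |i l al D il e DE|i l al il ne] w; rewrite ?poly /=.
- rewrite !e1 (proj_on Wsub Wds _ (pin be w)); by case: eqP => [->|_].
- by rewrite !ex e1 pid.
- by rewrite e1 !ex pid //; apply: xW.
- by rewrite !et e1 pid.
- by rewrite e1 !et pid //; apply: tauW.
- by rewrite !ex (pid _ _ (xW b (pin al w))) (pid _ _ (xW a (pin al w))) xC.
- have Wp := pin al w; rewrite !et (pid _ _ (tauW l Wp)) (pid _ _ (tauW i Wp)).
  exact: tf Wp.
- rewrite !et !ex (pid al); last exact: xW.
  rewrite (pid (swt i al)); last exact: tauW.
  rewrite (itw_tau_x itw i a (pin al w)) addrAC subrr add0r.
  by case: (_ == _) => //; case: (_ == _) => //; case: (_ == _).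
- by rewrite !et (pid _ _ (tauW i (pin al w))) (tq _ _ _ (pin al w)).
- have Wp := pin al w; rewrite !et.
  have Wl := tauW l Wp; have Wi := tauW i Wp.
  rewrite !(pid _ _ Wl) !(pid _ _ Wi) !(pid _ _ (tauW _ Wl)) !(pid _ _ (tauW _ Wi)).
  by apply: tb => //; rewrite /divided_difference e eqxx -e.
- have Wp := pin al w; rewrite !et.
  have Wl := tauW l Wp; have Wi := tauW i Wp.
  rewrite !(pid _ _ Wl) !(pid _ _ Wi) !(pid _ _ (tauW _ Wl)) !(pid _ _ (tauW _ Wi)).
  rewrite (tb _ _ _ _ 0 il Wp) ?pact0 // /divided_difference.
  by rewrite (introF eqP ne).
Qed.

Lemma build_H (actY : Yalg k r n -> V -> V) :
  is_module (@Ymul k r n) actY ->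
  (forall v, actY (Y1 k r n) v = v) ->
  (forall al a v, W al v -> actY (Yt k r a) v = zeta ^+ jj al a *: v) ->
  (forall al a v, W al v -> actY (Yy k r a) v = x a v + nu al a *: v) ->
  (forall i v, actY (Yf k r i) v = f i v) ->
  realization zeta (@ev_act _ _ (@Hrel k I r n) _ rho_H) actY W x tau f.
Proof.
move=> YM Y1E YtE YyE YfE.
have f2 : f_involutive f.
  by move=> i v; rewrite -!YfE -[RHS]Y1E; exact: (mod_rel YM v (Y_f2 k r i)).
have ff : f_commute f.
  by move=> i l v il; rewrite -!YfE; exact: (mod_rel YM v (Y_ff k r il)).
have fb : f_braid f.
  by move=> i l v il; rewrite -!YfE; exact: (mod_rel YM v (Y_braid k r il)).
have tq := f_quadratic_tau itw f2.
have rel u v : @Hrel k I r n u v -> teval rho_H u =1 teval rho_H v.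
  apply: rho_H_rel; [by []|exact: (f_far_tau itw)|].
  exact: (f_braid_tau itw).
have gE g v : @ev_act _ _ (@Hrel k I r n) _ rho_H (pi_alg (@Hrel k I r n) (Gen g)) v
    = rho_H g v.
  exact: (ev_act_pi rho_H_linear rel).
split=> //; try by move=> *; apply: gE.
exact: (ev_act_module rho_H_linear rel).
Qed.

End Build.

(** * From quiver Hecke modules to Yokonuma-Hecke modules *)

Section FromH.
Variables (k : fieldType) (I : set k) (r n : nat) (zeta : k).
Local Notation P := {mpoly k[n]}.
Local Notation wt := (weight I r n).
Hypothesis zetaP : r.-primitive_root zeta.
Variables (V : lmodType k) (act : Halg I r n -> V -> V).

Definition H_x a : V -> V := glue (Hweight act) (fun al => act (Hx a al)).
Definition H_tau i : V -> V := glue (Hweight act) (fun al => act (Ht i al)).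
(** Solves the equation of [intertwining] for [f]: on each weight space divide by [den_at] first. *)
Definition H_f i : V -> V := glue (Hweight act) (fun al v =>
  let w := inv_on (Hweight act al) (pact H_x (den_at i al)) v in
  H_tau i (pact H_x (qnum_at i al) w) - pact H_x (pnum_at i al) w).
Definition H_to_Y : Yalg k r n -> V -> V :=
  @ev_act _ _ (@Yrel k r n) _ (rho_Y zeta (Hweight act) H_x H_f).

Hypothesis HC : CGamma I r n V act.
Let Hact : is_module (@Hmul k I r n) act. Proof. by case: HC. Qed.
Let Wds : direct_sum (Hweight act). Proof. by case: HC. Qed.
Let W := Hweight act.
Let aL b : linear (act b) := mod_linear Hact b.

Let e_mul al be v : act (H1 al) (act (H1 be) v) = if al == be then act (H1 al) v else 0.
Proof.
have -> : act (H1 al) (act (H1 be) v) =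
    teval (fun g => act (pi_alg (@Hrel k I r n) (Gen g)))
      (if al == be then e1 al else 0%expr) v := mod_rel Hact v (H_11 al be).
by case: eqP => [->|_].
Qed.

Let e_in al v : W al (act (H1 al) v). Proof. by exists v. Qed.

Let e_id al v : W al v -> act (H1 al) v = v.
Proof. by case=> u _ <-; rewrite e_mul eqxx. Qed.

Let Wsub al : subspace (W al).
Proof.
split; first by exists 0 => //; apply: (rlin0 (aL _)).
by move=> a u v [u' _ <-] [v' _ <-]; exists (a *: u' + v') => //; rewrite aL.
Qed.

Lemma H1_projection al v : act (H1 al) v = projection W al v.
Proof.
move: v; apply: (ds_eq Wds (aL _) (proj_linear Wsub Wds _)) => be v Wv.
by rewrite (proj_on Wsub Wds _ Wv) -{1}(e_id Wv) e_mul; case: eqP => // ->; apply: e_id.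
Qed.

Let x_in a al v : W al (act (Hx a al) v).
Proof.
have <- : act (H1 al) (act (Hx a al) v) = act (Hx a al) v.
  exact: (mod_rel Hact v (H_1x a al)).
exact: e_in.
Qed.

Let xE a al v : W al v -> H_x a v = act (Hx a al) v.
Proof. by move=> Wv; apply: (glue_on Wsub Wds _ Wv) => be c u w _ _; rewrite aL. Qed.

Let tauE i al v : W al v -> H_tau i v = act (Ht i al) v.
Proof. by move=> Wv; apply: (glue_on Wsub Wds _ Wv) => be c u w _ _; rewrite aL. Qed.

Let tauL i : linear (H_tau i).
Proof. by apply: (glue_linear Wsub Wds) => be c u w _ _; rewrite aL. Qed.

Let xW al a v : W al v -> W al (H_x a v).
Proof. by move=> Wv; rewrite (xE a Wv); apply: x_in. Qed.

Lemma H_nil_action : nil_action H_x.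
Proof.
have xL a : linear (H_x a).
  by apply: (glue_linear Wsub Wds) => be c u w _ _; rewrite aL.
split=> // [a b|a].
  apply: (ds_eq Wds (comp_linear (xL a) (xL b)) (comp_linear (xL b) (xL a))) 
    => al v Wv /=.
  rewrite (xE b Wv) (xE a Wv) (xE a (x_in b al v)) (xE b (x_in a al v)).
  exact: (mod_rel Hact v (H_xx a b al)).
have NS := subspace_nil (xL a).
apply: (ds_ind Wds) => [|u v Nu Nv|al v Wv].
- exact: (subspace0 NS).
- exact: (subspaceD NS Nu Nv).
have [_ _ _ /(_ al a v Wv)[d dv]] := HC; exists d.
suff [-> _] : iter d (H_x a) v = iter d (act (Hx a al)) v /\
  W al (iter d (act (Hx a al)) v) by [].
elim: d {dv} => [//|d [IH IW]] /=; rewrite IH (xE a IW); split=> //.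
Qed.

Let tauW i al v : W al v -> W (swt i al) (H_tau i v).
Proof.
move=> Wv; rewrite (tauE i Wv).
have <- : act (H1 (swt i al)) (act (Ht i al) v) = act (Ht i al) v.
  exact: (mod_rel Hact v (H_1t i al)).
exact: e_in.
Qed.

Let xL := nil_lin H_nil_action.
Let xC := nil_comm H_nil_action.
Let xN := nil_nil H_nil_action.

Let f_glue i al a u v : W al u -> W al v ->
  let F v := let w := inv_on (W al) (pact H_x (den_at i al)) v in
    H_tau i (pact H_x (qnum_at i al) w) - pact H_x (pnum_at i al) w in
  F (a *: u + v) = a *: F u + F v.
Proof.
have ud : unit_act H_x (den_at i al) by apply: den_unit.
have inv w : W al w ->
    inv_on (W al) (pact H_x (den_at i al)) (pact H_x (den_at i al) w) = w.
  exact: (inv_on_pact H_nil_action).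
have pL p := pact_linear xL p.
move=> Wu Wv F; have [_ sd] := ud.
have [u1 Wu1 uE] := sd _ (Wsub al) (fun b w => @xW al b w) u Wu.
have [v1 Wv1 vE] := sd _ (Wsub al) (fun b w => @xW al b w) v Wv.
have W1 : W al (a *: u1 + v1) by case: (Wsub al) => _; apply.
rewrite /F uE vE -pL !inv // !pL tauL scalerBr opprD addrACA.
by rewrite -scalerN.
Qed.

Lemma H_intertwining : intertwining W H_x H_tau H_f.
Proof.
split; [exact: Wsub|exact: H_nil_action|exact: xW|exact: tauL| |exact: tauW| |].
- by move=> i; apply: (glue_linear Wsub Wds) => be c u w Wu Ww; apply: f_glue.
- move=> i al a v Wv; rewrite (tauE i (xW a Wv)) (xE a Wv) (tauE i Wv).
  have Wt : W (swt i al) (act (Ht i al) v) by rewrite -(tauE i Wv); apply: tauW.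
  rewrite (xE (sperm i a) Wt); have := mod_rel Hact v (H_tx i a al) => /=.
  move=> /eqP; rewrite subr_eq addrC => /eqP ->; congr (_ + _).
  case: (_ == _) => //; case: (_ == _); first by rewrite /= (e_id Wv).
  by case: (_ == _) => //=; rewrite e_id.
- move=> i al v Wv.
  have Wd : W al (pact H_x (den_at i al) v).
    by apply: pact_stable => // b w; apply: xW.
  rewrite /H_f (glue_on Wsub Wds _ Wd) => [|be c u w Wu Ww]; last exact: f_glue.
  by rewrite (inv_on_pact H_nil_action) //; apply: den_unit.
Qed.

Lemma H_realization : realization zeta act H_to_Y W H_x H_tau H_f.
Proof.
have pin al v : W al (projection W al v) by apply: (proj_in Wds).
have itw := H_intertwining.
have poly p al v : W al v -> teval (fun g => act (pi_alg (@Hrel k I r n) (Gen g)))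
    (poly1 p al) v = pact H_x p v.
  move=> Wv; rewrite -[in RHS](e_id Wv).
  apply: (@teval_poly1 _ _ _ _ _ H_x W) => [a u|u|a u Wu]; first exact: xW.
    exact: e_in.
  exact/esym/xE.
apply: (build_Y zetaP itw Wds Hact H1_projection).
- move=> a al v; rewrite (xE a (pin al v)) -H1_projection.
  exact/esym/(mod_rel Hact v (H_x1 a al)).
- move=> i al v; rewrite (tauE i (pin al v)) -H1_projection.
  exact/esym/(mod_rel Hact v (H_t1 i al)).
- move=> i al v Wv; rewrite (tauE i Wv).
  have Wt := tauW i Wv; rewrite (tauE i Wv) in Wt.
  rewrite (tauE i Wt); rewrite [LHS](mod_rel Hact v (H_quadratic i al)).
  exact: poly.
- move=> i l al v il Wv; have Wi := tauW i Wv; have Wl := tauW l Wv.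
  rewrite (tauE i Wl) (tauE l Wi) (tauE i Wv) (tauE l Wv).
  exact: (mod_rel Hact v (H_tt al il)).
- move=> i l al v D il Wv; have Wi := tauW i Wv; have Wl := tauW l Wv.
  have Wli := tauW l Wi; have Wil := tauW i Wl.
  rewrite (tauE l Wil) (tauE i Wl) (tauE l Wv) (tauE i Wli) (tauE l Wi) (tauE i Wv).
  rewrite /divided_difference; case: eqP => [e|ne] DE; last first.
    by rewrite DE pact0; apply: (mod_rel Hact v (H_braid_neq il ne)).
  rewrite [LHS](mod_rel Hact v (H_braid_eq il e DE)).
  exact: poly.
Qed.

End FromH.

(** * From Yokonuma-Hecke modules to quiver Hecke modules *)

Section FromY.
Variables (k : fieldType) (I : set k) (r n : nat) (zeta : k).
Local Notation P := {mpoly k[n]}.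
Local Notation wt := (weight I r n).
Hypothesis zetaP : r.-primitive_root zeta.
Variables (V : lmodType k) (act : Yalg k r n -> V -> V).

Definition Y_W : wt -> set V := fun al => Yweight zeta act al.
Definition Y_x a : V -> V := glue Y_W (fun al => yshift act al a).
(** The intertwiner [f + p'] applied to [den_at] times [w]. Since the inverse of [q'] is [den_at]
    over [qnum_at], dividing by [qnum_at] alone then gives [tau]. *)
Definition Y_phi i (al : wt) w : V :=
  act (Yf k r i) (pact Y_x (den_at i al) w) + pact Y_x (pnum_at i al) w.
Definition Y_tau i : V -> V := glue Y_W (fun al v =>
  Y_phi i al (inv_on (Y_W al) (pact Y_x (qnum_at i al)) v)).
Definition Y_to_H : Halg I r n -> V -> V :=
  @ev_act _ _ (@Hrel k I r n) _ (rho_H Y_W Y_x Y_tau).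

Hypothesis YC : CK r n I zeta V act.
Let Yact : is_module (@Ymul k r n) act. Proof. by case: YC. Qed.
Let Wds : direct_sum Y_W. Proof. by case: YC. Qed.
Let act1 v : act (Y1 k r n) v = v. Proof. by case: YC. Qed.
Let aL b : linear (act b) := mod_linear Yact b.
Local Notation t a := (act (Yt k r a)).
Local Notation y a := (act (Yy k r a)).
Local Notation f i := (act (Yf k r i)).

Let yshift_linear (al : wt) a : linear (yshift act al a).
Proof.
move=> c u w; rewrite /yshift aL scalerBr scalerDr opprD addrACA.
by rewrite !scalerA [_ * c]mulrC.
Qed.

Let Wsub al : subspace (Y_W al).
Proof.
split=> [a|c u v Wu Wv a].
  by split; [exists 0%N|rewrite scaler0; apply: (rlin0 (aL _))].
have [Nu tu] := Wu a; have [Nv tv] := Wv a; split.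
  by case: (subspace_nil (yshift_linear al a)) => _; apply.
by rewrite aL tu tv scalerDr !scalerA mulrC.
Qed.

Let yC a b v : y a (y b v) = y b (y a v) := mod_rel Yact v (Y_yy k r a b).
Let ty a b v : t a (y b v) = y b (t a v) := mod_rel Yact v (Y_ty k r a b).
Let ft i a v : f i (t a v) = t (sperm i a) (f i v) := mod_rel Yact v (Y_ft k r i a).

Let ff i v : f i (f i v) = v.
Proof. by rewrite -[RHS]act1; exact: (mod_rel Yact v (Y_f2 k r i)). Qed.

Let yW al a v : Y_W al v -> Y_W al (y a v).
Proof.
move=> Wv b; have [[d dv] tv] := Wv b; split; last by rewrite ty tv (rlinZ (aL _)).
exists d; suff -> : iter d (yshift act al b) (y a v) = y a (iter d (yshift act al b) v).
  by rewrite dv (rlin0 (aL _)).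
by elim: d {dv} => //= d ->; rewrite /yshift yC (rlinB (aL _)) (rlinZ (aL _)).
Qed.

Let xE a al v : Y_W al v -> Y_x a v = yshift act al a v.
Proof.
move=> Wv; apply: (glue_on Wsub Wds _ Wv) => be c u w _ _.
exact: yshift_linear.
Qed.

Let yE a al v : Y_W al v -> y a v = Y_x a v + nu al a *: v.
Proof. by move=> Wv; rewrite (xE a Wv) subrK. Qed.

Let xW al a v : Y_W al v -> Y_W al (Y_x a v).
Proof.
move=> Wv; rewrite (xE a Wv); apply: (subspaceB (Wsub al)); first exact: yW.
exact: (subspaceZ _ (Wsub al)).
Qed.

Lemma Y_nil_action : nil_action Y_x.
Proof.
have xL a : linear (Y_x a).
  by apply: (glue_linear Wsub Wds) => be c u w _ _; apply: yshift_linear.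
split=> // [a b|a].
  apply: (ds_eq Wds (comp_linear (xL a) (xL b)) (comp_linear (xL b) (xL a)))
    => al v Wv /=.
  rewrite (xE a (xW b Wv)) (xE b (xW a Wv)) (xE b Wv) (xE a Wv) /yshift.
  rewrite !(rlinB (aL _)) !(rlinZ (aL _)) yC !scalerBr !scalerA [nu al b * _]mulrC.
  set A := y b (y a v); set B := _ *: y a v; set D := _ *: y b v; set E := _ *: v.
  by rewrite !opprB (AC (2*2) ((1*4)*(2*3))) /= [RHS](AC (2*2) ((1*2)*(4*3))).
have NS := subspace_nil (xL a).
apply: (ds_ind Wds) => [|u v Nu Nv|al v Wv].
- exact: (subspace0 NS).
- exact: (subspaceD NS Nu Nv).
have [[d dv] _] := Wv a; exists d.
suff [-> _] : iter d (Y_x a) v = iter d (yshift act al a) v /\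
  Y_W al (iter d (yshift act al a) v) by [].
elim: d {dv} => [//|d [IH IW]] /=; rewrite IH (xE a IW); split=> //.
by rewrite -(xE a IW); apply: xW.
Qed.

Let xact := Y_nil_action.
Let xL := nil_lin xact.
Let xC := nil_comm xact.
Let xN := nil_nil xact.
Let pL p := pact_linear xL p.
Local Notation "p \@ v" := (pact Y_x p v) (at level 42, right associativity).

Let pW al p v : Y_W al v -> Y_W al (p \@ v).
Proof. by move=> Wv; apply: (pact_stable _ (Wsub al) _ Wv) => a w; apply: xW. Qed.

Let act_eY i (p q : 'I_r) v : t (lo i) v = zeta ^+ p *: v ->
  t (hi i) v = zeta ^+ q *: v ->
  f i (y (hi i) v) = y (lo i) (f i v) + (if p == q then v else 0).
Proof.
move=> tp tq.
have gL g : linear (fun v => act (pi_alg (@Yrel k r n) (Gen g)) v) := aL _.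
rewrite -(teval_eY zetaP gL act1 tp tq).
exact: (mod_rel Yact v (Y_fy_hi k r i)).
Qed.

Let f_yW i al a v : Y_W al v -> f i (y a v) = y (sperm i a) (f i v) +
    (if jj al (lo i) == jj al (hi i) then place_sign k i a *: v else 0).
Proof.
move=> Wv; have tv b := proj2 (Wv b); rewrite /place_sign.
have [->|al_] := eqVneq a (lo i); last first.
  have [->|ah] := eqVneq a (hi i).
    by rewrite sperm_hi scale1r; apply: act_eY; apply: tv.
  rewrite scale0r if_same addr0 sperm_D //.
  exact: (mod_rel Yact v (Y_fy k r al_ ah)).
have tl : t (lo i) (f i v) = zeta ^+ jj al (hi i) *: f i v.
  by rewrite -(rlinZ (aL _)) -tv ft sperm_hi.
have th : t (hi i) (f i v) = zeta ^+ jj al (lo i) *: f i v.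
  by rewrite -(rlinZ (aL _)) -tv ft sperm_lo.
(* The presentation only relates [f] to [y_(i+1)]. The rule for [y_i] follows by using it on
   [f i v], where the t-eigenvalues are swapped, and applying the involution [f i]. *)
have := congr1 (f i) (act_eY tl th); rewrite ff (rlinD (aL _)) ff sperm_lo => ->.
rewrite eq_sym scaleN1r; case: (_ == _); last by rewrite (rlin0 (aL _)) !addr0.
by rewrite ff addrK.
Qed.

Let phiL i al : linear (Y_phi i al).
Proof. by move=> c u w; rewrite /Y_phi !pL aL scalerDr addrACA. Qed.

Let y_phi i al a w : Y_W al w -> y (sperm i a) (Y_phi i al w) =
  Y_phi i al (y a w) -
  (if al (lo i) == al (hi i) then place_sign k i a *: (qnum_at i al \@ w) else 0).
Proof.
move=> Ww; have Wd := pW (den_at i al) Ww; have Wp := pW (pnum_at i al) Ww.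
have py p b : y b (p \@ w) = p \@ y b w.
  by rewrite (yE b (pW p Ww)) (yE b Ww) (rlinD (pL p)) (rlinZ (pL p)) pact_x.
rewrite /Y_phi (rlinD (aL _)) -!py (f_yW _ _ Wd).
rewrite (yE a Wp) (yE (sperm i a) Wp).
set F := y _ (f i _); set p1 := Y_x a _ + _; set p2 := Y_x (sperm i a) _ + _.
set c := place_sign k i a; set e := if al _ == _ then _ else _.
set d := if jj al _ == _ then _ else _.
suff E : p1 - p2 + d = e.
  by rewrite -E opprD opprB (AC (3*(2*1)) ((1*4)*((2*6)*(3*5)))) /= !subrr !addr0.
have -> : d = (c *: (if jj al (lo i) == jj al (hi i) then den_at i al else 0)) \@ w.
  by rewrite /d; case: (jj al _ == _); rewrite pactZ // pact0 scaler0.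
have -> : e = (c *: (if al (lo i) == al (hi i) then qnum_at i al else 0)) \@ w.
  by rewrite /e; case: (al _ == _); rewrite pactZ // pact0 scaler0.
rewrite /p1 /p2 (pnum_place xact) -pactD //; congr (_ \@ _).
by rewrite -den_relation scalerDr addrCA addNr addr0.
Qed.

(* Induction on the nilpotency exponent of w: the correction term in y_phi    *)
(* only occurs when al_i = al_(i+1), and then swt i al = al.                  *)
Let phi_W i al w : Y_W al w -> Y_W (swt i al) (Y_phi i al w).
Proof.
move=> Ww b; pose a := sperm i b; have bE : b = sperm i a by rewrite /a tpermK.
rewrite bE jj_swt; split; last first.
  have Wd := pW (den_at i al) Ww; have Wp := pW (pnum_at i al) Ww.
  rewrite /Y_phi (rlinD (aL _)) -ft (proj2 (Wd a)) (rlinZ (aL _)) scalerDr.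
  congr (_ + _); rewrite (proj2 (Wp _)).
  rewrite /pnum_at /pnum; case: eqP => [e|_]; last by rewrite pact0 !scaler0.
  by rewrite jj_sperm.
have sE u : yshift act (swt i al) (sperm i a) u = y (sperm i a) u - nu al a *: u.
  by rewrite /yshift nu_swt.
have NS := subspace_nil (yshift_linear (swt i al) (sperm i a)).
have [[d dw] _] := Ww a; move: dw.
elim: d w Ww => [|d IH] w Ww.
  by move=> /= ->; exists 0%N; rewrite (rlin0 (phiL i al)).
rewrite iterSr => dw.
suff [m Nm] : exists m, iter m (yshift act (swt i al) (sperm i a))
    (yshift act (swt i al) (sperm i a) (Y_phi i al w)) = 0.
  by exists m.+1; rewrite iterSr.
rewrite sE y_phi // addrAC -(rlinZ (phiL i al)) -(rlinB (phiL i al)).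
apply: (subspaceB NS).
  apply: IH => //; rewrite -/(yshift act al a w) -(xE a Ww); exact: xW.
case: eqP => [e|_]; last exact: (subspace0 NS).
apply: (subspaceZ _ NS); rewrite swt_id //.
by have [] := pW (qnum_at i al) Ww (sperm i a).
Qed.

Let inv_q i al u : Y_W al u ->
  inv_on (Y_W al) (pact Y_x (qnum_at i al)) (qnum_at i al \@ u) = u.
Proof. by apply: (inv_on_pact xact) => //; apply: qnum_unit. Qed.

Let q_surj i al v : Y_W al v -> exists2 w, Y_W al w & v = qnum_at i al \@ w.
Proof.
move=> Wv; have [_ sq] : unit_act Y_x (qnum_at i al) by apply: qnum_unit.
exact: (sq _ (Wsub al) (fun b w => @xW al b w) v Wv).
Qed.

Let phi_inv_linear i al c u v : Y_W al u -> Y_W al v ->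
  let F v := Y_phi i al (inv_on (Y_W al) (pact Y_x (qnum_at i al)) v) in
  F (c *: u + v) = c *: F u + F v.
Proof.
move=> /(q_surj i)[u1 Wu1 ->] /(q_surj i)[v1 Wv1 ->] F.
have W1 : Y_W al (c *: u1 + v1) by case: (Wsub al) => _; apply.
by rewrite /F -pL !inv_q // phiL.
Qed.

Let tau_q i al w : Y_W al w -> Y_tau i (qnum_at i al \@ w) = Y_phi i al w.
Proof.
move=> Ww; rewrite /Y_tau (glue_on Wsub Wds _ (pW _ Ww)) ?inv_q // => be c u v.
exact: phi_inv_linear.
Qed.

Let tauL i : linear (Y_tau i).
Proof.
by apply: (glue_linear Wsub Wds) => be c u v Wu Wv; apply: phi_inv_linear.
Qed.

Lemma Y_intertwining : intertwining Y_W Y_x Y_tau (fun i => f i).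
Proof.
split; [exact: Wsub|exact: xact|exact: xW|exact: tauL|by move=> i; apply: aL| | |].
- move=> i al v /(q_surj i)[w Ww ->]; rewrite (tau_q i Ww); exact: phi_W.
- move=> i al a v /(q_surj i)[w Ww ->]; rewrite pact_x // (tau_q i Ww).
  rewrite (tau_q i (xW a Ww)) (xE (sperm i a) (phi_W i Ww)) /yshift nu_swt y_phi //.
  rewrite (yE a Ww) (rlinD (phiL i al)) (rlinZ (phiL i al)).
  set p1 := Y_phi i al w; set e := if _ then _ else _; set e' := if _ then _ else _.
  have -> : e' = e.
    rewrite /e /e' /place_sign; case: (al _ == _) => //; case: (a == _).
      by rewrite scaleN1r.
    by case: (a == _); rewrite ?scale1r ?scale0r.
  by rewrite (AC (2*1*1*1) (1*(2*4)*(3*5))) /= subrr addNr !addr0.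
- by move=> i al v Wv; rewrite (tau_q i Wv) /Y_phi addrK.
Qed.

Lemma Y_realization :
  realization zeta Y_to_H act Y_W Y_x Y_tau (fun i => f i).
Proof.
apply: (build_H Y_intertwining Wds Yact act1) => // [al a v Wv|al a v Wv].
  by have [] := Wv a.
exact: yE.
Qed.

End FromY.

(** * Finite generation and the functors *)

Section Generation.
Variables (k : fieldType) (I : set k) (r n : nat) (zeta : k).
Local Notation P := {mpoly k[n]}.
Local Notation wt := (weight I r n).
Hypothesis zetaP : r.-primitive_root zeta.
Variables (V : lmodType k) (actH : Halg I r n -> V -> V).
Variables (actY : Yalg k r n -> V -> V) (W : wt -> set V) (x : 'I_n -> V -> V).
Variables tau f : 'I_n.-1 -> V -> V.
Hypothesis R : realization zeta actH actY W x tau f.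

Let itw := rl_itw R.
Let Wds := rl_ds R.
Let Wsub := itw_sub itw.
Let xact := itw_nil itw.
Let xL := nil_lin xact.
Let xC := nil_comm xact.
Let xN := nil_nil xact.
Let xW := itw_xW itw.
Local Notation "p \@ v" := (pact x p v) (at level 42, right associativity).

Let H_unit v : exists b, actH b v = v.
Proof.
have [s [_ _ vE]] := proj_sum Wds v; exists (\sum_(al <- s) H1 al).
have bL u : linear (actH^~ u) by case: (rl_H R).
by rewrite (rlin_sum (bL v)) [RHS]vE; apply: eq_bigr => al _; rewrite (rl_H1 R).
Qed.

Let Y_unit v : exists b, actY b v = v.
Proof. by exists (Y1 k r n); rewrite (rl_Y1 R). Qed.

Let sum_proj (S : set V) v : subspace S -> (forall al, S (projection W al v)) -> S v.
Proof.
by move=> HS Sv; have [s [_ _ ->]] := proj_sum Wds v; apply: subspace_sum.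
Qed.

Let WS_surj (S : set V) p al v : subspace S ->
  (forall be a u, W be u -> S u -> S (x a u)) -> unit_act x p ->
  W al v -> S v -> exists2 w, W al w /\ S w & v = p \@ w.
Proof.
move=> HS Sx [_ sp] Wv Sv; apply: (sp (W al `&` S)%classic) => //.
  exact: subspaceI.
by move=> a w [Ww Sw]; split; [apply: xW|apply: (Sx al)].
Qed.

Let pact_S (S : set V) p al v : subspace S ->
  (forall be a u, W be u -> S u -> S (x a u)) -> W al v -> S v -> S (p \@ v).
Proof.
move=> HS Sx Wv Sv; have : (W al `&` S)%classic (p \@ v); last by case.
apply: pact_stable => //; first exact: subspaceI.
by move=> a w [Ww Sw]; split; [apply: xW|apply: (Sx al)].
Qed.

(** An H-stable subspace contains the weight components of its vectors, and division by [den_at]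
    stays inside its intersection with a weight space; so the formula for [f] does not leave it. *)
Lemma H_stable_Y (S : set V) : subspace S ->
  (forall g v, S v -> S (actH (pi_alg (@Hrel k I r n) (Gen g)) v)) ->
  forall g v, S v -> S (actY (pi_alg (@Yrel k r n) (Gen g)) v).
Proof.
move=> HS SH g v Sv.
have Sp al u : S u -> S (projection W al u).
  by move=> Su; rewrite -(rl_H1 R); apply: (SH (H1gen al)).
have Sx be a u : W be u -> S u -> S (x a u).
  move=> Wu Su; rewrite -{1}(proj_id Wsub Wds Wu) -(rl_Hx R).
  exact: (SH (Hxgen a be)).
have St be i u : W be u -> S u -> S (tau i u).
  move=> Wu Su; rewrite -{1}(proj_id Wsub Wds Wu) -(rl_Ht R).
  exact: (SH (Htgen i be)).
have [s [_ _ ->]] := proj_sum Wds v; rewrite (rlin_sum (actY_linear R _)).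
apply: subspace_sum => // al; have Su := Sp al v Sv.
have Wu := proj_in Wds al v; move: (projection W al v) Su Wu => u Su Wu.
case: g => [|a|i|a].
- by rewrite [actY _ u](rl_Y1 R).
- by rewrite [actY _ u](rl_Yt R a Wu); apply: subspaceZ.
- rewrite [actY _ u](rl_Yf R).
  have ud : unit_act x (den_at i al) by apply: den_unit.
  have [w [Ww Sw] ->] := WS_surj HS Sx ud Wu Su.
  rewrite [f i _](itw_f itw) //; apply: subspaceB => //.
    apply: (St al); first exact: (pactW itw).
    exact: (pact_S _ HS Sx Ww).
  exact: (pact_S _ HS Sx Ww).
- rewrite [actY _ u](rl_Yy R a Wu); apply: subspaceD => //.
    exact: (Sx al).
  exact: subspaceZ.
Qed.

(* The subspace stable under H is that of the v whose weight components all   *)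
(* lie in S.                                                                  *)
Lemma Y_stable_H (S : set V) : subspace S ->
  (forall g v, S v -> S (actY (pi_alg (@Yrel k r n) (Gen g)) v)) ->
  forall g v, (forall al, S (projection W al v)) ->
  forall be, S (projection W be (actH (pi_alg (@Hrel k I r n) (Gen g)) v)).
Proof.
move=> HS SY g v Sv be.
have Sp al ga u : W al u -> S u -> S (projection W ga u).
  move=> Wu Su; rewrite (proj_on Wsub Wds ga Wu).
  by case: (_ == _) => //; apply: subspace0.
have Sx al a u : W al u -> S u -> S (x a u).
  move=> Wu Su; rewrite -(yshift_on R a Wu); apply: subspaceB => //.
    exact: (SY (Yygen a)).
  exact: subspaceZ.
case: g => [al|a al|i al].
- by rewrite [actH _ v](rl_H1 R); apply: (Sp al) => //; apply: (proj_in Wds).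
- rewrite [actH _ v](rl_Hx R); have Wu := proj_in Wds al v.
  by apply: (Sp al); [apply: xW|apply: (Sx al)].
rewrite [actH _ v](rl_Ht R); have Wu := proj_in Wds al v.
apply: (Sp (swt i al)); first exact: (itw_tauW itw).
have uq : unit_act x (qnum_at i al) by apply: qnum_unit.
have [w [Ww Sw] uE] := WS_surj HS Sx uq Wu (Sv al).
rewrite (tau_on R Ww uE) -(rl_Yf R); apply: subspaceD => //.
  apply: (SY (Yfgen i)); exact: (pact_S _ HS Sx Ww).
exact: (pact_S _ HS Sx Ww).
Qed.

(** The new generators are the finitely many nonzero weight components of the old ones. This avoids
    having to show that a Y-stable subspace is graded: [Y_stable_H] is about the vectors whose
    components all lie in it. *)
Lemma fg_Y_of_H : finitely_generated actH -> finitely_generated actY.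
Proof.
move=> /(fg_stable (rl_H R) H_unit)[s Hs]; apply/(fg_stable (rl_Y R) Y_unit).
have [ws _ supp] := proj_supp Wds s.
exists [seq projection W al v | v <- s, al <- ws] => S HS SY Ss v.
apply: sum_proj => // al; move: v al.
apply: (Hs (fun v => forall al, S (projection W al v))).
- split=> [al|a u v Su Sv al].
    by rewrite (rlin0 (proj_linear Wsub Wds al)); apply: subspace0.
  by rewrite (proj_linear Wsub Wds al); case: HS => _; apply.
- by move=> g v Sv al; apply: Y_stable_H.
- move=> v vs al; have [alw|alw] := boolP (al \in ws).
    by apply: Ss; apply/allpairsP; exists (v, al).
  by rewrite (supp v vs al alw); apply: subspace0.
Qed.

Lemma fg_H_of_Y : finitely_generated actY -> finitely_generated actH.
Proof.
move=> /(fg_stable (rl_Y R) Y_unit)[s Hs]; apply/(fg_stable (rl_H R) H_unit).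
by exists s => S HS SH Ss; apply: Hs => //; apply: H_stable_Y.
Qed.

Lemma realization_CGamma : finitely_generated actY -> CGamma I r n V actH.
Proof.
move=> fgY; have HW : Hweight actH = W by apply/funext => al; exact: (HweightE R).
split; [exact: (rl_H R)|by rewrite HW|exact: fg_H_of_Y|].
move=> al a v; rewrite HW => Wv; have [d dv] := xN a v; exists d.
suff [-> _] : iter d (actH (Hx a al)) v = iter d (x a) v /\ W al (iter d (x a) v) by [].
elim: d {dv} => [//|d [IH IW]] /=; rewrite IH (rl_Hx R) (proj_id Wsub Wds IW).
by split=> //; apply: xW.
Qed.

Lemma realization_CK : finitely_generated actH -> CK r n I zeta V actY.
Proof.
move=> fgH; have YW : (fun al : wt => Yweight zeta actY al) = W.
  by apply/funext => al; exact: (YweightE zetaP R).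
split; [exact: (rl_Y R)|exact: (rl_Y1 R)|exact: fg_Y_of_H|].
by have := Wds; rewrite -YW.
Qed.

End Generation.

(** * The two functors and the natural isomorphisms *)

Section Functors.
Variables (k : fieldType) (I : set k) (r n : nat) (zeta : k).
Hypothesis zetaP : r.-primitive_root zeta.
Local Notation C := (module_category (CGamma I r n)).
Local Notation D := (module_category (CK r n I zeta)).

Definition Phi_real (M : C) := H_realization zetaP (mactP M).
Definition Psi_real (N : D) := Y_realization zetaP (mactP N).

Lemma Phi_actP (M : C) : CK r n I zeta _ (H_to_Y zeta (@mact _ _ _ M)).
Proof.
apply: (realization_CK zetaP (Phi_real M)).
by case: (mactP M).
Qed.

Lemma Psi_actP (N : D) : CGamma I r n _ (@Y_to_H k I r n zeta _ (@mact _ _ _ N)).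
Proof.
apply: (realization_CGamma (Psi_real N)).
by case: (mactP N).
Qed.

Lemma Phi_hom (M N : C) (g : Defs.hom M N) b v :
  underlying g (H_to_Y zeta (@mact _ _ _ M) b v) =
  H_to_Y zeta (@mact _ _ _ N) b (underlying g v).
Proof.
apply: (hom_YH_of_HY (Phi_real M) (Phi_real N)); first exact: modfun_linear.
exact: modfun_act.
Qed.

Lemma Psi_hom (M N : D) (g : Defs.hom M N) b v :
  underlying g (@Y_to_H k I r n zeta _ (@mact _ _ _ M) b v) =
  @Y_to_H k I r n zeta _ (@mact _ _ _ N) b (underlying g v).
Proof.
apply: (hom_HY_of_YH zetaP (Psi_real M) (Psi_real N)); first exact: modfun_linear.
exact: modfun_act.
Qed.

Definition Phi : same_space_functor (CGamma I r n) (CK r n I zeta) :=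
  SameSpaceFunctor Phi_actP Phi_hom.
Definition Psi : same_space_functor (CK r n I zeta) (CGamma I r n) :=
  SameSpaceFunctor Psi_actP Psi_hom.

(** Both realizations contain the same Y-action, namely that of [Phi M], so the identity map also
    commutes with the two H-actions. *)
Lemma Psi_Phi_act (M : C) b (v : carrier M) :
  mact b v = @mact _ _ _ (Psi (Phi M)) b v.
Proof.
exact: (hom_HY_of_YH zetaP (Phi_real M) (Psi_real (Phi M)) (g := id)).
Qed.

Lemma Phi_Psi_act (N : D) b (v : carrier N) :
  mact b v = @mact _ _ _ (Phi (Psi N)) b v.
Proof.
exact: (hom_YH_of_HY (Psi_real N) (Phi_real (Psi N)) (g := id)).
Qed.

Definition eta_hom (M : C) : Defs.hom M (functor_comp Psi Phi M) :=
  @ModHom _ _ _ M (functor_comp Psi Phi M) id (fun _ _ _ => erefl) (@Psi_Phi_act M).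
Definition eta_inv (M : C) : Defs.hom (functor_comp Psi Phi M) M :=
  @ModHom _ _ _ (functor_comp Psi Phi M) M id (fun _ _ _ => erefl)
    (fun b v => esym (@Psi_Phi_act M b v)).
Definition eps_inv (N : D) : Defs.hom N (functor_comp Phi Psi N) :=
  @ModHom _ _ _ N (functor_comp Phi Psi N) id (fun _ _ _ => erefl) (@Phi_Psi_act N).
Definition eps_hom (N : D) : Defs.hom (functor_comp Phi Psi N) N :=
  @ModHom _ _ _ (functor_comp Phi Psi N) N id (fun _ _ _ => erefl)
    (fun b v => esym (@Phi_Psi_act N b v)).

(** Kept transparent, so that its components being the identity on vectors holds by computation. *)
Definition eta : nat_iso (functor_id C) (functor_comp Psi Phi).
Proof.
exists eta_hom eta_inv; first by move=> M; apply: modhom_ext.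
  by move=> M; apply: modhom_ext.
by move=> M N g; apply: modhom_ext.
Defined.

Definition eps : nat_iso (functor_comp Phi Psi) (functor_id D).
Proof.
exists eps_hom eps_inv; first by move=> M; apply: modhom_ext.
  by move=> M; apply: modhom_ext.
by move=> M N g; apply: modhom_ext.
Defined.

Lemma Phi_formulasP : Phi_formulas Phi.
Proof. by move=> M al v Wv; apply: (Phi_formulas_on (Phi_real M) Wv). Qed.

Lemma Psi_formulasP : Psi_formulas Psi.
Proof. by move=> N al; apply: (Psi_formulas_on zetaP (Psi_real N) al). Qed.

End Functors.

Theorem theorem4p2 (k : fieldType) (r n : nat) (hr : (0 < r)%N) (hn : (0 < n)%N)
    (zeta : k) (hzeta : (r.-primitive_root zeta)%R)
    (I : set k) (hI : quiver_connected I) :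
  let C := module_category (CGamma I r n) in
  let D := module_category (CK r n I zeta) in
  exists (Phi : same_space_functor (CGamma I r n) (CK r n I zeta))
         (Psi : same_space_functor (CK r n I zeta) (CGamma I r n)),
    [/\ exists (eta : nat_iso (functor_id C) (functor_comp Psi Phi))
               (eps : nat_iso (functor_comp Phi Psi) (functor_id D)),
          (forall (M : C) (v : carrier M), underlying (eta M) v = v) /\
          (forall (N : D) (v : carrier N), underlying (eps N) v = v),
        Phi_formulas Phi &
        Psi_formulas Psi].
Proof.
exists (Phi I n hzeta), (Psi I n hzeta).
split; [|exact: Phi_formulasP|exact: Psi_formulasP].
by exists (eta I n hzeta), (eps I n hzeta).
Qed.
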